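(* Let $P = \{x\in\mathbb{R}^n : \langle x,a_i\rangle \leq 1,\ 1\leq i\leq m\}$ be a centered $n$-dimensional polytope, given by its irredundant description, with facets $F_i = P\cap\{x\in\mathbb{R}^n:\langle a_i,x\rangle=1\}$ and cones $C_i=\mathrm{conv}(\{0\}\cup F_i)$ for $1\leq i\leq m$. For an affine subspace $A\subseteq\mathbb{R}^n$ consider the equality $$\sum_{j:\,a_j\in A} \mathrm{vol}(C_j)= \frac{\dim A+1}{n+1}\,\mathrm{vol}(P).\qquad ( * )$$ (i) If $A=\{a_i\}$ for some $1\leq i\leq m$, then $( * )$ holds if and only if $P$ is a pyramid with base $F_i$. (ii) If $v$ is a vertex of $P$ and $A$ is the hyperplane that is the affine hull of all those $a_i$ for which the facet $F_i$ contains $v$, then $( * )$ holds if and only if $P$ is a pyramid with apex $v$.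
   Context: A polytope is the convex hull of a finite set of points in $\mathbb{R}^n$. Every $n$-dimensional polytope $P\subset\mathbb{R}^n$ with $0$ in its interior has a unique (irredundant) representation $P=\{x\in\mathbb{R}^n:\langle a_i,x\rangle\leq 1,\ 1\leq i\leq m\}$, where the $a_i\in\mathbb{R}^n\setminus\{0\}$ are pairwise different and the sets $F_i=P\cap\{x:\langle a_i,x\rangle=1\}$ are exactly the facets (the $(n-1)$-dimensional faces) of $P$. The polytope $P$ is called centered if its centroid $\mathrm{c}(P)=\mathrm{vol}(P)^{-1}\int_P x\,dx$ equals $0$ (then $0$ is an interior point of $P$). $\mathrm{vol}$ is $n$-dimensional Lebesgue measure. An $n$-dimensional polytope $P$ is a pyramid with base $F$ and apex $v$ if $P=\mathrm{conv}(F\cup\{v\})$ for an $(n-1)$-dimensional polytope $F$ and a point $v\notin\mathrm{aff}\,F$; ''pyramid with base $F$'' means that such an apex exists, and ''pyramid with apex $v$'' means that such a base exists. *)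

(* Defs.v *)
From HB Require Import structures.
From mathcomp Require Import all_boot all_order all_algebra.
From mathcomp Require Import all_classical all_reals all_analysis.

Set Implicit Arguments.
Unset Strict Implicit.
Unset Printing Implicit Defensive.

Import Order.TTheory GRing.Theory Num.Theory.
Import numFieldNormedType.Exports.

Local Open Scope classical_set_scope.
Local Open Scope ring_scope.

(* The measurable structure on 'rV[T]_n is the one generated by the coordinate
   projections, as for n.-tuple T in the library; for T = R it is the Borel
   sigma-algebra of R^n. *)
Definition measure_rV_display : measure_display -> measure_display.
Proof. exact. Qed.

Section measurable_rV.
Context {d : measure_display} {T : sigmaRingType d}.
Variable n : nat.

Definition coord_rV (i : 'I_n) (x : 'rV[T]_n) : T := x ord0 i.

Let rV_set0 : g_sigma_preimage coord_rV set0.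
Proof. exact: sigma_algebra0. Qed.

Let rV_setC A : g_sigma_preimage coord_rV A -> g_sigma_preimage coord_rV (~` A).
Proof. exact: sigma_algebraC. Qed.

Let rV_bigcup (F : (set 'rV[T]_n)^nat) :
  (forall i, g_sigma_preimage coord_rV (F i)) ->
  g_sigma_preimage coord_rV (\bigcup_i (F i)).
Proof. exact: sigma_algebra_bigcup. Qed.

HB.instance Definition _ := @isMeasurable.Build (measure_rV_display d)
  'rV[T]_n (g_sigma_preimage coord_rV) rV_set0 rV_setC rV_bigcup.

End measurable_rV.

Section measurable_rV_theory.
Context {d d' : measure_display} {T : measurableType d} {T1 : measurableType d'}.

Lemma measurable_coord_rV n (i : 'I_n) :
  measurable_fun [set: 'rV[T]_n] (coord_rV i).
Proof.
move=> _ Y mY; rewrite setTI; apply: sub_sigma_algebra => /=.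
rewrite -bigcup_seq/=; exists i => /=; first by rewrite mem_index_enum.
by exists Y => //; rewrite setTI.
Qed.

Lemma measurable_fun_rVP n (f : T1 -> 'rV[T]_n) :
  (forall i, measurable_fun [set: T1] (coord_rV i \o f)) ->
  measurable_fun [set: T1] f.
Proof.
move=> mf.
suff H : g_sigma_preimage (fun i => coord_rV i \o f) `<=` measurable.
  move=> _ A mA; apply: H.
  by rewrite g_sigma_preimage_comp; exists A.
apply: smallest_sub; first exact: sigma_algebra_measurable.
rewrite -bigcup_seq => A [i _ [B mB <-]].
exact: mf.
Qed.

End measurable_rV_theory.

Section rV_cons.
Context {d : measure_display} {T : measurableType d}.

Definition rV_cons n (p : T * 'rV[T]_n) : 'rV[T]_n.+1 :=
  row_mx (\row_(j < 1) p.1) p.2.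

Definition rV_split n (x : 'rV[T]_n.+1) : T * 'rV[T]_n :=
  (x ord0 ord0, \row_j x ord0 (lift ord0 j)).

Lemma rV_cons0 n (p : T * 'rV[T]_n) : rV_cons p ord0 ord0 = p.1.
Proof.
rewrite /rV_cons (_ : ord0 = lshift n (ord0 : 'I_1)); last exact: val_inj.
by rewrite (@row_mxEl _ 1 1 n) mxE.
Qed.

Lemma rV_consS n (p : T * 'rV[T]_n) (j : 'I_n) :
  rV_cons p ord0 (lift ord0 j) = p.2 ord0 j.
Proof.
rewrite /rV_cons (_ : lift ord0 j = rshift 1 j); last exact: val_inj.
by rewrite (@row_mxEr _ 1 1 n).
Qed.

Lemma rV_consK n : cancel (@rV_cons n) (@rV_split n).
Proof.
move=> p; rewrite /rV_split rV_cons0 [RHS]surjective_pairing; congr pair.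
by apply/rowP => j; rewrite mxE rV_consS.
Qed.

Lemma measurable_rV_cons n : measurable_fun [set: T * 'rV[T]_n] (@rV_cons n).
Proof.
apply: measurable_fun_rVP => i.
have [->|[j ->]] : i = ord0 \/ exists j, i = lift ord0 j.
  by case: (unliftP ord0 i) => [j ->|->]; [right; exists j|left].
- rewrite (_ : _ \o _ = fst); first exact: measurable_fst.
  by apply/funext => p /=; rewrite /coord_rV rV_cons0.
- rewrite (_ : _ \o _ = coord_rV j \o snd).
    by apply: measurableT_comp; [exact: measurable_coord_rV|exact: measurable_snd].
  by apply/funext => p /=; rewrite /coord_rV rV_consS.
Qed.

Lemma measurable_rV_split n : measurable_fun [set: 'rV[T]_n.+1] (@rV_split n).
Proof.
apply/measurable_fun_pairP; split; first exact: (measurable_coord_rV ord0).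
apply: measurable_fun_rVP => i.
rewrite (_ : _ \o _ = coord_rV (lift ord0 i)); first exact: measurable_coord_rV.
by apply/funext => x; rewrite /= /coord_rV mxE.
Qed.

End rV_cons.

(* Lebesgue measure on R^n = 'rV[R]_n, by iterated products: the unit mass of
   the point when n = 0, and the image of lambda_1 \x lambda_n under
   (t, x) |-> (t, x_0, ..., x_(n-1)) in dimension n.+1. The box formula
   lebesgue_rV_box below characterizes it. *)
Section lebesgue_rV.
Variable R : realType.
Local Notation mR := (measurableTypeR R).
Local Open Scope ereal_scope.

Section succ.
Variables (n : nat) (mu : {sigma_finite_measure set 'rV[mR]_n -> \bar R}).

Definition lebesgue_rV_succ : set 'rV[mR]_n.+1 -> \bar R :=
  pushforward (@lebesgue_measure R \x mu) (@rV_cons _ mR n).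

Let succ0 : lebesgue_rV_succ set0 = 0.
Proof. by rewrite /lebesgue_rV_succ /pushforward preimage_set0 measure0. Qed.

Let succ_ge0 A : 0 <= lebesgue_rV_succ A.
Proof. by rewrite /lebesgue_rV_succ /pushforward measure_ge0. Qed.

Let measurable_preimage (A : set 'rV[mR]_n.+1) :
  measurable A -> measurable ((@rV_cons _ mR n) @^-1` A).
Proof. by move=> mA; rewrite -[X in measurable X]setTI; exact: measurable_rV_cons. Qed.

Let succ_sigma_additive : semi_sigma_additive lebesgue_rV_succ.
Proof.
move=> F mF tF mUF; rewrite /lebesgue_rV_succ /pushforward preimage_bigcup.
apply: measure_semi_sigma_additive.
- by move=> k; exact: measurable_preimage.
- apply/trivIsetP => /= i j _ _ ij; rewrite -preimage_setI.
  by move/trivIsetP : tF => /(_ _ _ _ _ ij) ->//; rewrite preimage_set0.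
- by rewrite -preimage_bigcup; exact: measurable_preimage.
Qed.

HB.instance Definition _ := isMeasure.Build _ _ _ lebesgue_rV_succ
  succ0 succ_ge0 succ_sigma_additive.

Let succ_sigma_finite : sigma_finite setT lebesgue_rV_succ.
Proof.
have /sigma_finiteP[F [FT ndF Foo]] := sigma_finiteT (@lebesgue_measure R).
have /sigma_finiteP[G [GT ndG Goo]] := sigma_finiteT mu.
exists (fun k => (@rV_split _ mR n) @^-1` (F k `*` G k)).
  apply/esym; rewrite -subTset => x _.
  have [i _ Fi] : (\bigcup_i F i) (rV_split x).1 by rewrite -FT.
  have [j _ Gj] : (\bigcup_i G i) (rV_split x).2 by rewrite -GT.
  exists (maxn i j) => //; split.
    by move: Fi; exact/subsetPset/ndF/leq_maxl.
  by move: Gj; exact/subsetPset/ndG/leq_maxr.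
move=> k; have [mFk Fk] := Foo k; have [mGk Gk] := Goo k; split.
  rewrite -[X in measurable X]setTI; apply: measurable_rV_split => //.
  exact: measurableX.
rewrite /lebesgue_rV_succ /pushforward (_ : _ @^-1` _ = F k `*` G k).
  by rewrite product_measure1E// lte_mul_pinfty// ge0_fin_numE.
by rewrite -comp_preimage (_ : _ \o _ = id)//; apply/funext => p; exact: rV_consK.
Qed.

HB.instance Definition _ := Measure_isSigmaFinite.Build _ _ _ lebesgue_rV_succ
  succ_sigma_finite.

End succ.

Fixpoint lebesgue_rV n : {sigma_finite_measure set 'rV[mR]_n -> \bar R} :=
  if n is k.+1 then lebesgue_rV_succ (lebesgue_rV k) else \d_(0%R : 'rV[mR]_0).

Lemma lebesgue_rV_box n (A : 'I_n -> set mR) : (forall i, measurable (A i)) ->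
  lebesgue_rV n [set x | forall i, A i (x ord0 i)] =
  \prod_(i < n) lebesgue_measure (A i).
Proof.
elim: n A => [|n IH] A mA.
  by rewrite big_ord0 /= diracE mem_set// => -[].
rewrite big_ord_recl -IH//=.
pose B : set 'rV[mR]_n := [set x | forall i, A (lift ord0 i) (x ord0 i)].
have mB : measurable B.
  rewrite (_ : B = \bigcap_(i in [set: 'I_n])
      ((coord_rV i : 'rV[mR]_n -> mR) @^-1` A (lift ord0 i))).
    apply: fin_bigcap_measurable => // i _.
    by rewrite -[X in measurable X]setTI; exact: measurable_coord_rV.
  by apply/seteqP; split => x /= H i; [move=> _|]; exact: H.
rewrite -[X in _ = _ * lebesgue_rV n X]/B -product_measure1E//.
rewrite /lebesgue_rV_succ /pushforward; congr (_ _).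
apply/seteqP; split => [[t x]|[t x]] /=.
  move=> H; split; first by have := H ord0; rewrite rV_cons0.
  by move=> i; have := H (lift ord0 i); rewrite rV_consS.
move=> [H0 HS] i; case: (unliftP ord0 i) => [j ->|->].
  by rewrite rV_consS; exact: HS.
by rewrite rV_cons0.
Qed.

End lebesgue_rV.

Section volume.
Context {R : realType} {n : nat}.
Implicit Types (P : set 'rV[R]_n).

Definition vol P : \bar R := lebesgue_rV R n P.

Definition centroid P : 'rV[R]_n :=
  (fine (vol P))^-1 *: \row_i \int[lebesgue_rV R n]_(x in P) (x ord0 i).

Definition centered P : Prop := centroid P = 0.

End volume.

Section polytopes.
Context {R : realType} {n : nat}.
Implicit Types (S A P F : set 'rV[R]_n) (L : {vspace 'rV[R]_n}) (u v x : 'rV[R]_n).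

Definition dotv u v : R := \sum_(i < n) u ord0 i * v ord0 i.

Definition conv_hull S : set 'rV[R]_n := [set x | exists (k : nat)
  (p : 'I_k -> 'rV[R]_n) (w : 'I_k -> R),
  [/\ forall i, S (p i), forall i, 0 <= w i, \sum_i w i = 1 &
      x = \sum_i w i *: p i]].

Definition aff_hull S : set 'rV[R]_n := [set x | exists (k : nat)
  (p : 'I_k -> 'rV[R]_n) (w : 'I_k -> R),
  [/\ forall i, S (p i), \sum_i w i = 1 & x = \sum_i w i *: p i]].

(* The linear subspace L such that the nonempty affine subspace A is a
   translate of L; the value 0 is junk, taken when A is not of this form. *)
Definition direction A : {vspace 'rV[R]_n} :=
  xget 0%VS [set L | exists2 x, A x & A = [set x + y | y in [set y | y \in L]]].

(* Dimension of the affine hull; the empty set has dimension -1. *)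
Definition adim S : int :=
  if `[< aff_hull S = set0 >] then - 1 else (\dim (direction (aff_hull S)))%:Z.

Definition is_hyperplane A : Prop := aff_hull A = A /\ adim A = n%:Z - 1.

Definition is_polytope P : Prop :=
  exists s : seq 'rV[R]_n, P = conv_hull [set` s].

Definition is_face P F : Prop := exists (u : 'rV[R]_n) (b : R),
  (forall x, P x -> dotv u x <= b) /\ F = P `&` [set x | dotv u x = b].

Definition is_facet P F : Prop := is_face P F /\ adim F = adim P - 1.

Definition is_vertex P v : Prop := is_face P [set v].

Definition is_pyramid P F v : Prop :=
  [/\ is_polytope F, adim F = adim P - 1, ~ aff_hull F v & P = conv_hull (F `|` [set v])].

Definition pyramid_with_base P F : Prop := exists v, is_pyramid P F v.

Definition pyramid_with_apex P v : Prop := exists F, is_pyramid P F v.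

Definition facet_of P (a : 'rV[R]_n) : set 'rV[R]_n :=
  P `&` [set x | dotv a x = 1].

Definition cone_of P (a : 'rV[R]_n) : set 'rV[R]_n := conv_hull ([set 0] `|` facet_of P a).

Definition irredundant_description (m : nat) (a : 'I_m -> 'rV[R]_n) P : Prop :=
  [/\ P = [set x | forall i, dotv (a i) x <= 1],
      forall i, a i != 0,
      injective a &
      forall F, is_facet P F <-> exists i, F = facet_of P (a i)].

Definition cone_volume_equality (m : nat) (a : 'I_m -> 'rV[R]_n) P A : Prop :=
  (\sum_(j < m | a j \in A) vol (cone_of P (a j)) =
   ((adim A + 1)%:~R / n.+1%:R)%:E * vol P)%E.

End polytopes.

(* Main.v *)
(* Let l_j(x) = 1 - <a_j, x>, V = vol P, and let d be the dimension. For p in P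
   the sets conv(p, F_j) tile P, and vol conv(p, F_j) = l_j(p) vol C_j, so
   V = sum_j l_j(p) vol C_j. For a vertex v the sum runs over the facets missing
   v, and P is a pyramid with apex v iff there is exactly one of them.

   Contracting P towards v shows that int_P f >= f(v) V / (d+1) for every concave
   f >= 0. As P is centered, int_P l_j = V, hence l_j(v) <= d+1. If the equality
   of (ii) holds, then l_j(v) = d+1 for every facet missing v, and two such facets
   would contradict the inequality applied to f = min(l_j, l_k).

   Conversely, and for (i), one needs (d+1) vol C_i <= V, with equality only for
   pyramids over F_i. Let f(u) be the (d-1)-volume of the section of P at height
   l_i = u, and g the same function for a pyramid over F_i of volume V. By
   Brunn-Minkowski f^(1/(d-1)) is concave while g^(1/(d-1)) is affine and agrees
   with it at 0, so f - g changes sign at most once, from + to -; comparing first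
   moments gives V = int u f(u) du <= int u g(u) du = V^2 / ((d+1) vol C_i), and
   the inequality is strict unless P is as high as that pyramid. *)
Require Import Defs.
From mathcomp Require Import all_boot all_order all_algebra.
From mathcomp Require Import all_classical all_reals all_analysis.
From mathcomp Require Import measurable_realfun lra.

Set Implicit Arguments.
Unset Strict Implicit.
Unset Printing Implicit Defensive.

Import Order.TTheory GRing.Theory Num.Theory.

Local Open Scope classical_set_scope.
Local Open Scope ring_scope.

(** * Slices and fibers of Lebesgue measure *)

Section slices.
Variable R : realType.
Local Notation mR := (measurableTypeR R).
Local Notation mu := (@lebesgue_measure R).
Local Open Scope ereal_scope.

(** In the code the space is R^(n+1), so d is [n.+1] and d+1 is [n.+2]. Equality (ii) is used in
    complementary form: all cones together have volume V, so it says that those over the facets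
    missing v have total volume V/(d+1). Weighted by l_j(v) <= d+1, the same volumes add up to V,
    which forces every such l_j(v) to be d+1. The step from pyramid to equality is the same in (i)
    and (ii): V = l_i(v) vol C_i <= (d+1) vol C_i meets the first-moment inequality in the other
    direction. No determinant is computed: [scales] records how a map changes volumes, and Tonelli
    reduces the maps needed (translations, dilations, x + <b, x> w) to affine maps of the line. The
    sets conv(p, F_j) are given by inequalities rather than as hulls, which makes measurability and
    overlaps easy to treat. The volume argument knows P only through a bound, a relative interior
    point of each facet, and the identities int_P l_j = V. *)

Definition slice n (S : set 'rV[mR]_n.+1) (t : mR) : set 'rV[mR]_n :=
  [set x | S (rV_cons (t, x))].

Definition fiber n (S : set 'rV[mR]_n.+1) (x : 'rV[mR]_n) : set mR :=
  [set t | S (rV_cons (t, x))].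

Lemma measurable_cons_preimage n (S : set 'rV[mR]_n.+1) : measurable S ->
  measurable ((@rV_cons _ mR n) @^-1` S).
Proof. by move=> mS; rewrite -[X in measurable X]setTI; exact: measurable_rV_cons. Qed.

Lemma sliceE n (S : set 'rV[mR]_n.+1) t :
  slice S t = xsection ((@rV_cons _ mR n) @^-1` S) t.
Proof. by apply/seteqP; split=> x Sx; [apply: mem_set|have := set_mem Sx]. Qed.

Lemma fiberE n (S : set 'rV[mR]_n.+1) x :
  fiber S x = ysection ((@rV_cons _ mR n) @^-1` S) x.
Proof. by apply/seteqP; split=> t St; [apply: mem_set|have := set_mem St]. Qed.

Lemma measurable_slice n (S : set 'rV[mR]_n.+1) t : measurable S -> measurable (slice S t).
Proof. by move=> mS; rewrite sliceE; by apply: measurable_xsection; exact: measurable_cons_preimage. Qed.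

Lemma measurable_fiber n (S : set 'rV[mR]_n.+1) x : measurable S -> measurable (fiber S x).
Proof. by move=> mS; rewrite fiberE; by apply: measurable_ysection; exact: measurable_cons_preimage. Qed.

Lemma measurable_vol_slice n (S : set 'rV[mR]_n.+1) : measurable S ->
  measurable_fun [set: mR] (fun t : mR => lebesgue_rV R n (slice S t) : \bar R).
Proof.
move=> mS; rewrite (_ : (fun t => _) =
  lebesgue_rV R n \o xsection ((@rV_cons _ mR n) @^-1` S)); last first.
  by apply/funext => t; rewrite sliceE.
exact: (measurable_fun_xsection (lebesgue_rV R n) (measurable_cons_preimage mS)).
Qed.

Lemma vol_slice n (S : set 'rV[mR]_n.+1) : measurable S ->
  lebesgue_rV R n.+1 S = \int[mu]_t lebesgue_rV R n (slice S t).
Proof.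
by move=> mS; under eq_integral do rewrite sliceE.
Qed.

(** Tonelli in the other order: a map that moves only the first coordinate can then be treated fiber
    by fiber. *)
Lemma vol_fiber n (S : set 'rV[mR]_n.+1) : measurable S ->
  lebesgue_rV R n.+1 S = \int[lebesgue_rV R n]_x mu (fiber S x).
Proof.
move=> mS; have mS' := measurable_cons_preimage mS.
rewrite vol_slice//; under eq_integral do rewrite sliceE.
under [RHS]eq_integral do rewrite fiberE.
have := indic_fubini_tonelli mu (lebesgue_rV R n) mS'.
by rewrite indic_fubini_tonelli_FE// indic_fubini_tonelli_GE.
Qed.

Lemma ge0_integral_slice n (f : 'rV[mR]_n.+1 -> \bar R) :
  measurable_fun setT f -> (forall x, 0 <= f x) ->
  \int[lebesgue_rV R n.+1]_x f x =
  \int[mu]_t \int[lebesgue_rV R n]_x f (rV_cons (t, x)).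
Proof.
move=> mf f0.
rewrite (_ : \int[lebesgue_rV R n.+1]_x f x =
   \int[pushforward (mu \x lebesgue_rV R n) (@rV_cons _ mR n)]_x f x)//.
rewrite ge0_integral_pushforward//; last exact: measurable_rV_cons.
rewrite preimage_setT fubini_tonelli1//.
exact: measurableT_comp mf (@measurable_rV_cons _ mR n).
by move=> x; exact: f0.
Qed.

End slices.

(** * Maps scaling a measure *)

Lemma measurable_preimage d d' (X : measurableType d) (Y : measurableType d')
    (f : X -> Y) S :
  measurable_fun setT f -> measurable S -> measurable (f @^-1` S).
Proof. by move=> mf mS; rewrite -[X in measurable X]setTI; exact: mf. Qed.

(** Stated for preimages, so that images need not be shown measurable. For an invertible linear [f]
    on R^n, [c] is the inverse of |det f|. *)
Definition scales {R : realType} {d} {X : measurableType d}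
    (mu : set X -> \bar R) (f : X -> X) (c : R) :=
  measurable_fun setT f /\
  forall S, measurable S -> mu (f @^-1` S) = (c%:E * mu S)%E.

Section scales_theory.
Context {R : realType} {d} {X : measurableType d}.
Variable mu : {measure set X -> \bar R}.
Implicit Types (f g : X -> X) (c k : R).
Local Open Scope ereal_scope.

Lemma scales_comp f g c k : scales mu f c -> scales mu g k ->
  scales mu (f \o g) (c * k)%R.
Proof.
move=> [mf fc] [mg gk]; split; first exact: measurableT_comp.
move=> S mS; rewrite comp_preimage gk; last exact: measurable_preimage.
by rewrite fc// muleA -EFinM mulrC.
Qed.

Lemma scales_inv f g c : cancel f g -> (0 < c)%R -> measurable_fun setT g ->
  scales mu f c -> scales mu g c^-1.
Proof.
move=> fgK c0 mg [mf fc]; split=> // S mS.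
have {2}-> : S = f @^-1` (g @^-1` S) by apply/seteqP; split=> x; rewrite /= fgK.
rewrite fc; last exact: measurable_preimage.
by rewrite muleA -EFinM mulVf ?mul1e// gt_eqF.
Qed.

Lemma ge0_integral_scales f c D (h : X -> \bar R) : scales mu f c -> (0 <= c)%R ->
  measurable D -> measurable_fun D h -> (forall x, D x -> 0 <= h x) ->
  \int[mu]_(x in f @^-1` D) h (f x) = c%:E * \int[mu]_(x in D) h x.
Proof.
move=> [mf fc] c0 mD mh h0.
rewrite -[LHS](@ge0_integral_pushforward _ _ _ _ _ _ mf mu D h)//; last first.
  by move=> y /set_mem; exact: h0.
rewrite -(@ge0_integral_mscale _ _ _ mu D mD (NngNum c0))//.
apply: (@eq_measure_integral _ _ _ D (mscale (NngNum c0) mu)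
  (pushforward mu f)) => A mA AD.
by rewrite /= /mscale /= -fc.
Qed.

End scales_theory.

(** * Affine maps of the line *)

Section affine_line.
Variable R : realType.
Local Notation mR := (measurableTypeR R).
Local Notation mu := (@lebesgue_measure R).

Lemma measurable_affine (u b : R) :
  measurable_fun [set: mR] ((fun t => u * t + b) : mR -> mR).
Proof.
by apply: measurable_funD => //; apply: measurable_funM.
Qed.

Lemma scales_affine (u b : R) : u != 0 ->
  scales mu (fun t : mR => u * t + b : mR) `|u|^-1.
Proof.
have pos (v w : R) : 0 < v -> scales mu (fun t : mR => v * t + w : mR) `|v|^-1.
  move=> v0; split; first exact: measurable_affine.
  have H : forall A : set mR, measurable A ->
      mu A = (`|v|%:E * mu ((fun t : mR => (v * t + w)%R : mR) @^-1` A))%E.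
    (* Lebesgue measure is determined by half-open intervals, on which the rescaled pushforward is
       computed directly. *)
    apply: (lebesgue_measure_unique (mu := mscale (NngNum (normr_ge0 v))
      (pushforward mu (fun t : mR => v * t + w : mR)))).
      exact: measurable_affine.
    move=> ? _ [[a c] _ <-].
    transitivity ((`|v|%:E * mu `]((a - w) / v)%R, ((c - w) / v)%R]%classic)%E)%E; last first.
      rewrite /= /mscale /pushforward /=; congr (_ * mu _)%E; apply/seteqP; split => t /=.
        by rewrite !in_itv/= ltr_pdivrMr// ler_pdivlMr// ltrBlDr lerBrDr mulrC.
      by rewrite !in_itv/= ltr_pdivrMr// ler_pdivlMr// ltrBlDr lerBrDr mulrC.
    rewrite !lebesgue_measure_itv/= !lte_fin ltr_pM2r ?invr_gt0// ltrD2r.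
    case: ifPn => _; last by rewrite mule0.
    rewrite -!EFinB -EFinM -mulrBl gtr0_norm//; congr EFin.
    by rewrite mulrCA divff ?gt_eqF// mulr1; lra.
  move=> S mS; rewrite (H _ mS) muleA -EFinM.
  by rewrite mulVf ?mul1e// normr_eq0 gt_eqF.
(* Negative slopes are reduced to positive ones by the reflection [-%R], since half-open intervals
   are not stable under it. *)
have opp : scales mu (-%R : mR -> mR) 1.
  split; first exact: oppr_measurable.
  by move=> S mS; rewrite mul1e; exact: lebesgue_measureN.
move=> u0; have [ugt0|ule0] := ltrP 0 u; first exact: pos.
have ult0 : u < 0 by rewrite lt_neqAle u0.
have := scales_comp (pos (- u) b _) opp.
rewrite normrN mulr1 oppr_gt0 => /(_ ult0).
by congr scales; apply/funext => t /=; rewrite mulrNN.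
Qed.

End affine_line.

Section dot.
Context {R : realType} {n : nat}.
Implicit Types (u v x y : 'rV[R]_n) (s : R).

Lemma dotvDr u x y : dotv u (x + y) = dotv u x + dotv u y.
Proof. by rewrite /dotv -big_split; apply: eq_bigr => i _; rewrite mxE mulrDr. Qed.

Lemma dotvZr u s x : dotv u (s *: x) = s * dotv u x.
Proof. by rewrite /dotv mulr_sumr; apply: eq_bigr => i _; rewrite mxE mulrCA. Qed.

Lemma dotvC u x : dotv u x = dotv x u.
Proof. by apply: eq_bigr => i _; rewrite mulrC. Qed.

Lemma dotv0r u : dotv u 0 = 0.
Proof. by rewrite -(scale0r 0) dotvZr mul0r. Qed.

Lemma dotvNr u x : dotv u (- x) = - dotv u x.
Proof. by rewrite -scaleN1r dotvZr mulN1r. Qed.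

Lemma dotvBr u x y : dotv u (x - y) = dotv u x - dotv u y.
Proof. by rewrite dotvDr dotvNr. Qed.

Lemma dotvDl u x y : dotv (x + y) u = dotv x u + dotv y u.
Proof. by rewrite dotvC dotvDr !(dotvC u). Qed.

Lemma dotvZl u s x : dotv (s *: x) u = s * dotv x u.
Proof. by rewrite dotvC dotvZr (dotvC u). Qed.

Lemma dotv0l u : dotv 0 u = 0.
Proof. by rewrite dotvC dotv0r. Qed.

Lemma dotvNl u x : dotv (- x) u = - dotv x u.
Proof. by rewrite dotvC dotvNr (dotvC u). Qed.

Lemma dotvBl u x y : dotv (x - y) u = dotv x u - dotv y u.
Proof. by rewrite dotvDl dotvNl. Qed.

Lemma dotv_delta i x : dotv (delta_mx 0 i) x = x 0 i.
Proof.
rewrite /dotv (bigD1 i)//= mxE !eqxx mul1r big1 ?addr0// => j ji.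
by rewrite mxE (negbTE ji) andbF mul0r.
Qed.

Lemma dotv_gt0 u : u != 0 -> 0 < dotv u u.
Proof.
move=> /rV0Pn[i ui]; rewrite /dotv (bigD1 i)//= ltr_wpDr//.
  by apply: sumr_ge0 => j _; rewrite -expr2 sqr_ge0.
by rewrite -expr2 exprn_even_gt0.
Qed.

End dot.

(** * Triangular maps, rank-one perturbations of the identity, and charts *)

Section linear_scales.
Variable R : realType.
Local Notation mR := (measurableTypeR R).
Local Notation mu := (@lebesgue_measure R).

Lemma measurable_dotv n (u : 'rV[R]_n) :
  measurable_fun [set: 'rV[mR]_n] ((fun x : 'rV[mR]_n => dotv u x) : _ -> mR).
Proof.
apply: measurable_sum => i; apply: measurable_funM => //.
exact: (@measurable_coord_rV _ mR).
Qed.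

Lemma rV_consP n (x y : 'rV[mR]_n.+1) :
  x ord0 ord0 = y ord0 ord0 ->
  (forall j, x ord0 (lift ord0 j) = y ord0 (lift ord0 j)) -> x = y.
Proof.
move=> xy0 xyS; apply/rowP => i.
by case: (unliftP ord0 i) => [j ->|->].
Qed.

Lemma dotv_cons n (u : 'rV[R]_n.+1) (t : mR) (x : 'rV[mR]_n) :
  dotv u (rV_cons (t, x)) = u 0 0 * t + dotv (rV_split (u : 'rV[mR]_n.+1)).2 x.
Proof.
rewrite /dotv big_ord_recl rV_cons0; congr (_ + _).
by apply: eq_bigr => j _; rewrite rV_consS mxE.
Qed.

Lemma rVDE n (x y : 'rV[R]_n) i : (x + y) ord0 i = x ord0 i + y ord0 i.
Proof. by rewrite mxE. Qed.

Lemma rVZE n s (x : 'rV[R]_n) i : (s *: x) ord0 i = s * x ord0 i.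
Proof. by rewrite mxE. Qed.

Lemma rV_split2E n (x : 'rV[mR]_n.+1) j :
  (rV_split x).2 ord0 j = x ord0 (lift ord0 j).
Proof. by rewrite mxE. Qed.

Definition rVE := (rVDE, rVZE, rV_split2E, @rV_cons0 _ mR, @rV_consS _ mR).

(** Block triangular case: the new first coordinate depends on the old one only, so each slice is
    the preimage of a slice, and the two factors multiply. *)
Lemma scales_lower n (sg : mR -> mR) (L : mR -> 'rV[mR]_n -> 'rV[mR]_n) (c k : R)
    (T : 'rV[mR]_n.+1 -> 'rV[mR]_n.+1) : 0 <= c -> 0 <= k ->
  scales mu sg c -> (forall t, scales (lebesgue_rV R n) (L t) k) ->
  measurable_fun setT T ->
  (forall t x, T (rV_cons (t, x)) = rV_cons (sg t, L t x)) ->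
  scales (lebesgue_rV R n.+1) T (c * k).
Proof.
move=> c0 k0 sc Lk mT TE; split=> // S mS.
rewrite vol_slice; last exact: measurable_preimage.
have E t : slice (T @^-1` S) t = L t @^-1` slice S (sg t).
  by apply/seteqP; split=> x; rewrite /slice /= TE.
under eq_integral => t _.
  rewrite E (Lk t).2; last exact: measurable_slice.
  over.
have mF := measurable_vol_slice mS.
rewrite /= ge0_integralZl//=; last first.
  apply: (@measurableT_comp _ _ _ _ _ _ (fun t => lebesgue_rV R n (slice S t))) => //.
  exact: sc.1.
have := @ge0_integral_scales _ _ _ mu sg c setT (fun t => lebesgue_rV R n (slice S t)) sc c0.
rewrite preimage_setT => ->//; rewrite -vol_slice// muleA -EFinM.
by rewrite mulrC.
Qed.

(** The opposite triangular case: the other coordinates are fixed, and each fiber is mapped with the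
    same factor. *)
Lemma scales_upper n (sg : 'rV[mR]_n -> mR -> mR) (c : R)
    (T : 'rV[mR]_n.+1 -> 'rV[mR]_n.+1) : 0 <= c ->
  (forall x, scales mu (sg x) c) -> measurable_fun setT T ->
  (forall t x, T (rV_cons (t, x)) = rV_cons (sg x t, x)) ->
  scales (lebesgue_rV R n.+1) T c.
Proof.
move=> c0 sc mT TE; split=> // S mS.
rewrite vol_fiber; last exact: measurable_preimage.
have E x : fiber (T @^-1` S) x = sg x @^-1` fiber S x.
  by apply/seteqP; split=> t; rewrite /fiber /= TE.
under eq_integral => x _.
  rewrite E (sc x).2; last exact: measurable_fiber.
  over.
rewrite /= ge0_integralZl//=; first by rewrite -vol_fiber.
rewrite (_ : (fun x => _) = mu \o ysection ((@rV_cons _ mR n) @^-1` S)).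
  exact: (measurable_fun_ysection mu (measurable_cons_preimage mS)).
by apply/funext => x; rewrite fiberE.
Qed.

Lemma scales_shift (b : R) : scales mu (fun t : mR => 1 * t + b : mR) 1.
Proof. by have := scales_affine b (oner_neq0 R); rewrite normr1 invr1. Qed.

(** The map with matrix I + w b^T, of determinant 1 + <b, w>. Charts and the maps between sectors
    with different apexes are built from it. *)
Definition rank1 n (b w x : 'rV[R]_n) : 'rV[R]_n := x + dotv b x *: w.

Lemma measurable_rank1D n (b w z : 'rV[R]_n) :
  measurable_fun [set: 'rV[mR]_n] ((fun x => rank1 b w x + z) : 'rV[mR]_n -> 'rV[mR]_n).
Proof.
apply: measurable_fun_rVP => i.
rewrite (_ : _ \o _ = fun x : 'rV[mR]_n =>
    x ord0 i + dotv b x * w ord0 i + z ord0 i : mR); last first.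
  by apply/funext => x; rewrite /coord_rV /rank1 /= !mxE.
apply: measurable_funD => //; apply: measurable_funD.
  exact: (@measurable_coord_rV _ mR).
by apply: measurable_funM => //; exact: measurable_dotv.
Qed.

Lemma rank1E0 n (b x : 'rV[R]_n) : rank1 b 0 x = x.
Proof. by rewrite /rank1 scaler0 addr0. Qed.

Lemma scales_translate n (z : 'rV[R]_n) :
  scales (lebesgue_rV R n) ((fun x => x + z) : 'rV[mR]_n -> 'rV[mR]_n) 1.
Proof.
elim: n z => [|n IH] z.
  split; last first.
    move=> S mS; rewrite mul1e (_ : _ @^-1` _ = S)//.
    by apply/seteqP; split=> x /=; rewrite (thinmx0 z) addr0.
  have := @measurable_rank1D 0 0 0 z; congr measurable_fun.
  by apply/funext => x; rewrite rank1E0.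
rewrite -(mulr1 1).
apply: (@scales_lower n (fun t : mR => 1 * t + z 0 0 : mR)
  (fun _ x => x + (rV_split (z : 'rV[mR]_n.+1)).2)) => //.
- exact: scales_shift.
- have := @measurable_rank1D n.+1 0 0 z; congr measurable_fun.
  by apply/funext => x; rewrite rank1E0.
- move=> t x; apply: rV_consP => [|j].
    by rewrite !rVE mul1r.
  by rewrite !rVE.
Qed.

Lemma measurable_scalerD n (s : R) (z : 'rV[R]_n) :
  measurable_fun [set: 'rV[mR]_n] ((fun x => s *: x + z) : 'rV[mR]_n -> 'rV[mR]_n).
Proof.
apply: measurable_fun_rVP => i.
rewrite (_ : _ \o _ = fun x : 'rV[mR]_n => s * x ord0 i + z ord0 i : mR); last first.
  by apply/funext => x; rewrite /coord_rV /= !mxE.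
apply: measurable_funD => //; apply: measurable_funM => //.
exact: (@measurable_coord_rV _ mR).
Qed.

Lemma scales_dilation n (s : R) (z : 'rV[R]_n) : 0 < s ->
  scales (lebesgue_rV R n) ((fun x => s *: x + z) : 'rV[mR]_n -> 'rV[mR]_n)
    (s^-1 ^+ n).
Proof.
move=> s0; elim: n z => [|n IH] z.
  split; first exact: measurable_scalerD.
  move=> S mS; rewrite mul1e (_ : _ @^-1` _ = S)//.
  by apply/seteqP; split=> x /=; rewrite (thinmx0 (_ + _)) (thinmx0 x).
rewrite exprS.
apply: (@scales_lower n (fun t : mR => s * t + z 0 0 : mR)
  (fun _ x => s *: x + (rV_split (z : 'rV[mR]_n.+1)).2)) => //.
- by rewrite invr_ge0 ltW.
- by rewrite exprn_ge0// invr_ge0 ltW.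
- by have := scales_affine (z 0 0) (lt0r_neq0 s0); rewrite gtr0_norm.
- exact: measurable_scalerD.
- move=> t x; apply: rV_consP => [|j].
    by rewrite !rVE.
  by rewrite !rVE.
Qed.

Lemma scales_rank1_lower n (w : 'rV[R]_n.+1) : w 0 0 = 0 ->
  scales (lebesgue_rV R n.+1) (rank1 (delta_mx 0 0) w : 'rV[mR]_n.+1 -> _) 1.
Proof.
move=> w0; rewrite -(mulr1 1).
apply: (@scales_lower n (fun t : mR => 1 * t + 0 : mR)
  (fun t x => x + t *: (rV_split (w : 'rV[mR]_n.+1)).2)) => //.
- exact: scales_shift.
- by move=> t; exact: scales_translate.
- have := @measurable_rank1D n.+1 (delta_mx 0 0) w 0; congr measurable_fun.
  by apply/funext => x; rewrite addr0.
- move=> t x; rewrite /rank1 dotv_delta; apply: rV_consP => [|j].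
    by rewrite !rVE w0 mulr0 addr0 mul1r addr0.
  by rewrite !rVE.
Qed.

Lemma scales_rank1_upper n (b : 'rV[R]_n.+1) : 1 + b 0 0 != 0 ->
  scales (lebesgue_rV R n.+1) (rank1 b (delta_mx 0 0) : 'rV[mR]_n.+1 -> _)
    `|1 + b 0 0|^-1.
Proof.
move=> b0.
apply: (@scales_upper n (fun x t => (1 + b 0 0) * t + dotv (rV_split (b : 'rV[mR]_n.+1)).2 x : mR)).
- by rewrite invr_ge0.
- by move=> x; exact: scales_affine.
- have := @measurable_rank1D n.+1 b (delta_mx 0 0) 0; congr measurable_fun.
  by apply/funext => x; rewrite addr0.
- move=> t x; rewrite /rank1; apply: rV_consP => [|j].
    by rewrite !rVE dotv_cons mxE !eqxx mulr1 mulrDl mul1r addrA.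
  by rewrite !rVE mxE /= mulr0 addr0.
Qed.

Lemma rank1_linear n (b w : 'rV[R]_n) s x y :
  rank1 b w (s *: x + y) = s *: rank1 b w x + rank1 b w y.
Proof.
by rewrite /rank1 dotvDr dotvZr scalerDl scalerDr scalerA !addrA; congr (_ + _); rewrite addrAC.
Qed.

(** The Sherman-Morrison formula: the inverse is again of the form [rank1]. *)
Lemma rank1K n (b w : 'rV[R]_n) : 1 + dotv b w != 0 ->
  cancel (rank1 b w) (rank1 b (- (1 + dotv b w)^-1 *: w)).
Proof.
move=> bw x; rewrite /rank1 dotvDr dotvZr scalerA -addrA -scalerDl.
set k := dotv b x; have -> : k + k * dotv b w = k * (1 + dotv b w) by lra.
by rewrite mulrN mulfK// subrr scale0r addr0.
Qed.

Lemma rank1VK n (b w : 'rV[R]_n) : 1 + dotv b w != 0 ->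
  cancel (rank1 b (- (1 + dotv b w)^-1 *: w)) (rank1 b w).
Proof.
move=> bw x; rewrite /rank1 dotvDr !dotvZr scalerA -addrA -scalerDl.
set k := dotv b x; set d := dotv b w in bw *.
have E : (1 + d)^-1 * (1 + d) = 1 by rewrite mulVf.
have -> : k * - (1 + d)^-1 + (k + k * (- (1 + d)^-1 * d)) =
  k - k * ((1 + d)^-1 * (1 + d)) by lra.
by rewrite E mulr1 subrr scale0r addr0.
Qed.

(* T maps the functional a to the first coordinate; T' is its inverse. *)
Record is_chart n (a : 'rV[R]_n.+1) (T T' : 'rV[mR]_n.+1 -> 'rV[mR]_n.+1) (c : R) : Prop :=
  IsChart {
    chart_gt0 : 0 < c ;
    chartK : cancel T T' ;
    chartVK : cancel T' T ;
    chart_linear : forall (s : R) (x y : 'rV[R]_n.+1),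
      T (s *: x + y) = (s *: (T x : 'rV[R]_n.+1) + T y) ;
    chart_dotv : forall x : 'rV[R]_n.+1, T x ord0 ord0 = dotv a x ;
    chart_scales : scales (lebesgue_rV R n.+1) T c ;
    chart_measurable : measurable_fun setT T' }.

Lemma chart n (a : 'rV[R]_n.+1) : a != 0 -> exists T T' c, is_chart a T T' c.
Proof.
move=> a0.
have main (b : 'rV[R]_n.+1) : b 0 0 != 0 -> exists T T' c, is_chart b T T' c.
  (* Adding <b - e, x> to the first coordinate of x replaces it by <b, x>. *)
  move=> b0; pose e : 'rV[R]_n.+1 := delta_mx 0 0; pose b' := b - e.
  have eb : 1 + b' 0 0 = b 0 0 by rewrite !mxE eqxx /=; lra.
  have de : dotv b' e = b' 0 0 by rewrite dotvC dotv_delta.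
  have bn0 : 1 + dotv b' e != 0 by rewrite de eb.
  exists (rank1 b' e), (rank1 b' (- (1 + dotv b' e)^-1 *: e)), `|b 0 0|^-1.
  split.
  - by rewrite invr_gt0 normr_gt0.
  - exact: rank1K.
  - exact: rank1VK.
  - exact: rank1_linear.
  - move=> x; rewrite /rank1 !rVE dotvBl dotv_delta mxE /=; lra.
  - by rewrite -eb; apply: scales_rank1_upper; rewrite eb.
  - have := @measurable_rank1D n.+1 b' (- (1 + dotv b' e)^-1 *: e) 0; congr measurable_fun.
    by apply/funext => x; rewrite addr0.
have [a00|] := eqVneq (a 0 0) 0; last exact: main.
have /rV0Pn[i ai] := a0.
(* If a_0 = 0, the shear x + x_0 e_i comes first. It adds a_i x_0 to the functional, so the previous
   case is applied to b = a - a_i e, whose first coordinate is -a_i. *)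
pose w : 'rV[R]_n.+1 := delta_mx 0 i; pose e : 'rV[R]_n.+1 := delta_mx 0 0.
pose b := a - a 0 i *: e.
have i0 : i != 0 by apply: contra_neq ai => ->.
have w0 : w 0 0 = 0 by rewrite mxE eq_sym (negbTE i0).
have b0 : b 0 0 != 0 by rewrite !mxE a00 /= mulr1 add0r oppr_eq0.
have [T [T' [c [c0 TK T'K Tlin T0 Tc mT']]]] := main _ b0.
have ew : 1 + dotv e w != 0 by rewrite dotv_delta w0 addr0 oner_neq0.
exists (T \o rank1 e w), (rank1 e (- (1 + dotv e w)^-1 *: w) \o T'), (c * 1).
split.
- by rewrite mulr1.
- by apply: can_comp => //; exact: rank1K.
- by apply: can_comp => //; exact: rank1VK.
- by move=> s x y; rewrite /= rank1_linear Tlin.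
- move=> x; rewrite /= T0 /rank1 dotvDr dotvZr dotv_delta !dotvBl !dotvZl dotv_delta.
  by rewrite [dotv e w]dotv_delta [dotv a w]dotvC dotv_delta w0; lra.
- by apply: scales_comp => //; exact: scales_rank1_lower.
- apply: (@measurableT_comp _ _ _ _ _ _ (rank1 e (- (1 + dotv e w)^-1 *: w) : 'rV[mR]_n.+1 -> 'rV[mR]_n.+1)) => //.
  have := @measurable_rank1D n.+1 e (- (1 + dotv e w)^-1 *: w) 0; congr measurable_fun.
  by apply/funext => x; rewrite addr0.
Qed.

End linear_scales.

(** * Brunn-Minkowski inequality *)

Section power_inequalities.
Variable R : realType.
Implicit Types x y l r p : R.

(** A convex power lies above its tangents. Multiplying the inequality for k by x leaves the
    nonnegative remainder (k+1) y^k (x - y)^2. *)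
Lemma ge_tangent_exp k x y : 0 <= x -> 0 <= y ->
  y ^+ k.+1 + k.+1%:R * y ^+ k * (x - y) <= x ^+ k.+1.
Proof.
move=> x0 y0; elim: k => [|k IH]; first by rewrite !expr1 expr0 mulr1 mul1r addrC subrK.
have /(ler_wpM2l x0) : y ^+ k.+1 + k.+1%:R * y ^+ k * (x - y) <= x ^+ k.+1 by [].
rewrite -exprS; apply: le_trans.
have : 0 <= k.+1%:R * y ^+ k * (x - y) ^+ 2.
  by rewrite mulr_ge0 ?sqr_ge0// mulr_ge0 ?exprn_ge0.
rewrite -[k.+2%:R]natr1 [y ^+ k.+2]exprS ![y ^+ k.+1]exprS expr2.
by lra.
Qed.

(** Jensen's inequality for t^(k+1) at the points 1 and r/p with weights proportional to 1 - l and l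
    p; W is the total weight and y the mean. It recombines lengths and section volumes in the
    induction step of Brunn-Minkowski. *)
Lemma mean_exp k l p r : 0 < l < 1 -> 0 < p -> 0 < r ->
  ((1 - l) + l * r) ^+ k.+1 <=
  ((1 - l) + l * p) ^+ k * ((1 - l) + l * (r ^+ k.+1 / p ^+ k)).
Proof.
move=> /andP[l0 l1] p0 r0.
set W := (1 - l) + l * p; have W0 : 0 < W by rewrite /W; nra.
set z := (1 - l) + l * r; have z0 : 0 < z by rewrite /z; nra.
pose y := z / W; have y0 : 0 < y by rewrite divr_gt0.
have E1 := ge_tangent_exp k ler01 (ltW y0).
have E2 := ge_tangent_exp k (ltW (divr_gt0 r0 p0)) (ltW y0).
have yW : y * W = z by rewrite /y mulfVK// gt_eqF.
set q := r / p in E2; have qp : q * p = r by rewrite /q mulfVK// gt_eqF.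
have -> : r ^+ k.+1 / p ^+ k = p * q ^+ k.+1.
  by rewrite /q exprMn exprVn (exprS p k) invfM mulrCA mulVKf ?gt_eqF.
have -> : z ^+ k.+1 = W ^+ k * (W * y ^+ k.+1).
  by rewrite -yW exprMn [W ^+ k.+1]exprSr; lra.
rewrite ler_pM2l ?exprn_gt0//.
set c := k.+1%:R * y ^+ k in E1 E2.
have l1' : 0 <= 1 - l by lra.
have lp : 0 <= l * p by rewrite mulr_ge0 ?ltW.
have := lerD (ler_wpM2l l1' E1) (ler_wpM2l lp E2).
rewrite expr1n mulr1 -[l * p * q ^+ _]mulrA; apply: le_trans.
have -> : (1 - l) * (y ^+ k.+1 + c * (1 - y)) + l * p * (y ^+ k.+1 + c * (q - y)) =
   W * y ^+ k.+1 + c * ((1 - l) + l * (q * p) - y * W) by rewrite /W; lra.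
by rewrite qp yW /z subrr mulr0 addr0.
Qed.

End power_inequalities.

Section level_sets.
Variable R : realType.
Local Notation mR := (measurableTypeR R).
Local Notation mu := (@lebesgue_measure R).
Implicit Types (I J G : set R) (l t : R).

Definition segment_closed I :=
  forall x y t, I x -> I y -> 0 <= t <= 1 -> I ((1 - t) * x + t * y).

Lemma segment_closed_mid I x y z : segment_closed I -> I x -> I y ->
  x <= z -> z <= y -> I z.
Proof.
move=> cI Ix Iy xz zy; have [xy|yx] := ltrP x y; last first.
  by have -> : z = x by apply/eqP; rewrite eq_le xz (le_trans zy yx).
have yx0 : 0 < y - x by rewrite subr_gt0.
pose t := (z - x) / (y - x).
have tE : t * (y - x) = z - x by rewrite /t mulfVK// gt_eqF.
have -> : z = (1 - t) * x + t * y by lra.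
apply: cI => //; rewrite /t; apply/andP; split.
  by rewrite divr_ge0 ?subr_ge0 ?(ltW xy).
by rewrite ler_pdivrMr// mul1r lerB.
Qed.

(** The endpoints of an interval need not belong to it, but points strictly between them do; an
    interval reduced to a point is covered as well. *)
Lemma segment_closed_inf_sup I t : segment_closed I -> I !=set0 ->
  has_ubound I -> has_lbound I -> 0 < t < 1 -> I ((1 - t) * inf I + t * sup I).
Proof.
move=> cI I0 uI lI /andP[t0 t1].
have hs : has_sup I by []. have hi : has_inf I by [].
have [x0 Ix0] := I0.
have Hu := @ub_le_sup _ _ uI; have Hl := @ge_inf _ _ lI.
have := le_trans (Hl _ Ix0) (Hu _ Ix0); rewrite le_eqVlt => /predU1P[E|lt].
  have Ex : x0 = inf I.
    by apply/eqP; rewrite eq_le (Hl _ Ix0) andbT E Hu.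
  by rewrite -E -mulrDl subrK mul1r -Ex.
set z := _ + _.
have zs : z < sup I by rewrite /z; nra.
have zi : inf I < z by rewrite /z; nra.
have [y Iy zy] : exists2 y, I y & z < y.
  by have [w ? ?] := sup_gt I0 zs; exists w.
have [x Ix xz] : exists2 x, I x & x < z by have [w ? ?] := inf_lt I0 zi; exists w.
exact: (segment_closed_mid cI Ix Iy (ltW xz) (ltW zy)).
Qed.

Lemma lebesgue_segment_le I : segment_closed I -> I !=set0 ->
  has_ubound I -> has_lbound I -> measurable (I : set mR) ->
  (mu I <= (sup I - inf I)%:E)%E.
Proof.
move=> cI I0 uI lI mI.
have hs : has_sup I by []. have hi : has_inf I by [].
have [x Ix] := I0.
have si : inf I <= sup I.
  exact: le_trans (ge_inf lI Ix) (ub_le_sup uI Ix).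
have -> : (sup I - inf I)%:E = mu `[inf I, sup I]%classic.
  rewrite lebesgue_measure_itv/= lte_fin; case: ltrP => // h.
  by have -> : sup I = inf I by [apply/eqP; rewrite eq_le h si]; rewrite subrr.
apply: le_measure; rewrite ?inE// => y Iy /=.
by rewrite in_itv/= (ge_inf lI)//= (ub_le_sup uI).
Qed.

(** One-dimensional Brunn-Minkowski for intervals: a point of ]lo, hi[ at fraction t combines the
    points at the same fraction t of [I] and [J]. *)
Lemma lebesgue_combination I J G l :
  segment_closed I -> I !=set0 -> has_ubound I -> has_lbound I ->
  measurable (I : set mR) ->
  segment_closed J -> J !=set0 -> has_ubound J -> has_lbound J ->
  measurable (J : set mR) ->
  measurable (G : set mR) -> 0 < l < 1 ->
  (forall s t, I s -> J t -> G ((1 - l) * s + l * t)) ->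
  ((1 - l)%:E * mu I + l%:E * mu J <= mu G)%E.
Proof.
move=> cI I0 uI lI mI cJ J0 uJ lJ mJ mG /andP[l0 l1] GE.
have l1' : 0 < 1 - l by lra.
set lo := (1 - l) * inf I + l * inf J; set hi := (1 - l) * sup I + l * sup J.
apply: (@le_trans _ _ (hi - lo)%:E).
  have -> : hi - lo = (1 - l) * (sup I - inf I) + l * (sup J - inf J).
    by rewrite /hi /lo; lra.
  rewrite [leRHS]EFinD; apply: leeD; rewrite EFinM; apply: lee_wpmul2l.
  - by rewrite lee_fin ltW.
  - exact: lebesgue_segment_le.
  - by rewrite lee_fin ltW.
  - exact: lebesgue_segment_le.
apply: (@le_trans _ _ (mu `]lo, hi[%classic)).
  rewrite lebesgue_measure_itv/= lte_fin; case: ltrP => // h.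
  by rewrite lee_fin subr_le0.
apply: le_measure; rewrite ?inE// => z /=; rewrite in_itv/= => /andP[loz zhi].
have hl0 : 0 < hi - lo by rewrite subr_gt0 (lt_trans loz).
pose t := (z - lo) / (hi - lo).
have tE : t * (hi - lo) = z - lo by rewrite /t mulfVK// gt_eqF.
have t01 : 0 < t < 1.
  apply/andP; split; first by apply: divr_gt0 => //; rewrite subr_gt0.
  by rewrite /t ltr_pdivrMr// mul1r ltrD2r.
have := GE _ _ (segment_closed_inf_sup cI I0 uI lI t01)
               (segment_closed_inf_sup cJ J0 uJ lJ t01).
congr G; suff : t * (hi - lo) = z - lo by rewrite /hi /lo; lra.
exact: tE.
Qed.

End level_sets.

Section brunn_minkowski.
Variable R : realType.
Local Notation mR := (measurableTypeR R).
Local Notation mu := (@lebesgue_measure R).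

Definition cvx n (A : set 'rV[R]_n) := forall x y t,
  A x -> A y -> 0 <= t <= 1 -> A ((1 - t) *: x + t *: y).

Definition bdd_by n (M : R) (A : set 'rV[R]_n) :=
  forall x, A x -> forall i, `|x ord0 i| <= M.

Lemma measurable_box n (A : 'I_n -> set mR) : (forall i, measurable (A i)) ->
  measurable [set x : 'rV[mR]_n | forall i, A i (x ord0 i)].
Proof.
move=> mA; rewrite (_ : mkset _ = \bigcap_(i in [set: 'I_n])
    ((coord_rV i : 'rV[mR]_n -> mR) @^-1` A i)).
  apply: fin_bigcap_measurable => // i _.
  by rewrite -[X in measurable X]setTI; exact: (@measurable_coord_rV _ mR).
by apply/seteqP; split => x /= H i; [move=> _|]; exact: H.
Qed.

Lemma vol_bdd_by n M (A : set 'rV[mR]_n) : 0 <= M -> measurable A -> bdd_by M A ->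
  (lebesgue_rV R n A <= ((2 * M) ^+ n)%:E)%E.
Proof.
move=> M0 mA bA.
pose B (i : 'I_n) : set mR := `[- M, M]%classic.
have mB i : measurable (B i) by exact: measurable_itv.
pose Bx : set 'rV[mR]_n := [set x | forall i, B i (x ord0 i)].
have mBx : measurable Bx by exact: measurable_box.
have -> : ((2 * M) ^+ n)%:E = lebesgue_rV R n Bx.
  rewrite [RHS](lebesgue_rV_box mB) (eq_bigr (fun=> (2 * M)%:E)); last first.
    move=> i _; rewrite /B lebesgue_measure_itv/= lte_fin.
    case: ltrP => h; first by rewrite -EFinB; congr EFin; lra.
    by congr EFin; lra.
  by rewrite prodEFin prodr_const card_ord.
apply: le_measure; rewrite ?inE//.
by move=> x Ax i; rewrite /B/= in_itv/= -ler_norml; exact: bA.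
Qed.

Lemma bdd_by_slice n M (A : set 'rV[mR]_n.+1) t : bdd_by M A -> bdd_by M (slice A t).
Proof. by move=> bA x Ax i; have := bA _ Ax (lift ord0 i); rewrite rV_consS. Qed.

Lemma rV_cons_comb n (s u k l : R) (x y : 'rV[mR]_n) :
  (rV_cons (k * s + l * u : mR, (k *: (x : 'rV[R]_n) + l *: (y : 'rV[R]_n)) : 'rV[mR]_n)
    : 'rV[R]_n.+1) =
  k *: (rV_cons (s : mR, x) : 'rV[R]_n.+1) + l *: (rV_cons (u : mR, y) : 'rV[R]_n.+1).
Proof.
by apply: rV_consP => [|j]; rewrite !rVE.
Qed.

Lemma cvx_slice n (A : set 'rV[mR]_n.+1) t : cvx A -> cvx (slice A t).
Proof.
move=> cA x y u Ax Ay u01; rewrite /slice /=.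
have := cA _ _ _ Ax Ay u01; rewrite -rV_cons_comb.
by congr (A (rV_cons (_, _))); lra.
Qed.

Section levels.
Variables (f : mR -> R) (mf : measurable_fun setT f) (k : R).

(** [level u] is a superlevel set at the relative height u, where k stands for the maximum of f;
    [heights s] is the section of the same planar set in the other direction. The restriction to 0 <
    u < 1 makes functions of different size comparable. *)
Definition heights (s : mR) : set mR := [set u | 0 < u < 1 /\ u * k < f s].

Definition level (u : mR) : set mR := [set s | 0 < u < 1 /\ u * k < f s].

Let E : set (mR * mR) := [set p | 0 < p.2 < 1 /\ p.2 * k < f p.1].

Let mE : measurable E.
Proof.
rewrite (_ : E = snd @^-1` (`]0, 1[%classic : set mR) `&`
    [set p | ((p.2 * k)%:E < (f p.1)%:E)%E]).
  apply: measurableI.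
    by apply: measurable_preimage => //; exact: measurable_snd.
  rewrite -[X in measurable X]setTI; apply: measurable_lte => //.
    apply/measurable_EFinP; apply: measurable_funM => //; exact: measurable_snd.
  by apply/measurable_EFinP; apply: measurableT_comp => //; exact: measurable_fst.
by apply/seteqP; split=> p /=; rewrite in_itv/= lte_fin.
Qed.

Lemma measurable_level u : measurable (level u).
Proof.
rewrite (_ : level u = ysection E u); first exact: measurable_ysection.
by apply/seteqP; split=> s Es; [apply: mem_set|have := set_mem Es].
Qed.

Lemma measurable_level_vol :
  measurable_fun [set: mR] ((fun u => mu (level u)) : mR -> \bar R).
Proof.
rewrite (_ : (fun u => _) = mu \o ysection E); last first.
  apply/funext => u; congr (mu _).
  by apply/seteqP; split=> s Es; [apply: mem_set|have := set_mem Es].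
exact: (measurable_fun_ysection mu mE).
Qed.

Lemma level_fubini : (\int[mu]_u mu (level u) =
  \int[mu]_s mu (heights s))%E.
Proof.
have := indic_fubini_tonelli mu mu mE.
rewrite indic_fubini_tonelli_FE// indic_fubini_tonelli_GE// => FG.
transitivity (\int[mu]_u (mu \o ysection E) u)%E.
  apply: eq_integral => u _ /=; congr (mu _).
  by apply/seteqP; split=> s Es; [apply: mem_set|have := set_mem Es].
rewrite -FG; apply: eq_integral => s _ /=; congr (mu _).
by apply/seteqP; split=> u Es; [have := set_mem Es|apply: mem_set].
Qed.

Hypotheses (k0 : 0 < k) (f0 : forall s, 0 <= f s).

Let measurable_heights s : measurable (heights s).
Proof.
rewrite (_ : heights s = xsection E s); first exact: measurable_xsection.
by apply/seteqP; split=> u Es; [apply: mem_set|have := set_mem Es].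
Qed.

Let integral_fk :
  (k^-1%:E * \int[mu]_s (f s)%:E = \int[mu]_s (k^-1 * f s)%:E)%E.
Proof.
rewrite -ge0_integralZl//=.
- by apply/measurable_EFinP.
- by move=> s _; rewrite lee_fin.
- by rewrite lee_fin invr_ge0 ltW.
Qed.

Let measurable_fk : measurable_fun [set: mR] (fun s => (k^-1 * f s)%:E).
Proof. by apply/measurable_EFinP; apply: measurable_funM. Qed.

(** The layer-cake formula counts only the part of [f] below [k], hence an inequality as long as [k]
    is not known to bound [f]. This form serves for the body C of Brunn-Minkowski, whose largest
    section is unknown. *)
Lemma level_integral_le : (\int[mu]_u mu (level u) <= k^-1%:E * \int[mu]_s (f s)%:E)%E.
Proof.
rewrite level_fubini integral_fk.
apply: ge0_le_integral => //.
- rewrite (_ : (fun s => _) = mu \o xsection E).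
    exact: (measurable_fun_xsection mu mE).
  apply/funext => s; congr (mu _).
  by apply/seteqP; split=> u Es; [apply: mem_set|have := set_mem Es].
move=> s _; have fk : 0 <= k^-1 * f s by rewrite mulr_ge0// invr_ge0 ltW.
have -> : (k^-1 * f s)%:E = mu `[0, k^-1 * f s]%classic.
  rewrite lebesgue_measure_itv/= lte_fin; case: ltrP => h.
    by rewrite sube0.
  by congr EFin; apply/eqP; rewrite eq_le fk h.
apply: le_measure; rewrite ?inE// => u /= [/andP[u0 _] uk].
by rewrite in_itv/= ltW//= mulrC ler_pdivlMr// ltW.
Qed.

Lemma level_integral : (forall s, f s <= k) ->
  (\int[mu]_u mu (level u) = k^-1%:E * \int[mu]_s (f s)%:E)%E.
Proof.
move=> fk; rewrite level_fubini integral_fk; apply: eq_integral => s _.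
have fk0 : 0 <= k^-1 * f s by rewrite mulr_ge0// invr_ge0 ltW.
transitivity (mu `]0, k^-1 * f s[%classic).
  congr (mu _); apply/seteqP; split=> u /=; rewrite in_itv/=.
    by move=> [/andP[u0 _] uk]; rewrite u0/= mulrC ltr_pdivlMr.
  move=> /andP[u0]; rewrite mulrC ltr_pdivlMr// => uk; split=> //.
  by rewrite u0/= -(ltr_pM2r k0) mul1r (lt_le_trans uk).
rewrite lebesgue_measure_itv/= lte_fin; case: ltrP => h.
  by rewrite sube0.
by congr EFin; apply/eqP; rewrite eq_le fk0 h.
Qed.
End levels.

(** [p] will be the ratio of the linear sizes of two sections of volumes a and b. In dimension 0
    there is nothing to scale and both volumes must agree. *)
Lemma root_exists n (a b : R) : 0 < a -> 0 < b -> (n = 0 -> a = b) ->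
  exists2 p, 0 < p & b = a * p ^+ n.
Proof.
move=> a0 b0; case: n => [/(_ erefl) ->|n _]; first by exists 1; rewrite ?mulr1.
have ba : 0 < b / a by rewrite divr_gt0.
exists ((b / a) `^ n.+1%:R^-1); first exact: powR_gt0.
rewrite -powR_mulrn ?powR_ge0// -powRrM mulVf ?pnatr_eq0// powRr1 ?ltW//.
by rewrite mulrCA divff ?gt_eqF// mulr1.
Qed.

End brunn_minkowski.

Section brunn_minkowski.
Variable R : realType.
Local Notation mR := (measurableTypeR R).
Local Notation mu := (@lebesgue_measure R).

Definition svol n (A : set 'rV[mR]_n.+1) (s : mR) : R :=
  fine (lebesgue_rV R n (slice A s)).

Section svol.
Variables (n : nat) (M : R) (A : set 'rV[mR]_n.+1).
Hypotheses (M0 : 0 <= M) (mA : measurable A) (bA : bdd_by M A).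

Let vol_slice_le s : (lebesgue_rV R n (slice A s) <= ((2 * M) ^+ n)%:E)%E.
Proof.
by apply: vol_bdd_by => //; [exact: measurable_slice|exact: bdd_by_slice].
Qed.

Lemma svolE s : lebesgue_rV R n (slice A s) = (svol A s)%:E.
Proof.
rewrite /svol fineK// ge0_fin_numE ?measure_ge0//.
exact: le_lt_trans (vol_slice_le s) (ltry _).
Qed.

Lemma svol_ge0 s : 0 <= svol A s.
Proof. by rewrite /svol fine_ge0. Qed.

Lemma svol_le s : svol A s <= (2 * M) ^+ n.
Proof. by rewrite -lee_fin -svolE. Qed.

Lemma measurable_svol : measurable_fun [set: mR] (svol A).
Proof.
apply/measurable_EFinP; rewrite (_ : EFin \o svol A = (fun s => lebesgue_rV R n (slice A s))).
  exact: measurable_vol_slice.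
by apply/funext => s; rewrite svolE.
Qed.

Lemma vol_svol : lebesgue_rV R n.+1 A = (\int[mu]_s (svol A s)%:E)%E.
Proof. by rewrite vol_slice//; apply: eq_integral => s _; rewrite svolE. Qed.

Lemma svol_gt0_bdd s : 0 < svol A s -> - M <= s <= M.
Proof.
rewrite -lte_fin -svolE => h.
have [x Ax] : slice A s !=set0.
  apply/set0P/eqP => E; move: h; rewrite E measure0 ltxx//.
by rewrite -ler_norml; have := bA Ax ord0; rewrite rV_cons0.
Qed.

Lemma svol_has_sup : has_sup (range (svol A)).
Proof.
split; first by exists (svol A 0); exists 0.
by exists ((2 * M) ^+ n) => _ [s _ <-]; exact: svol_le.
Qed.

Lemma svol_le_sup s : svol A s <= sup (range (svol A)).
Proof. by apply: ub_le_sup; [case: svol_has_sup|exists s]. Qed.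

Lemma svol_sup_gt0 : (0 < lebesgue_rV R n.+1 A)%E -> 0 < sup (range (svol A)).
Proof.
move=> VA; rewrite ltNge; apply/negP => s0; move: VA.
rewrite vol_svol (eq_integral (cst 0%E)) ?integral0 ?ltxx// => s _.
congr EFin; apply/eqP; rewrite eq_le svol_ge0 andbT.
exact: le_trans (svol_le_sup s) s0.
Qed.

End svol.

Lemma has_bounds_bdd (M : R) (I : set R) : (forall s, I s -> - M <= s <= M) ->
  has_ubound I /\ has_lbound I.
Proof.
by move=> h; split; [exists M|exists (- M)] => s /h /andP[].
Qed.

(* Equivalent to the concavity of vol^(1/n), but free of n-th roots, which also
   makes sense for n = 0. The sections of A and B by {x_0 = s}, compared at equal
   fractions of their maximal volumes, reduce dimension n.+1 to dimension n. *)
Theorem brunn_minkowski n (M l w r : R) (A B C : set 'rV[mR]_n) :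
  0 <= M -> measurable A -> measurable B -> measurable C ->
  cvx A -> cvx B -> bdd_by M A -> bdd_by M B -> bdd_by M C ->
  0 < l < 1 -> 0 < w -> 0 < r ->
  (forall x y : 'rV[R]_n, A x -> B y -> C ((1 - l) *: x + l *: y)) ->
  (w%:E <= lebesgue_rV R n A)%E -> ((w * r ^+ n)%:E <= lebesgue_rV R n B)%E ->
  ((w * ((1 - l) + l * r) ^+ n)%:E <= lebesgue_rV R n C)%E.
Proof.
elim: n M l w r A B C => [|n IH] M l w r A B C M0 mA mB mC cA cB bA bB bC l01 w0 r0 ABC wA wB.
  (* In dimension 0 a positive lower bound on the unit mass means that the set contains the only
     point. *)
  rewrite expr0 mulr1 in wB *; move: wA wB => /=; rewrite !diracE.
  case: (boolP (_ \in A)) => [/set_mem A0|_]; last by move=> /=; rewrite lee_fin => h; move: (lt_le_trans w0 h); rewrite ltxx.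
  case: (boolP (_ \in B)) => [/set_mem B0|_]; last by move=> _ /=; rewrite lee_fin => h; move: (lt_le_trans w0 h); rewrite ltxx.
  rewrite (mem_set (_ : C 0))//.
  by have := ABC _ _ A0 B0; rewrite !scaler0 addr0.
have /andP[l0 l1] := l01; have l1' : 0 < 1 - l by lra.
(* The induction hypothesis with ratio 1 makes section volumes of a convex set quasi-concave, so
   their superlevel sets are intervals. The end cases t = 0 and t = 1 are outside its range. *)
have levelset (D : set 'rV[mR]_n.+1) k u : measurable D -> cvx D -> bdd_by M D ->
    0 < k -> segment_closed (level (svol D) k u).
  move=> mD cD bD k0 s s' t [u01 us] [_ us'] /andP[t0 t1]; split=> //.
  move: t0; rewrite le_eqVlt => /predU1P[<-|t0]; first by rewrite subr0 mul1r mul0r addr0.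
  move: t1; rewrite le_eqVlt => /predU1P[->|t1]; first by rewrite subrr mul0r mul1r add0r.
  have /andP[u0 _] := u01.
  have uk0 : 0 < u * k by rewrite mulr_gt0.
  pose v := Num.min (svol D s) (svol D s').
  have uv : u * k < v by rewrite /v lt_min us us'.
  rewrite -lte_fin -(svolE M0 mD bD).
  apply: (@lt_le_trans _ _ v%:E); first by rewrite lte_fin.
  have := IH M t v 1 (slice D s) (slice D s') (slice D ((1 - t) * s + t * s')).
  rewrite mulr1 subrK !expr1n mulr1; apply => //; do ?exact: measurable_slice;
    do ?exact: cvx_slice; do ?exact: bdd_by_slice.
  - by rewrite t0.
  - exact: lt_trans uv.
  - move=> x y Dx Dy; rewrite /slice /= rV_cons_comb; apply: cD => //.
    by rewrite !ltW.
  - by rewrite (svolE M0 mD bD) lee_fin ge_min lexx.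
  - by rewrite (svolE M0 mD bD) lee_fin ge_min lexx orbT.
have VA : (0 < lebesgue_rV R n.+1 A)%E by apply: lt_le_trans wA; rewrite lte_fin.
have VB : (0 < lebesgue_rV R n.+1 B)%E.
  by apply: lt_le_trans wB; rewrite lte_fin mulr_gt0// exprn_gt0.
set a := sup (range (svol A)); set b := sup (range (svol B)).
have a0 : 0 < a := svol_sup_gt0 M0 mA bA VA.
have b0 : 0 < b := svol_sup_gt0 M0 mB bB VB.
(* For n = 0 the sections have volume 0 or 1, so both suprema, being positive, are equal to 1. *)
have [p p0 bE] : exists2 p, 0 < p & b = a * p ^+ n.
  apply: root_exists => // n0; subst n.
  have sup1 (D : set 'rV[mR]_1) : 0 < sup (range (svol D)) -> sup (range (svol D)) = 1.
    move=> D0; have vD s : svol D s = 0 \/ svol D s = 1.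
      rewrite /svol [lebesgue_rV R 0 _]diracE; case: (_ \in _) => /=; [by right|by left].
    have D1 : range (svol D) `<=` [set x | x <= 1].
      by move=> _ [s _ <-] /=; case: (vD s) => ->.
    apply/eqP; rewrite eq_le; apply/andP; split.
      by apply: ge_sup => //; exists (svol D 0), 0.
    have [_ [s _ <-] s0] := sup_gt (ex_intro _ (svol D 0) (ex_intro2 _ _ 0 I erefl)) D0.
    apply: ub_le_sup; first by exists 1.
    by exists s => //; case: (vD s) => // e; rewrite e ltxx in s0.
  by apply: (etrans (sup1 A a0)); apply/esym; exact: (sup1 B b0).
(* The volume predicted for the combination of the largest sections; it may be smaller than the
   largest section of C. *)
set c := a * ((1 - l) + l * p) ^+ n.
have lp0 : 0 < (1 - l) + l * p by nra.
have c0 : 0 < c by rewrite mulr_gt0// exprn_gt0.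
have nonempty (D : set 'rV[mR]_n.+1) u : measurable D -> bdd_by M D -> 0 < u < 1 ->
    0 < sup (range (svol D)) -> level (svol D) (sup (range (svol D))) u !=set0.
  move=> mD bD u01 D0; have /andP[u0 u1] := u01.
  have : u * sup (range (svol D)) < sup (range (svol D)) by rewrite gtr_pMl.
  by move=> /(sup_gt (svol_has_sup M0 mD bD).1)[_ [s _ <-] us]; exists s.
have bounds (D : set 'rV[mR]_n.+1) k u : measurable D -> bdd_by M D -> 0 < k ->
    has_ubound (level (svol D) k u) /\ has_lbound (level (svol D) k u).
  move=> mD bD k0; apply: (@has_bounds_bdd M) => s [/andP[u0 _] us].
  by apply: (svol_gt0_bdd M0 mD bD); apply: lt_trans us; rewrite mulr_gt0.
have key u : ((1 - l)%:E * mu (level (svol A) a u) + l%:E * mu (level (svol B) b u)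
    <= mu (level (svol C) c u))%E.
  have [u01|nu] := boolP (0 < u < 1); last first.
    have E0 f k : level f k u = set0.
      by apply/seteqP; split=> s //= -[] h; rewrite h in nu.
    by rewrite !E0 !measure0 !mule0 adde0.
  have /andP[u0 u1] := u01.
  have [uA lA] := bounds A a u mA bA a0; have [uB lB] := bounds B b u mB bB b0.
  apply: lebesgue_combination => //; do ?exact: levelset; do ?exact: nonempty;
    do ?by apply: measurable_level; apply: measurable_svol M0 _ _.
  move=> s t [_ us] [_ ut]; split=> //.
  have pn0 : 0 < p ^+ n by rewrite exprn_gt0.
  (* With this common bound the two sections have volumes at least v and v p^n, the form required by
     the induction hypothesis with ratio p. *)
  pose v := Num.min (svol A s) (svol B t / p ^+ n).
  have uv : u * a < v.
    by rewrite /v lt_min us/= ltr_pdivlMr// -mulrA -bE.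
  rewrite -lte_fin -(svolE M0 mC bC).
  apply: (@lt_le_trans _ _ (v * ((1 - l) + l * p) ^+ n)%:E).
    by rewrite lte_fin /c mulrA ltr_pM2r// exprn_gt0.
  apply: (IH M l v p (slice A s) (slice B t)) => //; do ?exact: measurable_slice;
    do ?exact: cvx_slice; do ?exact: bdd_by_slice.
  - by apply: lt_trans uv; rewrite mulr_gt0.
  - by move=> x y Ax By; rewrite /slice /= rV_cons_comb; exact: ABC.
  - by rewrite (svolE M0 mA bA) lee_fin ge_min lexx.
  - by rewrite (svolE M0 mB bB) lee_fin -ler_pdivlMr// ge_min lexx orbT.
have mal := measurable_svol M0 mA bA.
have mbe := measurable_svol M0 mB bB.
have mga := measurable_svol M0 mC bC.
have : ((1 - l)%:E * (a^-1%:E * lebesgue_rV R n.+1 A) +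
        l%:E * (b^-1%:E * lebesgue_rV R n.+1 B) <= c^-1%:E * lebesgue_rV R n.+1 C)%E.
  rewrite (vol_svol M0 mA bA) (vol_svol M0 mB bB) (vol_svol M0 mC bC).
  apply: le_trans (level_integral_le mga c0 (svol_ge0 C)).
  rewrite -(level_integral mal a0 (svol_ge0 A)); last exact: svol_le_sup M0 mA bA.
  rewrite -(level_integral mbe b0 (svol_ge0 B)); last exact: svol_le_sup M0 mB bB.
  have mlA := measurable_level_vol mal a; have mlB := measurable_level_vol mbe b.
  rewrite -ge0_integralZl//=; last by rewrite lee_fin ltW.
  rewrite -ge0_integralZl//=; last by rewrite lee_fin ltW.
  rewrite -ge0_integralD//=; last 4 first.
  - by move=> u _; rewrite mule_ge0// lee_fin ltW.
  - exact: measurable_funeM.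
  - by move=> u _; rewrite mule_ge0// lee_fin ltW.
  - exact: measurable_funeM.
  apply: ge0_le_integral => //=.
  - by move=> u _; rewrite adde_ge0// mule_ge0// lee_fin ltW.
  - by apply: emeasurable_funD; exact: measurable_funeM.
  - exact: measurable_level_vol.
have cV : (0 <= c^-1%:E :> \bar R)%E by rewrite lee_fin invr_ge0 ltW.
move=> h.
have : (((1 - l) * (a^-1 * w) + l * (b^-1 * (w * r ^+ n.+1)))%:E <=
    c^-1%:E * lebesgue_rV R n.+1 C)%E.
  apply: le_trans h; rewrite [leLHS]EFinD.
  have l1e : (0 <= (1 - l)%:E :> \bar R)%E by rewrite lee_fin ltW.
  have le : (0 <= l%:E :> \bar R)%E by rewrite lee_fin ltW.
  have ae : (0 <= a^-1%:E :> \bar R)%E by rewrite lee_fin invr_ge0 ltW.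
  have be : (0 <= b^-1%:E :> \bar R)%E by rewrite lee_fin invr_ge0 ltW.
  by apply: leeD; rewrite EFinM; apply: lee_wpmul2l => //; rewrite EFinM;
    apply: lee_wpmul2l.
move=> /(lee_wpmul2l (ltW (_ : 0 < c%:E)%E)); rewrite lte_fin => /(_ c0).
rewrite muleA -[X in (_ <= X * _)%E]EFinM divff ?gt_eqF// mul1e.
apply: le_trans; rewrite -EFinM lee_fin /c.
(* The integrated inequality carries the factor p of the sections, while the goal has the ratio r of
   the bodies; Jensen passes from one to the other. *)
have := mean_exp n l01 p0 r0; rewrite -(ler_pM2l w0) => /le_trans; apply.
rewrite bE invfM le_eqVlt; apply/orP; left; apply/eqP.
set q := (_ + l * p) ^+ n; set X := r ^+ n.+1; set Y := (p ^+ n)^-1.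
have -> : a * q * ((1 - l) * (a^-1 * w) + l * (a^-1 * Y * (w * X))) =
  (a * a^-1) * (w * (q * (1 - l + l * (X * Y)))) by lra.
by rewrite divff ?gt_eqF// mul1r.
Qed.

End brunn_minkowski.

(** * Integrals of concave functions *)

Section radon.
Variable R : realType.
Local Notation mR := (measurableTypeR R).
Local Notation mu := (@lebesgue_measure R).

(** The hypothesis gives (1 - s) s^n K <= (1 - s^(n+1)) I <= (n+1) (1 - s) I by Bernoulli. Division
    by 1 - s and s -> 1 finish. *)
Lemma le_of_dilations n (K I : R) : 0 <= K -> 0 <= I ->
  (forall s, 0 < s < 1 -> s ^+ n * ((1 - s) * K + s * I) <= I) ->
  K <= n.+1%:R * I.
Proof.
move=> K0 I0 h.
have step s : 0 < s < 1 -> s ^+ n * K <= n.+1%:R * I.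
  move=> s01; have /andP[s0 s1] := s01; have s1' : 0 < 1 - s by lra.
  rewrite -(ler_pM2l s1').
  have := ge_tangent_exp n (ltW s0) (@ler01 R); rewrite !expr1n mulr1 => b.
  have := h s s01; have := ler_wpM2r I0 b; rewrite exprS; lra.
rewrite leNgt; apply/negP => lt.
set D := K - n.+1%:R * I; have D0 : 0 < D by rewrite subr_gt0.
have nK : 0 <= n%:R * K by rewrite mulr_ge0.
(* An explicit s = 1 - e replaces the limit: n e K < D, so the lower bound (1 - n e) K for s^n K
   still exceeds (n+1) I. *)
pose e := D / (2 * (n%:R * K + D)).
have eE : e * (2 * (n%:R * K + D)) = D by rewrite /e mulfVK// gt_eqF//; lra.
have e0 : 0 < e by rewrite divr_gt0//; lra.
have e1 : e < 1 by rewrite ltr_pdivrMr ?mul1r; lra.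
have s01 : 0 < 1 - e < 1 by apply/andP; split; lra.
have := step _ s01; apply/negP; rewrite -ltNge.
have b : 1 - n%:R * e <= (1 - e) ^+ n.
  case: (n) => [|k]; first by rewrite mul0r subr0 expr0.
  have := @ge_tangent_exp R k (1 - e) 1; rewrite !expr1n mulr1.
  have /andP[/ltW s0 _] := s01; by move=> /(_ s0 ler01); lra.
apply: lt_le_trans (ler_wpM2r K0 b).
suff : n%:R * e * K < D by rewrite /D; lra.
have eD : 0 < e * D by rewrite mulr_gt0.
by lra.
Qed.

(* Compares the integral of m over P with that over the copy of P contracted
   towards v by a factor s, and lets s tend to 1. *)
Lemma radon_le n (P : set 'rV[mR]_n) (m : 'rV[mR]_n -> R) (v : 'rV[R]_n) :
  measurable P -> cvx P -> (lebesgue_rV R n P < +oo)%E -> P v ->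
  measurable_fun setT (m : _ -> mR) -> (forall x, P x -> 0 <= m x) ->
  (forall x y t, P x -> P y -> 0 <= t <= 1 ->
    (1 - t) * m x + t * m y <= m ((1 - t) *: (x : 'rV[R]_n) + t *: (y : 'rV[R]_n))) ->
  ((m v)%:E * lebesgue_rV R n P <=
    n.+1%:R%:E * \int[lebesgue_rV R n]_(x in P) (m x)%:E)%E.
Proof.
move=> mP cP VP Pv mm m0 mc.
have mmE (D : set 'rV[mR]_n) : measurable_fun D (fun x => (m x)%:E).
  by apply: measurable_funTS; apply/measurable_EFinP.
have I0 : (0 <= \int[lebesgue_rV R n]_(x in P) (m x)%:E)%E.
  by apply: integral_ge0 => x Px; rewrite lee_fin m0.
case E : (\int[lebesgue_rV R n]_(x in P) (m x)%:E)%E I0 => [I| |]//; last first.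
  by move=> _; rewrite gt0_muley ?leey// lte_fin ltr0n.
rewrite lee_fin => I0.
have VE : lebesgue_rV R n P = (fine (lebesgue_rV R n P))%:E.
  by rewrite fineK// ge0_fin_numE.
set V := fine _ in VE; have V0 : 0 <= V by rewrite fine_ge0.
rewrite VE -!EFinM lee_fin; apply: le_of_dilations => //; first by rewrite mulr_ge0// m0.
move=> s s01; have /andP[s0 s1] := s01; have s1' : 0 < 1 - s by lra.
pose f : 'rV[mR]_n -> 'rV[mR]_n := fun y : 'rV[R]_n => s *: y + (1 - s) *: v.
pose g : 'rV[mR]_n -> 'rV[mR]_n := fun x : 'rV[R]_n => s^-1 *: x + - (s^-1 * (1 - s)) *: v.
have gf x : g (f x) = x.
  rewrite /g /f scalerDr !scalerA mulVf ?gt_eqF// scale1r -addrA -scalerDl.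
  by rewrite subrr scale0r addr0.
have fE (x : 'rV[R]_n) : x = (1 - s) *: v + s *: (g x : 'rV[R]_n).
  rewrite /g scalerDr !scalerA mulrN mulrA mulfV ?gt_eqF// mul1r scale1r.
  by rewrite addrCA -scalerDl subrr scale0r addr0.
have mf : scales (lebesgue_rV R n) f (s^-1 ^+ n) by exact: scales_dilation.
have mg : measurable_fun setT g by exact: measurable_scalerD.
(* [D] is the contracted copy f(P), contained in P by convexity; the change of variables gives int_P
   m(f x) = s^(-n) int_D m. *)
pose D := g @^-1` P; have mD : measurable D by exact: measurable_preimage.
have DP : D `<=` P by move=> x Dx; rewrite (fE x); apply: cP => //; rewrite !ltW.
have fD : f @^-1` D = P by apply/seteqP; split=> x; rewrite /D /= gf.
have sn0 : 0 <= s^-1 ^+ n by rewrite exprn_ge0// invr_ge0 ltW.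
have H := @ge0_integral_scales _ _ _ (lebesgue_rV R n) f (s^-1 ^+ n) D
   (fun x => (m x)%:E) mf sn0 mD (mmE D) _.
rewrite fD in H.
have {}H : (\int[lebesgue_rV R n]_(x in P) (m (f x))%:E <= ((s^-1 ^+ n) * I)%:E)%E.
  rewrite H; last by move=> x Dx; rewrite lee_fin m0//; exact: DP.
  rewrite EFinM -E; apply: lee_wpmul2l; first by rewrite lee_fin.
  by apply: ge0_subset_integral => // x Px; rewrite lee_fin m0.
have : (((1 - s) * (m v * V) + s * I)%:E <= ((s^-1 ^+ n) * I)%:E)%E.
  apply: le_trans H; rewrite EFinD !EFinM -E -VE.
  have se : (0 <= s%:E :> \bar R)%E by rewrite lee_fin ltW.
  have se' : (0 <= (1 - s)%:E :> \bar R)%E by rewrite lee_fin ltW.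
  have mP0 x : P x -> (0 <= (m x)%:E)%E by move=> Px; rewrite lee_fin m0.
  rewrite -integral_cst//.
  rewrite -(@ge0_integralZl _ _ _ _ P mP (fun x => (m x)%:E) (mmE P) s%:E)//.
  rewrite -(@ge0_integralZl _ _ _ _ P mP (cst (m v)%:E) _ (1 - s)%:E)//; last first.
    by move=> x Px; exact: mP0.
  have mvm : measurable_fun P (fun x => s%:E * (m x)%:E)%E.
    exact: measurable_funeM.
  rewrite -ge0_integralD//; last 2 first.
  - by move=> x Px; rewrite -EFinM lee_fin mulr_ge0 ?m0// ltW.
  - by move=> x Px; rewrite -EFinM lee_fin mulr_ge0 ?m0// ltW.
  apply: ge0_le_integral => //.
  - by move=> x Px; rewrite -!EFinM -EFinD lee_fin addr_ge0// mulr_ge0 ?m0// ltW.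
  - exact: emeasurable_funD.
  - apply: measurable_funTS; apply/measurable_EFinP.
    by apply: (@measurableT_comp _ _ _ _ _ _ (m : _ -> mR)) => //; exact: mf.1.
  move=> x Px; rewrite -!EFinM -EFinD lee_fin /f.
  by rewrite (addrC (s *: _)); apply: mc => //; rewrite !ltW.
rewrite lee_fin => /(ler_wpM2l (exprn_ge0 n (ltW s0))).
by rewrite [X in _ <= X]mulrA -exprMn divff ?gt_eqF// expr1n mul1r.
Qed.

End radon.

(** * First moment of a convex body above a facet *)

Section first_moment.
Variable R : realType.
Local Notation mR := (measurableTypeR R).
Local Notation mu := (@lebesgue_measure R).

Lemma integral_support (D : set mR) (f : mR -> \bar R) :
  (forall u, ~ D u -> f u = 0%E) -> (\int[mu]_u f u = \int[mu]_(u in D) f u)%E.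
Proof.
move=> f0; rewrite [RHS]integral_mkcond; apply: eq_integral => u _.
by rewrite patchE; case: ifPn => // /negP; rewrite inE => /f0.
Qed.

Lemma measurable_onem_exp (h : R) n (D : set mR) :
  measurable_fun D ((fun u => (1 - u / h) ^+ n) : mR -> mR).
Proof.
apply: measurable_funTS; apply: measurable_funX; apply: measurable_funB => //.
exact: measurable_funM.
Qed.

Lemma integral_onem_exp (h : R) n : 0 < h ->
  (\int[mu]_(u in `[0%R, h]) ((1 - u / h) ^+ n)%:E = (h / n.+1%:R)%:E)%E.
Proof.
move=> h0.
have unit : (\int[mu]_(u in `[0%R, 1%R]) ((1 - u) ^+ n)%:E = (n.+1%:R^-1)%:E :> \bar R)%E.
  have := @Rintegral_onemXn R n; rewrite /Rintegral /unstable.onem.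
  have n0 : (n.+1%:R^-1 : R) != 0 by rewrite invr_eq0 pnatr_eq0.
  by case: (integral _ _ _) => [r <-//| |] /= e; move: n0; rewrite -e eqxx.
have := scales_affine 0 (invr_neq0 (lt0r_neq0 h0)).
rewrite gtr0_norm ?invr_gt0// invrK => sc.
have := @ge0_integral_scales _ _ _ mu _ _ `[0, 1]%classic (fun u => ((1 - u) ^+ n)%:E) sc (ltW h0) _ _ _.
rewrite unit -EFinM => <-//.
- rewrite (_ : _ @^-1` _ = `[0, h]%classic).
    by apply: eq_integral => u _; rewrite addr0 mulrC.
  apply/seteqP; split=> u /=; rewrite !in_itv/= addr0 mulrC.
    by rewrite ler_pdivrMr// mul1r pmulr_lge0 ?invr_gt0.
  by rewrite ler_pdivrMr// mul1r pmulr_lge0 ?invr_gt0.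
- apply/measurable_EFinP; apply: measurable_funTS.
  by apply: measurable_funX; exact: measurable_funB.
- move=> u /=; rewrite in_itv/= => /andP[u0 u1].
  by rewrite lee_fin exprn_ge0// subr_ge0.
Qed.

(** Writing u = h - h (1 - u/h) reduces the moment to two integrals of pure powers, added rather
    than subtracted until both are known to be finite. *)
Lemma integral_id_onem_exp (h : R) n : 0 < h ->
  (\int[mu]_(u in `[0%R, h]) (u * (1 - u / h) ^+ n)%:E =
   (h / n.+1%:R * (h / n.+2%:R))%:E)%E.
Proof.
move=> h0.
have nneg u : (0 <= u <= h) -> 0 <= u /\ 0 <= 1 - u / h.
  by rewrite subr_ge0 ler_pdivrMr// mul1r => /andP[].
have h0' : (0 <= h%:E :> \bar R)%E by rewrite lee_fin ltW.
have E : (\int[mu]_(u in `[0%R, h]) (u * (1 - u / h) ^+ n)%:E +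
   h%:E * \int[mu]_(u in `[0%R, h]) ((1 - u / h) ^+ n.+1)%:E =
   h%:E * \int[mu]_(u in `[0%R, h]) ((1 - u / h) ^+ n)%:E)%E.
  have m1 k : measurable_fun `[0, h] (fun u => ((1 - u / h) ^+ k)%:E).
    by apply/measurable_EFinP; exact: measurable_onem_exp.
  have p1 k u : `[0, h]%classic u -> (0 <= ((1 - u / h) ^+ k)%:E)%E.
    by rewrite /= in_itv/= => /nneg[? ?]; rewrite lee_fin exprn_ge0.
  have Z k := @ge0_integralZl _ _ _ mu `[0, h]%classic (measurable_itv _) _ (m1 k) h%:E (p1 k) h0'.
  rewrite -(Z n) -(Z n.+1).
  rewrite -ge0_integralD//=.
  - apply: eq_integral => u _; rewrite -!EFinM -EFinD; congr EFin.
    have uh : u / h * h = u by rewrite mulfVK// gt_eqF.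
    rewrite exprS; set w := u / h in uh *; set q := (1 - w) ^+ n.
    by have -> : u = w * h by []; lra.
  - by move=> u /=; rewrite ?in_itv/= => /nneg[? ?]; rewrite lee_fin mulr_ge0// exprn_ge0.
  - apply/measurable_EFinP; apply: measurable_funM => //.
    exact: measurable_onem_exp.
  - by move=> u /=; rewrite ?in_itv/= => /nneg[? ?]; apply: mule_ge0 => //; rewrite lee_fin exprn_ge0.
  - by apply: measurable_funeM; exact: (m1 n.+1).
rewrite !integral_onem_exp// -!EFinM in E.
have := congr1 (fun x => (x - (h * (h / n.+2%:R))%:E)%E) E.
rewrite addeK// -EFinB => ->; congr EFin.
have n1 : n.+1%:R / n.+1%:R = 1 :> R by rewrite divff// pnatr_eq0.
have n2 : n.+2%:R / n.+2%:R = 1 :> R by rewrite divff// pnatr_eq0.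
set x := n.+1%:R^-1 in n1 *; set y := n.+2%:R^-1 in n2 *.
have xy : x - y = x * y.
  have e1 : x * (n.+2%:R * y) = x by rewrite n2 mulr1.
  have e2 : n.+1%:R * x * y = y by rewrite n1 mul1r.
  by rewrite -(natr1 n.+1) in e1; lra.
have -> : h * (h * x) - h * (h * y) = h * h * (x - y) by lra.
by rewrite xy; lra.
Qed.

(** By convexity the section at height s contains the bottom section contracted towards the apex [v]
    by the factor 1 - s/H. *)
Lemma cone_slice n (K : set 'rV[mR]_n.+1) M (v : 'rV[R]_n.+1) H s :
  0 <= M -> measurable K -> bdd_by M K -> cvx K -> K v -> v 0 0 = H ->
  0 <= s < H -> svol K 0 * (1 - s / H) ^+ n <= svol K s.
Proof.
move=> M0 mK bK cK Kv vH /andP[s0 sH].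
have H0 : 0 < H by exact: le_lt_trans sH.
set t := s / H.
have t0 : 0 <= t by apply: divr_ge0 => //; exact: ltW.
have t1 : t < 1 by rewrite /t ltr_pdivrMr// mul1r.
have t1' : 0 < 1 - t by rewrite subr_gt0.
pose w := (rV_split (v : 'rV[mR]_n.+1)).2.
have vE : v = rV_cons (H : mR, w).
  by apply: rV_consP => [|j]; rewrite !rVE.
pose f : 'rV[mR]_n -> 'rV[mR]_n :=
  fun x : 'rV[R]_n => (1 - t) *: x + t *: (w : 'rV[R]_n).
have sc : scales (lebesgue_rV R n) f ((1 - t)^-1 ^+ n) by exact: scales_dilation.
have mS := measurable_slice s mK.
have h : (lebesgue_rV R n (slice K 0%R) <=
          lebesgue_rV R n (f @^-1` slice K s))%E.
  apply: le_measure; rewrite ?inE.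
  - exact: measurable_slice.
  - by apply: measurable_preimage => //; exact: sc.1.
  move=> x Kx; rewrite /f /slice /=.
  have := cK _ _ t Kx Kv; rewrite t0 (ltW t1) => /(_ isT).
  rewrite vE -rV_cons_comb; congr (K (rV_cons (_, _))).
  by rewrite mulr0 add0r /t mulfVK// gt_eqF.
move: h; rewrite (sc.2 _ mS) !(svolE M0 mK bK) -EFinM lee_fin exprVn.
by rewrite mulrC ler_pdivlMr// exprn_gt0.
Qed.

(** Why the sign changes only once: Brunn-Minkowski between the heights 0 and s, with ratio r = 1 -
    s/h, carries the comparison with the cone of height h down from s to every s' below it. *)
Lemma svol_below_cone n (K : set 'rV[mR]_n.+1) M h s s' :
  0 <= M -> measurable K -> bdd_by M K -> cvx K -> 0 < svol K 0 ->
  0 < s' < s -> s < h ->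
  svol K 0 * (1 - s / h) ^+ n <= svol K s ->
  svol K 0 * (1 - s' / h) ^+ n <= svol K s'.
Proof.
move=> M0 mK bK cK f0 /andP[s'0 s's] sh hs.
have s0 : 0 < s by exact: lt_trans s's.
have h0 : 0 < h by exact: lt_trans sh.
set l := s' / s.
have lE : l * s = s' by rewrite /l mulfVK// gt_eqF.
have l01 : 0 < l < 1 by rewrite divr_gt0//= ltr_pdivrMr// mul1r.
have r0 : 0 < 1 - s / h by rewrite subr_gt0 ltr_pdivrMr// mul1r.
have := @brunn_minkowski R n M l (svol K 0) (1 - s / h) (slice K 0) (slice K s) (slice K s') M0.
have -> : (1 - l) + l * (1 - s / h) = 1 - s' / h by rewrite -lE; lra.
rewrite !(svolE M0 mK bK) !lee_fin; apply => //; do ?exact: measurable_slice;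
  do ?exact: cvx_slice; do ?exact: bdd_by_slice.
move=> x y Kx Ky; rewrite /slice /=.
have := cK _ _ l Kx Ky; move: l01 => /andP[/ltW -> /ltW ->] /(_ isT).
by rewrite -rV_cons_comb; congr (K (rV_cons (_, _))); rewrite mulr0 add0r.
Qed.

End first_moment.

Section first_moment_bound.
Variable R : realType.
Local Notation mR := (measurableTypeR R).
Local Notation mu := (@lebesgue_measure R).

Lemma integral_first_coord n (K : set 'rV[mR]_n.+1) M :
  0 <= M -> measurable K -> bdd_by M K -> (forall x, K x -> 0 <= (x ord0 ord0 : R)) ->
  (\int[lebesgue_rV R n.+1]_(x in K) (x ord0 ord0)%:E =
   \int[mu]_u (u * svol K u)%:E)%E.
Proof.
move=> M0 mK bK K0.
rewrite integral_mkcond ge0_integral_slice; last 2 first.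
- apply/(measurable_restrictT _ mK); apply: measurable_funTS; apply/measurable_EFinP.
  exact: (@measurable_coord_rV _ mR).
- by move=> x; rewrite patchE; case: ifPn => // /set_mem /K0; rewrite lee_fin.
apply: eq_integral => u _.
transitivity (\int[lebesgue_rV R n]_(x in slice K u) u%:E)%E.
  rewrite [RHS]integral_mkcond; apply: eq_integral => x _.
  rewrite !patchE rV_cons0.
  by have -> : (rV_cons (u, x) \in K) = (x \in slice K u) by apply/idP/idP => /set_mem h; exact: mem_set.
rewrite integral_cst; last exact: measurable_slice.
by rewrite EFinM -(svolE M0 mK bK).
Qed.

(* When h = H, Brunn-Minkowski is replaced by the convexity of K at its apex v. *)
Lemma cone_crossing n (K : set 'rV[mR]_n.+1) M (v : 'rV[R]_n.+1) H h :
  0 <= M -> measurable K -> bdd_by M K -> cvx K -> K v -> v 0 0 = H ->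
  0 < H -> H <= h -> (forall u, H < u -> svol K u = 0) -> 0 < svol K 0 ->
  exists2 z, 0 <= z <= H & forall u, 0 <= u <= h ->
    (u < z -> svol K 0 * (1 - u / h) ^+ n <= svol K u) /\
    (z < u -> svol K u <= svol K 0 * (1 - u / h) ^+ n).
Proof.
move=> M0 mK bK cK Kv vH H0 Hh fH f0.
have h0 : 0 < h by exact: lt_le_trans Hh.
move: (Hh); rewrite le_eqVlt => /predU1P[E|{}Hh].
  exists H; first by rewrite lexx ltW.
  move=> u /andP[u0 uh]; split; last by rewrite E => /lt_geF; rewrite uh.
  by move=> uH; rewrite -E; apply: (cone_slice M0 mK bK cK Kv vH); rewrite u0.
(* Heights at which the section is at least that of the cone. Above H the sections vanish while
   those of the cone do not yet, so S stays below H; its supremum is the crossing. *)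
pose S : set R := [set s | 0 <= s < h /\ svol K 0 * (1 - s / h) ^+ n <= svol K s].
have SH s : S s -> s <= H.
  move=> [/andP[s0 sh] fs]; rewrite leNgt; apply/negP => Hs.
  move: fs; rewrite (fH _ Hs) leNgt mulr_gt0// exprn_gt0// subr_gt0.
  by rewrite ltr_pdivrMr// mul1r.
have S0 : S 0 by split; [rewrite lexx h0|rewrite mul0r subr0 expr1n mulr1].
have uS : has_ubound S by exists H => s /SH.
have zH : sup S <= H by apply: ge_sup => //; exists 0.
exists (sup S); first by rewrite zH andbT; exact: ub_le_sup.
move=> u /andP[u0 uh]; split=> [uz|zu].
  have [s [/andP[s0 sh] fs] us] := sup_gt (ex_intro _ 0 S0) uz.
  move: u0; rewrite le_eqVlt => /predU1P[<-|u0].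
    by rewrite mul0r subr0 expr1n mulr1.
  by apply: (svol_below_cone M0 mK bK cK f0 _ sh fs); rewrite u0.
rewrite leNgt; apply/negP => fu.
have g0 : 0 <= svol K 0 * (1 - u / h) ^+ n.
  apply: mulr_ge0; first exact: ltW.
  by apply: exprn_ge0; rewrite subr_ge0 ler_pdivrMr// mul1r.
have uh' : u < h.
  rewrite (le_lt_trans _ Hh)// leNgt; apply/negP => /fH fu0.
  by move: fu; rewrite fu0 ltNge g0.
have : S u by split; [rewrite u0|exact: ltW].
by move=> /(ub_le_sup uS); rewrite leNgt zu.
Qed.

(* h is the height of the cone over the bottom section having the volume of K.
   As z is where the sections of K become smaller than those of this cone,
   integrating (u - z) times their difference compares the first moments; e, p
   and q keep track of the contribution of the heights between H and h. *)
Lemma first_moment_le n (K : set 'rV[mR]_n.+1) M (v : 'rV[R]_n.+1) H h :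
  0 <= M -> measurable K -> bdd_by M K -> cvx K -> K v -> v 0 0 = H ->
  0 < H -> H <= h -> (forall x : 'rV[R]_n.+1, K x -> 0 <= x 0 0 <= H) ->
  0 < svol K 0 ->
  lebesgue_rV R n.+1 K = (svol K 0 * (h / n.+1%:R))%:E ->
  exists2 d, 0 <= d /\ (H < h -> 0 < d) &
   (\int[lebesgue_rV R n.+1]_(x in K) (x ord0 ord0)%:E + d%:E <=
      (svol K 0 * (h / n.+1%:R) * (h / n.+2%:R))%:E)%E.
Proof.
move=> M0 mK bK cK Kv vH H0 Hh KH f0 VE.
have h0 : 0 < h by exact: lt_le_trans Hh.
set f := svol K; set g := fun u => f 0 * (1 - u / h) ^+ n.
have slice0 u : ~ (0 <= u <= H) -> f u = 0.
  move=> nu; rewrite /f /svol (_ : slice K u = set0) ?measure0//.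
  by apply/seteqP; split=> x // Kx; apply: nu; have := KH _ Kx; rewrite rV_cons0.
have fH u : H < u -> f u = 0.
  by move=> Hu; apply: slice0 => /andP[_]; rewrite leNgt Hu.
have fge0 u : 0 <= f u by exact: svol_ge0.
have [z /andP[z0 zH] zP] := cone_crossing M0 mK bK cK Kv vH H0 Hh fH f0.
set D : set mR := `[0, h]%classic.
have mD : measurable D by exact: measurable_itv.
have supp (F : mR -> \bar R) : (forall u, f u = 0 -> F u = 0%E) ->
    (\int[mu]_u F u = \int[mu]_(u in D) F u)%E.
  move=> F0; apply: integral_support => u Du; apply/F0/slice0 => /andP[u0 uH].
  by apply: Du; rewrite /D /= in_itv/= u0 (le_trans uH).
have gge0 u : 0 <= u <= h -> 0 <= g u.
  move=> /andP[u0 uh]; apply: mulr_ge0; first exact: ltW.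
  by apply: exprn_ge0; rewrite subr_ge0 ler_pdivrMr// mul1r.
have mf : measurable_fun D (f : mR -> mR) by apply: measurable_funTS; exact: measurable_svol M0 mK bK.
have mg : measurable_fun D (g : mR -> mR).
  by apply: measurable_funM => //; exact: measurable_onem_exp.
have mid : measurable_fun D (fun u : mR => u) by apply: measurable_funTS.
have f0e : (0 <= (f 0)%:E :> \bar R)%E by rewrite lee_fin.
have g_int : (\int[mu]_(u in D) (g u)%:E = (f 0 * (h / n.+1%:R))%:E)%E.
  rewrite EFinM -integral_onem_exp//.
  rewrite -ge0_integralZl//.
  - by apply/measurable_EFinP; exact: measurable_onem_exp.
  - by move=> u; rewrite /D/= in_itv/= => uD; rewrite lee_fin exprn_ge0// subr_ge0 ler_pdivrMr// mul1r; case/andP: uD.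
have ug_int : (\int[mu]_(u in D) (u * g u)%:E = (f 0 * (h / n.+1%:R) * (h / n.+2%:R))%:E)%E.
  rewrite -mulrA EFinM -integral_id_onem_exp//.
  rewrite -ge0_integralZl//.
  - by apply: eq_integral => u _; rewrite -EFinM /g mulrCA.
  - by apply/measurable_EFinP; apply: measurable_funM => //; exact: measurable_onem_exp.
  - move=> u; rewrite /D/= in_itv/= => /andP[u0 uh]; rewrite lee_fin mulr_ge0// exprn_ge0// subr_ge0.
    by rewrite ler_pdivrMr// mul1r.
have f_int : (\int[mu]_(u in D) (f u)%:E = (f 0 * (h / n.+1%:R))%:E)%E.
  rewrite -(supp (fun u => (f u)%:E)); last by move=> u ->.
  by rewrite -VE (vol_svol M0 mK bK).
rewrite (integral_first_coord M0 mK bK); last by move=> x /KH /andP[].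
rewrite (supp (fun u => (u * f u)%:E)); last by move=> u ->; rewrite mulr0.
(* The middle third of [H, h]. There f vanishes, u - z >= p - H and g(u) >= g(q), so the comparison
   gains at least [e]. If H < h, then p > H, q > p and g(q) > 0; if H = h, the gain is 0. *)
set p := (2 * H + h) / 3; set q := (H + 2 * h) / 3.
have Hp : H <= p by rewrite /p; lra.
have pq : p <= q by rewrite /p /q; lra.
have qh : q <= h by rewrite /q; lra.
have p0 : 0 <= p by lra.
have gq0 : 0 <= g q by apply: gge0; apply/andP; split; lra.
set e := (p - H) * g q; have e0 : 0 <= e by rewrite mulr_ge0// subr_ge0.
pose J : set mR := `[p, q]%classic.
have mJ : measurable J by exact: measurable_itv.
exists (e * (q - p)).
  split; first by rewrite mulr_ge0// subr_ge0.
  move=> Hlth; rewrite !mulr_gt0 ?subr_gt0//; rewrite /p /q; try lra.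
  by apply: exprn_gt0; rewrite subr_gt0 ltr_pdivrMr//; lra.
(* This is (u - z) (g - f) >= e on J and >= 0 elsewhere, rearranged into nonnegative terms so that
   it can be integrated in the extended reals. As f and g have the same integral, the two terms with
   z then cancel. *)
have pointwise u : D u ->
    u * f u + z * g u + e * \1_J u <= u * g u + z * f u.
  rewrite /D/= in_itv/= => uD; have /andP[u0 uh] := uD.
  have [lo hi] := zP u uD; rewrite -/f -/(g u) in lo hi.
  have gu0 := gge0 _ uD; have fu0 := fge0 u.
  have [uJ|uJ] := boolP (u \in J); last first.
    rewrite indicE (negbTE uJ) mulr0 addr0.
    have [uz|zu|->] := ltgtP u z; last by lra.
      have gf := lo uz.
      have : 0 <= (z - u) * (f u - g u) by apply: mulr_ge0; rewrite subr_ge0//; exact: ltW.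
      by lra.
    have gf := hi zu.
    have : 0 <= (u - z) * (g u - f u) by apply: mulr_ge0; rewrite subr_ge0//; exact: ltW.
    by lra.
  rewrite indicE uJ mulr1; move/set_mem : uJ; rewrite /J/= in_itv/= => /andP[pu uq].
  have gqu : g q <= g u.
    have uq' : u / h <= q / h by rewrite ler_pM2r// invr_gt0.
    have q1 : q / h <= 1 by rewrite ler_pdivrMr// mul1r.
    by rewrite /g ler_pM2l//; apply: lerXn2r; rewrite ?nnegrE; lra.
  have [Hu|uH] := ltrP H u.
    rewrite (fH _ Hu) /e.
    have : 0 <= (p - H) * (g u - g q) by rewrite mulr_ge0// subr_ge0.
    have : 0 <= ((u - z) - (p - H)) * g u by rewrite mulr_ge0//; lra.
    by lra.
  (* Here H <= p <= u <= H, so the gain [e] is zero and the sign condition is enough. *)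
  have uE : u = H by lra.
  have pE : p = H by lra.
  rewrite /e pE subrr mul0r addr0.
  move: zH; rewrite -uE le_eqVlt => /predU1P[->|zu]; first by lra.
  have := hi zu => h1.
  have : 0 <= (u - z) * (g u - f u) by apply: mulr_ge0; rewrite subr_ge0//; exact: ltW.
  by lra.
have zfin : ((z * (f 0 * (h / n.+1%:R)))%:E \is a fin_num) by [].
have ze : (0 <= z%:E :> \bar R)%E by rewrite lee_fin.
have ee : (0 <= e%:E :> \bar R)%E by rewrite lee_fin.
have Dge u : D u -> 0 <= u /\ 0 <= u <= h by rewrite /D/= in_itv/= => /[dup] + -> => /andP[].
have muf : measurable_fun D (fun u : mR => (u * f u)%:E) by apply/measurable_EFinP; exact: measurable_funM.
have mug : measurable_fun D (fun u : mR => (u * g u)%:E) by apply/measurable_EFinP; exact: measurable_funM.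
have mzg : measurable_fun D (fun u : mR => (z * g u)%:E) by apply/measurable_EFinP; exact: measurable_funM.
have mzf : measurable_fun D (fun u : mR => (z * f u)%:E) by apply/measurable_EFinP; exact: measurable_funM.
have meJ : measurable_fun D (fun u : mR => (e * \1_J u)%:E).
  by apply/measurable_EFinP; apply: measurable_funM => //; exact: measurable_indic.
have uf0 u : D u -> (0 <= (u * f u)%:E)%E by move=> /Dge[? _]; rewrite lee_fin mulr_ge0.
have ug0 u : D u -> (0 <= (u * g u)%:E)%E by move=> /Dge[? ?]; rewrite lee_fin mulr_ge0// gge0.
have zg0 u : D u -> (0 <= (z * g u)%:E)%E by move=> /Dge[? ?]; rewrite lee_fin mulr_ge0// gge0.
have zf0 u : D u -> (0 <= (z * f u)%:E)%E by move=> _; rewrite lee_fin mulr_ge0.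
have eJ0 u : D u -> (0 <= (e * \1_J u)%:E)%E by move=> _; rewrite lee_fin mulr_ge0.
have mgE : measurable_fun D (fun u : mR => (g u)%:E) by apply/measurable_EFinP.
have mfE : measurable_fun D (fun u : mR => (f u)%:E) by apply/measurable_EFinP.
have gE0 u : D u -> (0 <= (g u)%:E)%E by move=> /Dge[_ ?]; rewrite lee_fin gge0.
have fE0 u : D u -> (0 <= (f u)%:E)%E by rewrite lee_fin.
have I1 : (\int[mu]_(u in D) (z * g u)%:E = (z * (f 0 * (h / n.+1%:R)))%:E)%E.
  by rewrite EFinM -g_int -(ge0_integralZl mu mD mgE gE0 ze).
have I2 : (\int[mu]_(u in D) (z * f u)%:E = (z * (f 0 * (h / n.+1%:R)))%:E)%E.
  by rewrite EFinM -f_int -(ge0_integralZl mu mD mfE fE0 ze).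
have I3 : (\int[mu]_(u in D) (e * \1_J u)%:E = (e * (q - p))%:E)%E.
  have mJE : measurable_fun D (fun u : mR => (\1_J u : R)%:E).
    by apply/measurable_EFinP; exact: measurable_indic.
  have JE0 u : D u -> (0 <= (\1_J u : R)%:E)%E by rewrite lee_fin.
  have muJ : mu J = (q - p)%:E.
    rewrite /J lebesgue_measure_itv/= lte_fin.
    by case: ltrP => // qp; congr EFin; lra.
  rewrite [RHS]EFinM -muJ -[X in (_ * mu X)%E](setIidl (B := D)); last first.
    by move=> u; rewrite /J /D/= !in_itv/= => /andP[pu uq]; apply/andP; split; lra.
  by rewrite -integral_indic// -(ge0_integralZl mu mD mJE JE0 ee).
have mA := emeasurable_funD muf mzg.
have pA u : D u -> (0 <= (u * f u)%:E + (z * g u)%:E)%E.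
  by move=> Du; rewrite adde_ge0 ?uf0 ?zg0.
have mB := emeasurable_funD mA meJ.
have mC := emeasurable_funD mug mzf.
have pB u : D u -> (0 <= (u * f u)%:E + (z * g u)%:E + (e * \1_J u)%:E)%E.
  by move=> Du; rewrite adde_ge0 ?pA ?eJ0.
have le u : D u -> ((u * f u)%:E + (z * g u)%:E + (e * \1_J u)%:E <=
    (u * g u)%:E + (z * f u)%:E)%E.
  by move=> Du; rewrite -!EFinD lee_fin pointwise.
have := ge0_le_integral mu mD pB mB mC le.
rewrite (ge0_integralD mu mD pA mA eJ0 meJ) (ge0_integralD mu mD uf0 muf zg0 mzg).
rewrite (ge0_integralD mu mD ug0 mug zf0 mzf) I1 I2 I3 ug_int => hle.
by rewrite -(leeD2rE _ _ zfin) addeAC.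
Qed.

End first_moment_bound.

(** * Volumes of polyhedra and of their sectors *)

Section volumes.
Variable R : realType.
Local Notation mR := (measurableTypeR R).
Local Notation mu := (@lebesgue_measure R).

(** In a chart T of b the map becomes y + y_0 T(w), which is triangular; the volume factors of T and
    of its inverse cancel. *)
Lemma scales_rank1 n (b w z : 'rV[R]_n.+1) : 0 < 1 + dotv b w ->
  scales (lebesgue_rV R n.+1)
    ((fun x => rank1 b w x + z) : 'rV[mR]_n.+1 -> 'rV[mR]_n.+1) (1 + dotv b w)^-1.
Proof.
move=> bw0.
have [->|b0] := eqVneq b 0.
  rewrite dotv0l addr0 invr1; have := scales_translate z.
  by congr scales; apply/funext => x; rewrite /rank1 dotv0l scale0r addr0.
have [T [T' [c [c0 TK T'K Tlin T0 Tc mT']]]] := chart b0.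
pose w' : 'rV[R]_n.+1 := T w.
have w'0 : w' 0 0 = dotv b w by exact: T0.
pose N : 'rV[mR]_n.+1 -> 'rV[mR]_n.+1 := rank1 (delta_mx 0 0) w'.
have mN : measurable_fun setT N.
  have := @measurable_rank1D R n.+1 (delta_mx 0 0) w' 0; congr measurable_fun.
  by apply/funext => x; rewrite addr0.
have NT (x : 'rV[R]_n.+1) : T (rank1 b w x) = N (T x).
  have -> : rank1 b w x = dotv b x *: w + x by rewrite /rank1 addrC.
  by rewrite Tlin /N /rank1 dotv_delta T0 addrC.
have sN : scales (lebesgue_rV R n.+1) N ((1 + dotv b w)^-1 * 1).
  apply: (@scales_lower R n (fun t : mR => (1 + w' 0 0) * t + 0 : mR)
    (fun t x => x + t *: (rV_split (w' : 'rV[mR]_n.+1)).2)) => //.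
  - by rewrite invr_ge0 ltW.
  - have bw' : 1 + w' 0 0 != 0 by rewrite w'0 gt_eqF.
    by have := scales_affine 0 bw'; rewrite w'0 gtr0_norm.
  - by move=> t; exact: scales_translate.
  - move=> t x; rewrite /N /rank1 dotv_delta; apply: rV_consP => [|j].
      by rewrite !rVE addr0 mulrDl mul1r mulrC.
    by rewrite !rVE.
have := scales_comp (scales_inv TK c0 mT' Tc) (scales_comp sN Tc).
have := fun h => scales_comp (scales_translate z) h.
move=> h /h; rewrite mul1r mulr1 mulrCA mulVf ?gt_eqF// mulr1.
by congr scales; apply/funext => x /=; rewrite -NT TK.
Qed.

Lemma vol_hyperplane n (b : 'rV[R]_n.+1) (c : R) : b != 0 ->
  lebesgue_rV R n.+1 [set x : 'rV[mR]_n.+1 | dotv b x = c] = 0%E.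
Proof.
move=> b0; have [T [T' [k [_ _ _ _ T0 Tc _]]]] := chart b0.
pose A (i : 'I_n.+1) : set mR := if i == ord0 then [set c] else setT.
have mA i : measurable (A i) by rewrite /A; case: ifP.
pose B : set 'rV[mR]_n.+1 := [set x | forall i, A i (x ord0 i)].
have mB : measurable B by exact: measurable_box.
have -> : [set x : 'rV[mR]_n.+1 | dotv b x = c] = T @^-1` B.
  apply/seteqP; split=> x /=.
    by move=> bx i; rewrite /A; case: ifPn => // /eqP ->; rewrite /= T0.
  by move=> /(_ ord0); rewrite /A eqxx /= T0.
rewrite Tc.2// [X in (_ * X)%E](lebesgue_rV_box mA) big_ord_recl /A eqxx.
by rewrite lebesgue_measure_set1 mul0e mule0.
Qed.

(** The strict inequalities hold on a whole cube around [x0]. The half-side [e] is the smallest gap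
    divided by a bound on the l1-norms of the functionals; the default 1 keeps the gap positive
    without constraints. *)
Lemma vol_open_gt0 n (I : finType) (c : I -> 'rV[R]_n) (d : I -> R) (x0 : 'rV[R]_n)
    (S : set 'rV[mR]_n) : measurable S ->
  (forall i, dotv (c i) x0 < d i) ->
  (forall x : 'rV[R]_n, (forall i, dotv (c i) x < d i) -> S x) ->
  (0 < lebesgue_rV R n S)%E.
Proof.
move=> mS x0d HS.
pose gap := \big[Num.min/1]_i (d i - dotv (c i) x0).
have gap0 : 0 < gap.
  by apply: lt_bigmin => // i _; rewrite subr_gt0.
have gapP i : gap <= d i - dotv (c i) x0 by exact: bigmin_le_cond.
pose C := 1 + \sum_i \sum_j `|c i ord0 j|.
have C1 i : \sum_j `|c i ord0 j| < C.
  rewrite /C (bigD1 i)//= addrCA -[X in X < _]addr0 ltrD2l ltr_pwDl//.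
  by apply: sumr_ge0 => k _; apply: sumr_ge0.
have C0 : 0 < C by rewrite /C ltr_pwDl//; apply: sumr_ge0 => k _; apply: sumr_ge0.
pose e := gap / C; have e0 : 0 < e by rewrite divr_gt0.
have eC : e * C = gap by rewrite /e mulfVK// gt_eqF.
pose B (j : 'I_n) : set mR := `]x0 ord0 j - e, x0 ord0 j + e[%classic.
have mB j : measurable (B j) by exact: measurable_itv.
pose Bx : set 'rV[mR]_n := [set x | forall i, B i (x ord0 i)].
apply: (@lt_le_trans _ _ (lebesgue_rV R n Bx)).
  rewrite [X in (_ < X)%E](lebesgue_rV_box mB) (eq_bigr (fun=> (2 * e)%:E)); last first.
    move=> i _; rewrite /B lebesgue_measure_itv/= lte_fin ifT; last by lra.
    by rewrite -EFinB; congr EFin; lra.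
  by rewrite prodEFin prodr_const lte_fin exprn_gt0// mulr_gt0.
have mBx : measurable Bx by exact: measurable_box.
apply: le_measure; rewrite ?inE// => x Bxx; apply: HS => i.
have : dotv (c i) (x : 'rV[R]_n) - dotv (c i) x0 <= e * \sum_j `|c i ord0 j|.
  rewrite -dotvBr /dotv mulr_sumr; apply: ler_sum => j _.
  have := Bxx j; rewrite /B /= in_itv/= => /andP[h1 h2].
  apply: le_trans (ler_norm _) _; rewrite normrM mulrC ler_wpM2r//.
  by rewrite !mxE ler_norml; apply/andP; split; lra.
have : e * \sum_j `|c i ord0 j| < gap by rewrite -eC ltr_pM2l.
have := gapP i; lra.
Qed.

(** Removing the null set [N] from every piece makes the pieces disjoint and changes no measure. *)
Lemma measure_almost_partition d (T : measurableType d) (nu : {measure set T -> \bar R})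
    m (Q : {pred 'I_m}) (F : 'I_m -> set T) (A N : set T) :
  measurable A -> measurable N -> nu N = 0%E -> (forall i, measurable (F i)) ->
  (forall i, Q i -> F i `<=` A) -> (forall x, A x -> exists2 i, Q i & F i x) ->
  (forall i j, Q i -> Q j -> i != j -> F i `&` F j `<=` N) ->
  nu A = (\sum_(i < m | Q i) nu (F i))%E.
Proof.
move=> mA mN N0 mF FA AF FN.
have drop S : measurable S -> nu (S `\` N) = nu S.
  move=> mS; rewrite [RHS](measureDI nu mS mN) [X in (_ + X)%E](_ : _ = 0%E) ?adde0//.
  by apply: (@subset_measure0 _ _ _ nu _ N) => //; exact: measurableI.
rewrite -drop// -(eq_bigr _ (fun i _ => drop _ (mF i))).
rewrite -measure_bigsetU_ord_cond; last 2 first.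
- by move=> i _; exact: measurableD.
- apply/trivIsetP => i j Qi Qj ij; apply/seteqP; split=> x // -[[Fi Ni] [Fj _]].
  by apply: Ni; apply: (FN i j).
congr (nu _); rewrite -bigcup_seq_cond; apply/seteqP; split=> x.
  move=> [Ax Nx]; have [i Qi Fi] := AF x Ax.
  by exists i => //=; rewrite mem_index_enum.
by move=> [i /= /andP[_ Qi]] [Fi Ni]; split=> //; exact: (FA i).
Qed.

End volumes.

Section polyhedron.
Variables (R : realType) (n m : nat) (a : 'I_m -> 'rV[R]_n.+1).
Local Notation mR := (measurableTypeR R).
Local Notation leb := (lebesgue_rV R n.+1).

Definition polyhedron : set 'rV[mR]_n.+1 := [set x | forall i, dotv (a i) x <= 1].

Definition slack j (x : 'rV[R]_n.+1) : R := 1 - dotv (a j) x.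

(* [radial p j x] is the s such that x = (1 - s) p + s f with f in the hyperplane
   of the j-th facet, and [sector p j] is the convex hull of p and this facet.
   Both are meaningful only if [slack j p != 0]. *)
Definition radial p j x : R := dotv (a j) (x - p) / slack j p.

Definition sector p j : set 'rV[mR]_n.+1 :=
  [set x | radial p j x <= 1 /\ forall k, dotv (a k) (x - p) <= radial p j x * slack k p].

Lemma slack_comb j x y t :
  slack j ((1 - t) *: x + t *: y) = (1 - t) * slack j x + t * slack j y.
Proof. by rewrite /slack dotvDr !dotvZr; lra. Qed.

Lemma slack0 j : slack j 0 = 1.
Proof. by rewrite /slack dotv0r subr0. Qed.

Lemma polyhedronP x : polyhedron x <-> forall j, 0 <= slack j x.
Proof. by split=> h j; have := h j; rewrite subr_ge0. Qed.

Lemma cvx_polyhedron : cvx polyhedron.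
Proof.
move=> x y t /polyhedronP Px /polyhedronP Py /andP[t0 t1]; apply/polyhedronP => j.
by rewrite slack_comb addr_ge0// mulr_ge0// subr_ge0.
Qed.

Lemma polyhedron0 : polyhedron 0.
Proof. by apply/polyhedronP => j; rewrite slack0. Qed.

Lemma measurable_slack j : measurable_fun [set: 'rV[mR]_n.+1] (slack j : 'rV[mR]_n.+1 -> mR).
Proof. by apply: measurable_funB => //; exact: measurable_dotv. Qed.

Lemma measurable_dotvB (b p : 'rV[R]_n.+1) :
  measurable_fun [set: 'rV[mR]_n.+1] ((fun x : 'rV[R]_n.+1 => dotv b (x - p)) : 'rV[mR]_n.+1 -> mR).
Proof.
rewrite (_ : (fun x => _) = fun x : 'rV[R]_n.+1 => dotv b x - dotv b p); last first.
  by apply/funext => x; rewrite dotvBr.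
by apply: measurable_funB => //; exact: measurable_dotv.
Qed.

Lemma measurable_le_set (F G : 'rV[mR]_n.+1 -> mR) :
  measurable_fun setT F -> measurable_fun setT G ->
  measurable [set x | (F x <= G x)%R].
Proof.
move=> mF mG; rewrite (_ : mkset _ = ~` [set x | ((G x)%:E < (F x)%:E)%E]).
  apply: measurableC; rewrite -[X in measurable X]setTI.
  by apply: measurable_lte => //; exact/measurable_EFinP.
apply/seteqP; split=> x /=; rewrite lte_fin => h; first by rewrite ltNge h.
by rewrite leNgt; apply/negP.
Qed.

Lemma measurable_polyhedron : measurable polyhedron.
Proof.
rewrite (_ : polyhedron = \bigcap_(i in [set: 'I_m])
   [set x : 'rV[mR]_n.+1 | (dotv (a i) x <= 1)%R]); last first.
  by apply/seteqP; split=> x h i; [move=> _|]; exact: h.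
apply: fin_bigcap_measurable => // i _; apply: measurable_le_set => //.
exact: measurable_dotv.
Qed.

Lemma measurable_radial p j :
  measurable_fun [set: 'rV[mR]_n.+1] (radial p j : 'rV[mR]_n.+1 -> mR).
Proof. by apply: measurable_funM => //; exact: measurable_dotvB. Qed.

Lemma measurable_sector p j : measurable (sector p j).
Proof.
rewrite (_ : sector p j = [set x : 'rV[mR]_n.+1 | (radial p j x <= 1)%R] `&`
   \bigcap_(k in [set: 'I_m])
   [set x : 'rV[mR]_n.+1 | (dotv (a k) ((x : 'rV[R]_n.+1) - p) <= radial p j x * slack k p)%R]); last first.
  apply/seteqP; split=> x [h1 h2]; split=> // k; first by move=> _; exact: h2.
  exact: h2.
apply: measurableI.
  by apply: measurable_le_set => //; exact: measurable_radial.
apply: fin_bigcap_measurable => // k _; apply: measurable_le_set.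
  exact: measurable_dotvB.
by apply: measurable_funM => //; exact: measurable_radial.
Qed.

Lemma sector_sub p j : polyhedron p -> sector p j `<=` polyhedron.
Proof.
move=> /polyhedronP Pp x [r1 rk]; apply/polyhedronP => k; rewrite /slack.
have := rk k; rewrite dotvBr; have := Pp k; rewrite /slack.
set c := dotv (a k) p; set r := radial p j x in r1 *; nra.
Qed.

(** The affine map y + (1 - <a_j, y>) p fixes the hyperplane of the j-th facet and sends 0 to p,
    hence one sector to the other; its linear part has determinant [slack j p]. *)
Lemma vol_sector p j : 0 < slack j p -> leb (sector p j) = ((slack j p)%:E * leb (sector 0 j))%E.
Proof.
move=> jp0; pose M : 'rV[mR]_n.+1 -> 'rV[mR]_n.+1 := fun y => rank1 (- a j) p y + p.
have sM : scales leb M (slack j p)^-1.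
  have := @scales_rank1 R n (- a j) p p; rewrite dotvNl; exact.
have ME (y : 'rV[R]_n.+1) : (M y : 'rV[R]_n.+1) - p = y - dotv (a j) y *: p.
  by rewrite /M addrK /rank1 dotvNl scaleNr.
have rE (y : 'rV[R]_n.+1) : radial p j (M y) = dotv (a j) y.
  rewrite /radial ME dotvBr dotvZr.
  have -> : dotv (a j) y - dotv (a j) y * dotv (a j) p = dotv (a j) y * slack j p.
    by rewrite /slack; lra.
  by rewrite mulfK// gt_eqF.
have r0E (y : 'rV[R]_n.+1) : radial 0 j y = dotv (a j) y.
  by rewrite /radial slack0 subr0 divr1.
have E : sector 0 j = M @^-1` sector p j.
  have iffM (y : 'rV[R]_n.+1) : sector 0 j y <-> sector p j (M y).
    rewrite /sector /= rE r0E; split=> -[r1 rk]; split=> // k; have := rk k;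
      rewrite ME subr0 slack0 mulr1 dotvBr dotvZr /slack; lra.
  by apply/seteqP; split=> y /iffM.
rewrite E sM.2; last exact: measurable_sector.
by rewrite muleA -EFinM divff ?mul1e// gt_eqF.
Qed.

Section bounded.
Variable M : R.
(** [facet_pt] is the form in which irredundance enters: a point in the relative interior of every
    facet. *)
Hypotheses (bP : bdd_by M polyhedron)
  (facet_pt : forall j, exists f, slack j f = 0 /\ forall k, k != j -> 0 < slack k f).

Lemma recession d : (forall k, dotv (a k) d <= 0) -> d = 0.
Proof.
move=> d0; apply/rowP => i; rewrite mxE; apply/eqP.
apply/negPn/negP => di.
have Pt t : 0 <= t -> polyhedron (t *: d).
  by move=> t0 k; rewrite /= dotvZr; have := d0 k; nra.
have di0 : 0 < `|d 0 i| by rewrite normr_gt0.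
have M0 : 0 <= M.
  by have := bP polyhedron0 i; rewrite mxE normr0.
have t0 : 0 <= (M + 1) / `|d 0 i|.
  by apply: divr_ge0; [lra|exact: ltW].
have := bP (Pt _ t0) i; rewrite mxE normrM ger0_norm// mulfVK ?gt_eqF//.
by lra.
Qed.

(** A negative value would make x - p a recession direction, hence zero by boundedness, and then
    [radial p j x] is 0 after all. *)
Lemma radial_ge0 p j x : 0 < slack j p -> polyhedron p -> sector p j x -> 0 <= radial p j x.
Proof.
move=> jp0 /polyhedronP Pp [_ rk]; rewrite leNgt; apply/negP => r0.
have : x - p = 0.
  apply: recession => k; apply: le_trans (rk k) _.
  by have := Pp k; nra.
by move=> E; move: r0; rewrite /radial E dotv0r mul0r ltxx.
Qed.

Lemma sectorP p j x : 0 < slack j p -> polyhedron p -> sector p j x ->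
  exists t f, [/\ 0 <= t <= 1, polyhedron f, slack j f = 0 & x = (1 - t) *: p + t *: f].
Proof.
move=> jp0 Pp Sx; have r0 := radial_ge0 jp0 Pp Sx; have [r1 rk] := Sx.
have [r0'|{}r0] : 0 = radial p j x \/ 0 < radial p j x.
- by move: r0; rewrite le_eqVlt => /predU1P.
- exists (radial p j x); move: r0' => {}r0.
  have xp : x - p = 0.
    by apply: recession => k; have := rk k; rewrite -r0 mul0r.
  have [f [fj fk]] := facet_pt j; exists f; split => //.
  - by rewrite -r0 lexx ler01.
  - apply/polyhedronP => k; have [->|/fk/ltW//] := eqVneq k j.
    by rewrite fj.
  - by rewrite -r0 subr0 scale1r scale0r addr0; apply/eqP; rewrite -subr_eq0 xp.
- exists (radial p j x).
set r := radial p j x in r0 r1 rk *.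
pose f := p + r^-1 *: (x - p).
have rf : r *: f = r *: p + (x - p).
  by rewrite /f scalerDr scalerA divff ?gt_eqF// scale1r.
exists f; split.
- by rewrite ltW.
- apply/polyhedronP => k; rewrite /f /slack dotvDr dotvZr.
  have := rk k; rewrite /slack; set u := dotv (a k) p; set w := dotv _ _ => h.
  have : r^-1 * w <= 1 - u by rewrite mulrC ler_pdivrMr// mulrC.
  by lra.
- rewrite /f /slack dotvDr dotvZr; have -> : dotv (a j) (x - p) = r * slack j p.
    by rewrite /r /radial mulfVK// gt_eqF.
  by rewrite mulKf ?gt_eqF// /slack; lra.
- by rewrite rf addrA -scalerDl subrK scale1r addrC subrK.
Qed.

(** The sector containing x belongs to the facet met by the ray from p through x, which maximizes
    [radial] among the facets missing p. *)
Lemma sector_cover p x : polyhedron p -> polyhedron x ->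
  exists2 j, 0 < slack j p & sector p j x.
Proof.
move=> /polyhedronP Pp /polyhedronP Px.
(* If p lay on every facet, -p would be a recession direction, so p = 0, which lies on none. Then
   there are no facets at all, and the polyhedron is the whole unbounded space. *)
have [j0 j0p] : exists j, 0 < slack j p.
  apply: contrapT => /forallNP no.
  have p1 k : dotv (a k) p = 1.
    by have := no k; have := Pp k; rewrite /slack => ? /negP; rewrite -leNgt; lra.
  have : - p = 0 by apply: recession => k; rewrite dotvNr p1; lra.
  move=> /eqP; rewrite oppr_eq0 => /eqP p0.
  have nm (k : 'I_m) : False by have := p1 k; rewrite p0 dotv0r => /eqP; rewrite eq_sym oner_eq0.
  have := recession (d := const_mx 1) (fun k => False_ind _ (nm k)).
  by move=> /rowP/(_ ord0) /eqP; rewrite !mxE oner_eq0.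
pose j := [arg max_(j > j0 | 0 < slack j p) radial p j x]%O.
have [jp jmax] : 0 < slack j p /\ forall k, 0 < slack k p -> radial p k x <= radial p j x.
  by rewrite /j; case: (@arg_maxP _ _ _ j0 (fun j => 0 < slack j p) (fun j => radial p j x) j0p).
exists j => //; split.
  rewrite /radial ler_pdivrMr// mul1r dotvBr /slack; have := Px j; rewrite /slack; lra.
move=> k; have := Pp k; rewrite le_eqVlt => /predU1P[k0|k0].
  rewrite -k0 mulr0 dotvBr; move: k0 (Px k); rewrite /slack; lra.
by have := jmax k k0; rewrite {1}/radial ler_pdivrMr.
Qed.

(** The two functionals are separated by f - p, with f in the relative interior of the j-th facet:
    the first takes the value 1, the second a smaller one. *)
Lemma slack_normal_inj p j k : 0 < slack j p -> 0 < slack k p -> j != k ->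
  (slack j p)^-1 *: a j != (slack k p)^-1 *: a k.
Proof.
move=> jp kp jk; apply/eqP => E.
have [f [fj fk]] := facet_pt j; have := fk k; rewrite eq_sym => /(_ jk) {}fk.
have := congr1 (fun u => dotv u (f - p)) E; rewrite !dotvZl !dotvBr.
have -> : dotv (a j) f - dotv (a j) p = slack j p by move: fj; rewrite /slack; lra.
rewrite mulVf ?gt_eqF// => e.
have : dotv (a k) f - dotv (a k) p < slack k p by move: fk; rewrite /slack; lra.
have : slack k p * 1 = dotv (a k) f - dotv (a k) p by rewrite e mulVKf// gt_eqF.
by lra.
Qed.

(** On the overlap of the sectors j and k the functions [radial p j] and [radial p k] agree, which
    confines it to a hyperplane through p. *)
Lemma vol_decomposition p : polyhedron p ->
  leb polyhedron = (\sum_(j < m | (0 < slack j p)%R) leb (sector p j))%E.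
Proof.
move=> Pp.
pose u j := (slack j p)^-1 *: a j.
pose hyp jk : set 'rV[mR]_n.+1 :=
  [set x : 'rV[mR]_n.+1 | dotv (u jk.1 - u jk.2) x = dotv (u jk.1 - u jk.2) p].
pose Q (jk : 'I_m * 'I_m) := [&& 0 < slack jk.1 p, 0 < slack jk.2 p & jk.1 != jk.2].
pose N : set 'rV[mR]_n.+1 := \big[setU/set0]_(jk | Q jk) hyp jk.
have mh jk : measurable (hyp jk).
  rewrite (_ : hyp jk = (dotv (u jk.1 - u jk.2) : 'rV[mR]_n.+1 -> mR) @^-1`
     [set dotv (u jk.1 - u jk.2) p])//.
  by apply: measurable_preimage => //; exact: measurable_dotv.
apply: (@measure_almost_partition _ _ _ leb m (fun j => 0 < slack j p) _ _ N).
- exact: measurable_polyhedron.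
- by apply: bigsetU_measurable.
- suff [] : measurable N /\ leb N = 0%E by [].
  apply: (big_ind (fun S : set 'rV[mR]_n.+1 => measurable S /\ leb S = 0%E)) => //.
    move=> S S' [mS S0] [mS' S'0]; split; first exact: measurableU.
    by rewrite measureU0.
  move=> [j k] /and3P[/= jp kp jk]; split; first exact: mh.
  by apply: vol_hyperplane; rewrite subr_eq0; exact: slack_normal_inj.
- by move=> j; exact: measurable_sector.
- by move=> j _; exact: sector_sub.
- by move=> x; exact: sector_cover.
- move=> j k jp kp jk x [[_ jx] [_ kx]].
  rewrite /N -bigcup_seq_cond; exists (j, k); first by rewrite /= mem_index_enum /Q /= jp kp jk.
  rewrite /hyp /=; apply/eqP; rewrite -subr_eq0 -dotvBr dotvBl !dotvZl.
  have h1 : radial p k x <= radial p j x by rewrite {1}/radial ler_pdivrMr.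
  have h2 : radial p j x <= radial p k x by rewrite {1}/radial ler_pdivrMr.
  by rewrite subr_eq0 ![(slack _ _)^-1 * _]mulrC eq_le h1 h2.
Qed.

End bounded.
End polyhedron.

(** * Centered polyhedra *)

Section centered_polyhedron.
Variables (R : realType) (n m : nat) (a : 'I_m -> 'rV[R]_n.+1) (M : R).
Local Notation mR := (measurableTypeR R).
Local Notation leb := (lebesgue_rV R n.+1).
Local Notation P := (polyhedron a).
Local Notation slack := (slack a).
Local Notation sector := (sector a).
Hypotheses (bP : bdd_by M P)
  (facet_pt : forall j, exists f, slack j f = 0 /\ forall k, k != j -> 0 < slack k f).

Let M0 : 0 <= M.
Proof. by have := bP (polyhedron0 a) ord0; rewrite mxE normr0. Qed.

Let mP : measurable P := measurable_polyhedron a.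

Definition pvol : R := fine (leb P).

Lemma pvolE : leb P = pvol%:E.
Proof.
rewrite /pvol fineK// ge0_fin_numE//.
exact: le_lt_trans (vol_bdd_by M0 mP bP) (ltry _).
Qed.

Lemma pvol_gt0 : 0 < pvol.
Proof.
rewrite -lte_fin -pvolE; apply: (@vol_open_gt0 R _ _ a (fun=> 1) 0) => //.
  by move=> i; rewrite dotv0r.
by move=> x ax i; rewrite ltW.
Qed.

Definition svolume j : R := fine (leb (sector 0 j)).

Let sector0_sub j : sector 0 j `<=` P.
Proof. by apply: sector_sub; exact: polyhedron0. Qed.

Lemma svolumeE j : leb (sector 0 j) = (svolume j)%:E.
Proof.
rewrite /svolume fineK// ge0_fin_numE//.
apply: (@le_lt_trans _ _ (leb P)); last by rewrite pvolE ltry.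
by apply: le_measure; rewrite ?inE//; exact: measurable_sector.
Qed.

Lemma sector0E j x : sector 0 j x <->
  dotv (a j) x <= 1 /\ forall k, dotv (a k) x <= dotv (a j) x.
Proof.
by rewrite /sector /= /radial slack0 subr0 divr1; split=> -[h1 h2]; split=> // k;
  have := h2 k; rewrite slack0 mulr1.
Qed.

Lemma svolume_gt0 j : 0 < svolume j.
Proof.
rewrite -lte_fin -svolumeE; have [f [fj fk]] := facet_pt j.
have fj1 : dotv (a j) f = 1 by move: fj; rewrite /slack; lra.
apply: (@vol_open_gt0 R _ _ (fun k => if k == j then a j else a k - a j)
  (fun k => if k == j then 1 else 0) (2^-1 *: f)).
- exact: measurable_sector.
- move=> k; case: ifPn => [_|/fk]; first by rewrite dotvZr fj1; lra.
  by rewrite dotvZr dotvBl fj1 /slack; lra.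
- move=> x hx; apply/sector0E; have hj := hx j; rewrite eqxx in hj.
  split=> [|k]; first exact: ltW.
  have [->//|kj] := eqVneq k j; have := hx k.
  by rewrite (negbTE kj) dotvBl subr_lt0 => /ltW.
Qed.

Lemma svolume_sum p : P p -> pvol = \sum_(j < m | 0 < slack j p) slack j p * svolume j.
Proof.
move=> Pp; apply: EFin_inj; rewrite -pvolE (vol_decomposition bP facet_pt Pp) -sumEFin.
by apply: eq_bigr => j jp; rewrite vol_sector// svolumeE.
Qed.

Hypothesis centP : forall j, (\int[leb]_(x in P) (slack j x)%:E = leb P)%E.

Let radonP (f : 'rV[mR]_n.+1 -> R) v : P v -> measurable_fun setT (f : _ -> mR) ->
  (forall x, P x -> 0 <= f x) ->
  (forall x y t, P x -> P y -> 0 <= t <= 1 ->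
    (1 - t) * f x + t * f y <= f ((1 - t) *: (x : 'rV[R]_n.+1) + t *: (y : 'rV[R]_n.+1))) ->
  ((f v * pvol)%:E <= n.+2%:R%:E * \int[leb]_(x in P) (f x)%:E)%E.
Proof.
move=> Pv mf f0 fc; rewrite EFinM -pvolE; apply: radon_le => //.
  exact: cvx_polyhedron.
by rewrite pvolE ltry.
Qed.

Lemma slack_le j v : P v -> slack j v <= n.+2%:R.
Proof.
move=> Pv.
have := @radonP (slack j) v Pv (measurable_slack a j).
rewrite centP pvolE -EFinM lee_fin ler_pM2r ?pvol_gt0//; apply.
  by move=> x /polyhedronP.
by move=> x y t _ _ _; rewrite slack_comb.
Qed.

Lemma slack_max_inj j k v : P v -> slack j v = n.+2%:R -> slack k v = n.+2%:R -> j = k.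
Proof.
move=> Pv jv kv; apply/eqP/negPn/negP => jk.
pose f (x : 'rV[mR]_n.+1) : R := Num.min (slack j x) (slack k x).
have fj x : f x <= slack j x by rewrite /f ge_min lexx.
have fk x : f x <= slack k x by rewrite /f ge_min lexx orbT.
have f0 x : P x -> 0 <= f x.
  by move=> /polyhedronP Px; rewrite /f le_min !Px.
have mf : measurable_fun setT (f : _ -> mR).
  by apply: measurable_minr; exact: measurable_slack.
have fv : f v = n.+2%:R by rewrite /f jv kv minxx.
have := @radonP f v Pv mf f0; rewrite fv EFinM => H.
have {}H : (pvol%:E <= \int[leb]_(x in P) (f x)%:E)%E.
  have n0 : (0 < n.+2%:R :> R) by [].
  rewrite -(@lee_pmul2l R n.+2%:R%:E) ?lte_fin//; apply: H.
  move=> x y t _ _ /andP[t0 t1]; have t1' : 0 <= 1 - t by rewrite subr_ge0.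
  rewrite {3}/f le_min !slack_comb; apply/andP; split; apply: lerD;
    by apply: ler_wpM2l => //; (exact: fj || exact: fk).
(* The minimum must lose mass. Near a relative interior point p of the k-th facet, [slack k] is
   below [slack j]; at the interior point p/2 of P the difference is 2 d, so it exceeds d on a set N
   of positive volume. Then pvol + d vol N <= pvol, a contradiction. *)
have [p [pk p_gt0]] := facet_pt k; have pj := p_gt0 j jk.
pose d := slack j p / 4; have d0 : 0 < d by rewrite divr_gt0.
have jE : slack j p = 1 - dotv (a j) p by [].
have kE : dotv (a k) p = 1 by move: pk; rewrite /slack; lra.
pose N : set 'rV[mR]_n.+1 := P `&` [set x | (slack k x + d <= slack j x)%R].
have mN : measurable N.
  apply: measurableI => //; apply: measurable_le_set; last exact: measurable_slack.
  by apply: measurable_funD => //; exact: measurable_slack.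
have N0 : (0 < leb N)%E.
  apply: (@vol_open_gt0 R _ (option 'I_m) (fun o => if o is Some i then a i else a j - a k)
    (fun o => if o is Some i then 1 else - d) (2^-1 *: p)) => //.
    case=> [i|]; last by rewrite dotvZr dotvBl kE /d jE; lra.
    rewrite dotvZr; have [->|/p_gt0] := eqVneq i k; first by rewrite kE; lra.
    by rewrite /slack; lra.
  move=> x hx; split; first by move=> i; exact: ltW (hx (Some i)).
  by have := hx None; rewrite /= dotvBl /slack; lra.
have NP : N `<=` P by move=> x [].
have N1 x : N x -> f x + d <= slack j x.
  by move=> [_ /= h]; rewrite (le_trans _ h)// lerD2r.
have meas (g : 'rV[mR]_n.+1 -> R) : measurable_fun setT (g : _ -> mR) ->
    measurable_fun P (fun x => (g x)%:E).
  by move=> mg; apply: measurable_funTS; apply/measurable_EFinP.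
have d0e : (0 <= d%:E :> \bar R)%E by rewrite lee_fin ltW.
have mJE : measurable_fun P (fun x : 'rV[mR]_n.+1 => (\1_N x : R)%:E).
  by apply/measurable_EFinP; exact: measurable_indic.
have J0 x : P x -> (0 <= (\1_N x : R)%:E)%E by rewrite lee_fin.
have md : measurable_fun P (fun x : 'rV[mR]_n.+1 => (d%:E * (\1_N x : R)%:E)%E).
  exact: measurable_funeM.
have dJ0 x : P x -> (0 <= d%:E * (\1_N x : R)%:E)%E.
  by move=> Px; apply: mule_ge0 => //; exact: J0.
have f0e x : P x -> (0 <= (f x)%:E)%E by move=> Px; rewrite lee_fin f0.
have le x : P x -> ((f x)%:E + d%:E * (\1_N x : R)%:E <= (slack j x)%:E)%E.
  move=> Px; rewrite -EFinM -EFinD lee_fin indicE.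
  case: (boolP (x \in N)) => [/set_mem /N1|_]; first by rewrite mulr1.
  by rewrite mulr0 addr0.
have fd0 x : P x -> (0 <= (f x)%:E + d%:E * (\1_N x : R)%:E)%E.
  by move=> Px; apply: adde_ge0; [exact: f0e|exact: dJ0].
have := ge0_le_integral leb mP fd0 (emeasurable_funD (meas _ mf) md)
  (meas _ (measurable_slack a j)) le.
rewrite (ge0_integralD leb mP f0e (meas _ mf) dJ0 md).
rewrite (ge0_integralZl leb mP mJE J0 d0e) integral_indic// setIidl//.
rewrite centP pvolE => h.
have {h} : (pvol%:E + d%:E * leb N <= pvol%:E)%E by apply: le_trans h; rewrite leeD2r.
rewrite -[X in (_ <= X)%E]adde0 leeD2lE// => h.
have := mule_gt0 (_ : 0 < d%:E)%E N0; rewrite lte_fin => /(_ d0).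
by rewrite ltNge h.
Qed.

End centered_polyhedron.

(** * Volume of the cone over one facet compared with the volume of P *)

Section volume_ratio.
Variables (R : realType) (n m : nat) (a : 'I_m -> 'rV[R]_n.+1) (M : R).
Local Notation mR := (measurableTypeR R).
Local Notation mu := (@lebesgue_measure R).
Local Notation leb := (lebesgue_rV R n.+1).
Local Notation P := (polyhedron a).
Local Notation slack := (slack a).
Local Notation sector := (sector a).
Local Notation svolume := (svolume a).
Local Notation pvol := (pvol a).
Hypotheses (bP : bdd_by M P)
  (facet_pt : forall j, exists f, slack j f = 0 /\ forall k, k != j -> 0 < slack k f).
Hypothesis centP : forall j, (\int[leb]_(x in P) (slack j x)%:E = leb P)%E.

Let mP : measurable P := measurable_polyhedron a.

Lemma linear_bdd (T : 'rV[R]_n.+1 -> 'rV[R]_n.+1) : 0 <= M ->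
  (forall s x y, T (s *: x + y) = s *: T x + T y) ->
  exists2 C, 0 <= C & forall x : 'rV[R]_n.+1, (forall i, `|x 0 i| <= M) ->
    forall i, `|T x 0 i| <= C.
Proof.
move=> M0 Tlin.
have T0 : T 0 = 0.
  have := Tlin 1 0 0; rewrite scaler0 addr0 scale1r => /eqP.
  by rewrite -subr_eq0 opprD addrA subrr sub0r oppr_eq0 => /eqP.
have TD x y : T (x + y) = T x + T y by rewrite -[x in LHS]scale1r Tlin scale1r.
have TZ s x : T (s *: x) = s *: T x by rewrite -[_ *: _]addr0 Tlin T0 addr0.
pose C := \sum_i \sum_(j < n.+1) M * `|T (delta_mx 0 j) 0 i|.
exists C; first by apply: sumr_ge0 => i _; apply: sumr_ge0 => j _; rewrite mulr_ge0.
move=> x xM i.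
have -> : T x = \sum_j x 0 j *: T (delta_mx 0 j).
  rewrite [x in LHS]row_sum_delta (big_morph T TD T0).
  by apply: eq_bigr => j _; rewrite TZ.
rewrite summxE; apply: (le_trans (ler_norm_sum _ _ _)).
apply: (@le_trans _ _ (\sum_(j < n.+1) M * `|T (delta_mx 0 j) 0 i|)).
  by apply: ler_sum => j _; rewrite mxE normrM ler_wpM2r.
rewrite /C [leRHS](bigD1 i)//= lerDl; apply: sumr_ge0 => k _.
by apply: sumr_ge0 => j _; rewrite mulr_ge0.
Qed.

Section chart.
Variables (i : 'I_m) (T T' : 'rV[mR]_n.+1 -> 'rV[mR]_n.+1) (c : R).
Hypothesis TP : is_chart (- a i) T T' c.

Let e : 'rV[R]_n.+1 := delta_mx 0 0.
(** The chart of -a_i yields -<a_i, x>; the shift by [e] turns it into [slack i], so the i-th facet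
    lies at height 0 and the origin at height 1. *)
Definition flat (x : 'rV[mR]_n.+1) : 'rV[mR]_n.+1 := (T x : 'rV[R]_n.+1) + e.
Definition unflat (y : 'rV[mR]_n.+1) : 'rV[mR]_n.+1 := T' ((y : 'rV[R]_n.+1) - e).

Lemma flatK : cancel flat unflat.
Proof. by move=> x; rewrite /flat /unflat addrK (chartK TP). Qed.

Lemma unflatK : cancel unflat flat.
Proof. by move=> x; rewrite /flat /unflat (chartVK TP) subrK. Qed.

Lemma flat_comb (x y : 'rV[R]_n.+1) t :
  flat ((1 - t) *: x + t *: y) = (1 - t) *: (flat x : 'rV[R]_n.+1) + t *: (flat y : 'rV[R]_n.+1).
Proof.
have TD (u w : 'rV[R]_n.+1) : (T (u + w) : 'rV[R]_n.+1) = (T u : 'rV[R]_n.+1) + T w.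
  by rewrite -[u in LHS]scale1r (chart_linear TP) scale1r.
have T0 : T 0 = 0 :> 'rV[R]_n.+1.
  have := TD 0 0; rewrite addr0 => /eqP.
  by rewrite -subr_eq0 opprD addrA subrr sub0r oppr_eq0 => /eqP.
have TZ s (u : 'rV[R]_n.+1) : (T (s *: u) : 'rV[R]_n.+1) = s *: (T u : 'rV[R]_n.+1).
  by rewrite -[_ *: _]addr0 (chart_linear TP) T0 addr0.
rewrite /flat TD !TZ !scalerDr addrACA -scalerDl subrK scale1r.
by [].
Qed.

Lemma unflat_comb (x y : 'rV[R]_n.+1) t :
  unflat ((1 - t) *: x + t *: y) =
  (1 - t) *: (unflat x : 'rV[R]_n.+1) + t *: (unflat y : 'rV[R]_n.+1).
Proof. by apply: (can_inj flatK); rewrite unflatK flat_comb !unflatK. Qed.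

Lemma flat0 (x : 'rV[R]_n.+1) : flat x 0 0 = slack i x.
Proof. by rewrite /flat rVDE (chart_dotv TP) dotvNl /e mxE /slack /= addrC. Qed.

Lemma unflat0 (y : 'rV[R]_n.+1) : slack i (unflat y) = y 0 0.
Proof. by rewrite -flat0 unflatK. Qed.

Lemma measurable_unflat : measurable_fun setT unflat.
Proof.
apply: (@measurableT_comp _ _ _ _ _ _ T'); first exact: chart_measurable TP.
exact: (scales_translate (- e)).1.
Qed.

Lemma scales_flat : scales leb flat c.
Proof.
have := scales_comp (scales_translate e) (chart_scales TP).
by rewrite mul1r.
Qed.

Lemma vol_unflat S : measurable S -> leb S = (c%:E * leb (unflat @^-1` S))%E.
Proof.
move=> mS; rewrite -scales_flat.2; last exact: measurable_preimage measurable_unflat mS.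
by congr (leb _); apply/seteqP; split=> x; rewrite /= flatK.
Qed.

Let K := unflat @^-1` P.
Let mK : measurable K. Proof. exact: measurable_preimage measurable_unflat mP. Qed.

Let cK : cvx K.
Proof.
by move=> x y t Kx Ky t01; rewrite /K /= unflat_comb; exact: cvx_polyhedron.
Qed.

Let M0 : 0 <= M.
Proof. by have := bP (polyhedron0 a) ord0; rewrite mxE normr0. Qed.

Let bK : exists2 C, 0 <= C & bdd_by C K.
Proof.
have [C C0 TC] := linear_bdd M0 (chart_linear TP).
exists (C + 1); first lra.
move=> y Ky j; rewrite -(unflatK y) /flat rVDE.
apply: le_trans (ler_normD _ _) _; apply: lerD.
  exact: (TC _ (bP Ky)).
by rewrite /e mxE eqxx /=; case: (_ == _); rewrite ?normr1 ?normr0.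
Qed.

(** The section of the cone C_i at height u is the bottom section contracted by 1 - u, and (1 - u)^n
    has integral 1/(n+1) over [0, 1]. *)
Lemma svolume_flat : svolume i = c * (svol K 0 / n.+1%:R).
Proof.
have [C C0 bKC] := bK.
set G := unflat @^-1` sector 0 i.
have mG : measurable G by exact: measurable_preimage measurable_unflat (measurable_sector a 0 i).
have GK : G `<=` K by move=> y; apply: sector_sub; exact: polyhedron0.
have bG : bdd_by C G by move=> y /GK; exact: bKC.
apply: EFin_inj; rewrite -(svolumeE bP) vol_unflat; last exact: measurable_sector.
rewrite EFinM; congr (_ * _)%E; rewrite (vol_svol C0 mG bG).
have Gi u x : G (rV_cons (u, x)) -> 0 <= u <= 1.
  move=> Gux; have r0 := radial_ge0 bP (_ : 0 < slack i 0) (polyhedron0 a) Gux.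
  have := unflat0 (rV_cons (u, x)); rewrite rV_cons0 /= => <-.
  have := (sector0E a i _).1 Gux => -[h1 _].
  move: r0; rewrite slack0 ltr01 => /(_ isT); rewrite /radial slack0 subr0 divr1 /slack; lra.
rewrite (@integral_support R `[0, 1]%classic); last first.
  move=> u u01; rewrite /svol (_ : slice G u = set0) ?measure0//.
  by apply/seteqP; split=> x // /Gi u01'; apply: u01; rewrite /= in_itv.
(* At height 1 the contraction degenerates to a point and has no scaling factor, so this height is
   left out. *)
rewrite -integral_itv_bndo_bndc; last first.
  by apply/measurable_EFinP; apply: measurable_funTS; exact: measurable_svol C0 mG bG.
pose w := (rV_split (flat 0)).2.
have flat0E : flat 0 = rV_cons (1 : mR, w).
  apply: rV_consP => [|j]; last by rewrite !rVE.
  by rewrite rV_cons0 flat0 slack0.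
have sec u (f : 'rV[R]_n.+1) : 0 <= u < 1 -> slack i f = 0 -> sector 0 i ((1 - u) *: f) <-> P f.
  move=> /andP[u0 u1] fi; have fi1 : dotv (a i) f = 1 by move: fi; rewrite /slack; lra.
  have u1' : 0 < 1 - u by lra.
  rewrite sector0E dotvZr fi1 mulr1; split=> [[_ h] k|h].
    by have := h k; rewrite dotvZr -[leRHS]mulr1 ler_pM2l.
  by split=> [|k]; [lra|rewrite dotvZr -[leRHS]mulr1 ler_pM2l//; exact: h].
have svG u : 0 <= u < 1 -> svol G u = svol K 0 * (1 - u) ^+ n.
  move=> u01; have /andP[u0 u1] := u01; have u1' : 0 < 1 - u by lra.
  pose g : 'rV[mR]_n -> 'rV[mR]_n :=
    fun x : 'rV[R]_n => (1 - u) *: x + u *: (w : 'rV[R]_n).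
  have sg : scales (lebesgue_rV R n) g ((1 - u)^-1 ^+ n) by exact: scales_dilation.
  have E : slice K 0%R = g @^-1` slice G u.
    have iffx x : slice K 0 x <-> slice G u (g x).
      have EQ : (unflat (rV_cons (u : mR, g x)) : 'rV[R]_n.+1) =
          (1 - u) *: (unflat (rV_cons (0 : mR, x)) : 'rV[R]_n.+1).
        have := unflat_comb (rV_cons (0 : mR, x)) (flat 0) u.
        rewrite flatK scaler0 addr0 => <-; rewrite flat0E -rV_cons_comb.
        by rewrite mulr0 add0r mulr1.
      apply: iff_sym; rewrite /slice /G /= EQ; apply: sec => //.
      by rewrite unflat0 rV_cons0.
    by apply/seteqP; split=> x /iffx.
  have : lebesgue_rV R n (slice K 0%R) = (((1 - u)^-1 ^+ n)%:E * lebesgue_rV R n (slice G u))%E.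
    by rewrite E sg.2//; exact: measurable_slice.
  rewrite (svolE C0 mK bKC) (svolE C0 mG bG) -EFinM => -[->].
  by rewrite mulrAC -exprMn mulVf ?gt_eqF// expr1n mul1r.
rewrite (eq_integral (fun u : mR => (svol K 0 * (1 - u / 1) ^+ n)%:E)); last first.
  by move=> u /set_mem /=; rewrite in_itv/= => u01; rewrite divr1 svG.
rewrite integral_itv_bndo_bndc; last first.
  apply/measurable_EFinP; apply: measurable_funM => //; exact: measurable_onem_exp.
under eq_integral do rewrite EFinM.
rewrite ge0_integralZl//=.
- by rewrite integral_onem_exp// -EFinM div1r.
- by apply/measurable_EFinP; exact: measurable_onem_exp.
- move=> u; rewrite ?in_itv/= => /andP[u0 u1]; rewrite lee_fin exprn_ge0//.
  by rewrite divr1 subr_ge0.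
- by rewrite lee_fin svol_ge0.
Qed.

Lemma volume_ratio_chart v : P v -> (forall x, P x -> slack i x <= slack i v) ->
  n.+2%:R * svolume i <= pvol /\
  (n.+2%:R * svolume i = pvol -> pvol = slack i v * svolume i).
Proof.
move=> Pv vmax; have [C C0 bKC] := bK; have c0 := chart_gt0 TP.
set H := slack i v; set s := svolume i; set f0 := svol K 0.
have s0 : 0 < s := svolume_gt0 bP facet_pt i.
have V0 : 0 < pvol := pvol_gt0 bP.
have H0 : 0 < H.
  by apply: (lt_le_trans (@ltr01 R)); rewrite -(slack0 a i); apply: vmax; exact: polyhedron0.
have n1 : 0 < n.+1%:R :> R by [].
have n2 : 0 < n.+2%:R :> R by [].
have sE : s = c * (f0 / n.+1%:R) by exact: svolume_flat.
have f00 : 0 < f0.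
  by have := s0; rewrite sE pmulr_rgt0// pmulr_lgt0 ?invr_gt0.
(* The height of the pyramid over the i-th facet that has the volume of P; H <= h because H s is one
   term of the decomposition of P seen from v. *)
pose h := pvol / s; have hs : h * s = pvol by rewrite /h mulfVK// gt_eqF.
have Hs : H * s <= pvol.
  rewrite (svolume_sum bP facet_pt Pv) (bigD1 i)//= lerDl.
  apply: sumr_ge0 => j /andP[jv _]; apply: mulr_ge0; first exact: ltW.
  exact/ltW/(svolume_gt0 bP facet_pt).
have Hh : H <= h by rewrite ler_pdivlMr.
have KE : leb K = (f0 * (h / n.+1%:R))%:E.
  have : leb P = (c%:E * leb K)%E by exact: vol_unflat.
  rewrite (pvolE bP) -hs sE => e1.
  have -> : leb K = (c^-1%:E * (c%:E * leb K))%E.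
    by rewrite muleA -EFinM mulVf ?gt_eqF// mul1e.
  rewrite -e1 -EFinM; congr EFin.
  have -> : h * (c * (f0 / n.+1%:R)) = c * (f0 * (h / n.+1%:R)).
    by rewrite mulrCA; congr (c * _); rewrite mulrCA.
  by rewrite mulKf// gt_eqF.
have flatP : flat @^-1` K = P by apply/seteqP; split=> x; rewrite /K /= flatK.
(* Centering, transported by the chart: the first moment of K in the direction of height equals its
   volume, which bounds h below by [n.+2]. *)
have I1 : (\int[leb]_(x in K) (x ord0 ord0)%:E = (f0 * (h / n.+1%:R))%:E)%E.
  have mc : measurable_fun K (fun x : 'rV[mR]_n.+1 => (x ord0 ord0)%:E).
    by apply: measurable_funTS; apply/measurable_EFinP; exact: (@measurable_coord_rV _ mR).
  have K0 (x : 'rV[mR]_n.+1) : K x -> (0 <= (x ord0 ord0)%:E :> \bar R)%E.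
    by move=> /polyhedronP/(_ i); rewrite unflat0 lee_fin.
  have := ge0_integral_scales scales_flat (ltW c0) mK mc K0.
  have E2 : (\int[leb]_(x in P) (flat x ord0 ord0)%:E = c%:E * leb K)%E.
    rewrite -vol_unflat// -(centP i); apply: eq_integral => x _.
    by rewrite flat0.
  rewrite flatP => e1; have {}e1 := etrans (esym E2) e1.
  have cc z : z = (c^-1%:E * (c%:E * z))%E.
    by rewrite muleA -EFinM mulVf ?gt_eqF// mul1e.
  by rewrite -KE [LHS]cc -e1 -cc.
have KH (x : 'rV[R]_n.+1) : K x -> 0 <= x 0 0 <= H.
  by move=> Kx; rewrite -unflat0 vmax// andbT; move/polyhedronP : Kx; exact.
have Kv : K (flat v) by rewrite /K /= flatK.
have [d [d0 dH]] := first_moment_le C0 mK bKC cK Kv (flat0 v) H0 Hh KH f00 KE.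
rewrite I1 -EFinD lee_fin -/f0.
set X := f0 * (h / n.+1%:R).
have X0 : 0 < X by rewrite !mulr_gt0 ?invr_gt0// divr_gt0.
move=> hX; have hn : n.+2%:R <= h.
  have : 1 <= h / n.+2%:R.
    by rewrite -(ler_pM2l X0) mulr1; apply: le_trans hX; rewrite lerDl.
  by rewrite ler_pdivlMr// mul1r.
split; first by rewrite -hs ler_pM2r.
rewrite -hs => /(mulIf (lt0r_neq0 s0)) nh.
(* With h = [n.+2] the first-moment bound leaves no room for a positive gain d. *)
have : ~ H < h.
  move=> /dH; move: hX; rewrite -nh divff ?gt_eqF// mulr1; lra.
by move=> /negP; rewrite -leNgt => hH; congr (_ * _); apply/eqP; rewrite eq_le hH Hh.
Qed.
End chart.

Lemma volume_ratio i v : P v -> (forall x, P x -> slack i x <= slack i v) ->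
  n.+2%:R * svolume i <= pvol /\
  (n.+2%:R * svolume i = pvol -> pvol = slack i v * svolume i).
Proof.
have ai0 : - a i != 0.
  rewrite oppr_eq0; apply/eqP => ai; have [f [fi _]] := facet_pt i.
  by move: fi; rewrite /slack ai dotv0l subr0 => /eqP; rewrite oner_eq0.
have [T [T' [c TP]]] := chart ai0.
exact: volume_ratio_chart TP v.
Qed.

End volume_ratio.

(** * Pyramids in terms of the slacks of their apex *)

Section apexes.
Variables (R : realType) (n m : nat) (a : 'I_m -> 'rV[R]_n.+1) (M : R).
Local Notation mR := (measurableTypeR R).
Local Notation leb := (lebesgue_rV R n.+1).
Local Notation P := (polyhedron a).
Local Notation slack := (slack a).
Local Notation svolume := (svolume a).
Local Notation pvol := (pvol a).
Hypotheses (bP : bdd_by M P)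
  (facet_pt : forall j, exists f, slack j f = 0 /\ forall k, k != j -> 0 < slack k f).
Hypothesis centP : forall j, (\int[leb]_(x in P) (slack j x)%:E = leb P)%E.

(* P is the pyramid with apex v over its i-th facet *)
Definition sees_only i v := 0 < slack i v /\ forall k, 0 < slack k v -> k = i.

Lemma sees_only_cover i v x : P v -> sees_only i v -> P x ->
  exists t f, [/\ 0 <= t <= 1, P f, slack i f = 0 & x = (1 - t) *: v + t *: f].
Proof.
move=> Pv [iv uniq] Px; have [j jv Sx] := sector_cover bP Pv Px.
by have ji := uniq _ jv; rewrite ji in Sx; exact: (sectorP bP facet_pt iv Pv Sx).
Qed.

Lemma sees_only_pvol i v : P v -> sees_only i v -> pvol = slack i v * svolume i.
Proof.
move=> Pv [iv uniq]; rewrite (svolume_sum bP facet_pt Pv) (bigD1 i)//= big1 ?addr0//.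
by move=> k /andP[/uniq ->]; rewrite eqxx.
Qed.

(** Two opposite bounds meet: [volume_ratio] gives one direction, and pvol = slack i v * svolume i
    with [slack_le] gives the other. *)
Lemma sees_only_ratio i v : P v -> sees_only i v -> n.+2%:R * svolume i = pvol.
Proof.
move=> Pv iv; have E := sees_only_pvol Pv iv.
have s0 := svolume_gt0 bP facet_pt i.
have vmax x : P x -> slack i x <= slack i v.
  move=> /(sees_only_cover Pv iv)[t [f [/andP[t0 t1] _ fi ->]]].
  rewrite slack_comb fi mulr0 addr0 ler_piMl// ?gerBl//.
  exact: ltW iv.1.
have [le _] := volume_ratio bP facet_pt centP Pv vmax.
apply/eqP; rewrite eq_le le andTb E ler_pM2r//.
exact: (slack_le bP centP).
Qed.

(** The i-th term already exhausts the decomposition of P seen from v, so no further facet can miss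
    v. *)
Lemma ratio_sees_only i v : P v -> (forall x, P x -> slack i x <= slack i v) ->
  n.+2%:R * svolume i = pvol -> sees_only i v.
Proof.
move=> Pv vmax /(volume_ratio bP facet_pt centP Pv vmax).2 E.
have s0 k := svolume_gt0 bP facet_pt k.
have iv : 0 < slack i v.
  by have := pvol_gt0 bP; rewrite E pmulr_lgt0.
split=> // k kv; apply/eqP/negPn/negP => ki.
have := svolume_sum bP facet_pt Pv; rewrite (bigD1 i)//= (bigD1 k) ?kv//=.
rewrite {1}E => /eqP; rewrite -subr_eq0 opprD addrA subrr sub0r oppr_eq0.
rewrite gt_eqF// ltr_pwDl ?mulr_gt0//.
by apply: sumr_ge0 => j /andP[/andP[jv _] _]; apply: mulr_ge0; exact: ltW.
Qed.

Lemma exists_sees_only v : P v ->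
  \sum_(j | 0 < slack j v) n.+2%:R * svolume j = pvol <-> exists i, sees_only i v.
Proof.
move=> Pv; have s0 k := svolume_gt0 bP facet_pt k.
split=> [E|[i iv]]; last first.
  rewrite (bigD1 i) ?iv.1//= big1 ?addr0; first exact: sees_only_ratio iv.
  by move=> k /andP[/iv.2 ->]; rewrite eqxx.
(* Both sums over the facets missing v, with weights [n.+2] and with weights [slack j v], equal
   pvol; since the weights are ordered term by term, they agree. *)
have eqn k : 0 < slack k v -> slack k v = n.+2%:R.
  move=> kv; apply/eqP; rewrite eq_le (slack_le bP centP)//= leNgt; apply/negP => lt.
  have : 0 < \sum_(j | 0 < slack j v) (n.+2%:R - slack j v) * svolume j.
    rewrite (bigD1 k)//= ltr_pwDl ?mulr_gt0 ?subr_gt0//.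
    apply: sumr_ge0 => j _; apply: mulr_ge0; last exact: ltW.
    by rewrite subr_ge0 (slack_le bP centP).
  under eq_bigr do rewrite mulrBl.
  by rewrite sumrB E -(svolume_sum bP facet_pt Pv) subrr ltxx.
have [i iv _] := sector_cover bP Pv Pv.
exists i; split=> // k kv.
exact: (slack_max_inj bP facet_pt centP Pv (eqn k kv) (eqn i iv)).
Qed.

Lemma svolume_total : \sum_j svolume j = pvol.
Proof.
rewrite (svolume_sum bP facet_pt (polyhedron0 a)).
by apply: eq_big => [j|j _]; rewrite slack0 ?ltr01 ?mul1r.
Qed.

End apexes.

(** * Hulls and dimensions *)

Section hulls.
Variables (R : realType) (n : nat).
Implicit Types (S C F : set 'rV[R]_n) (x y u v : 'rV[R]_n).

Lemma sub_conv_hull S : S `<=` conv_hull S.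
Proof.
move=> x Sx; exists 1%N, (fun=> x), (fun=> 1); split => //.
  by rewrite big_ord1.
by rewrite big_ord1 scale1r.
Qed.

Lemma conv_hull_min S C : cvx C -> S `<=` C -> conv_hull S `<=` C.
Proof.
move=> cC SC _ [k [p [w [Sp w0 w1 ->]]]].
elim: k p w Sp w0 w1 => [|k IH] p w Sp w0 w1.
  by move: w1; rewrite big_ord0 => /esym/eqP; rewrite oner_eq0.
move: w1; rewrite !big_ord_recr /=; set l := w ord_max => w1.
have s0 : 0 <= \sum_(i < k) w (widen_ord (leqnSn k) i) by apply: sumr_ge0.
have [l1|l1] := eqVneq l 1.
  rewrite big1 ?add0r ?l1 ?scale1r; first exact/SC/Sp.
  move=> i _; have /eqP : \sum_(i < k) w (widen_ord (leqnSn k) i) = 0 by lra.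
  rewrite psumr_eq0// => /allP/(_ i); rewrite mem_index_enum => /(_ isT)/eqP ->.
  by rewrite scale0r.
have l1' : 1 - l != 0 by rewrite subr_eq0 eq_sym.
have -> : \sum_(i < k) w (widen_ord (leqnSn k) i) *: p (widen_ord (leqnSn k) i) =
  (1 - l) *: \sum_(i < k) (w (widen_ord (leqnSn k) i) / (1 - l)) *: p (widen_ord (leqnSn k) i).
  rewrite scaler_sumr; apply: eq_bigr => i _.
  by rewrite scalerA mulrCA divff// mulr1.
have l0 : 0 <= l by exact: w0.
apply: cC; [|exact/SC/Sp|apply/andP; split; lra].
apply: IH => //.
  by move=> i; apply: divr_ge0 => //; lra.
rewrite -mulr_suml; have -> : \sum_(i < k) w (widen_ord (leqnSn k) i) = 1 - l by lra.
by rewrite divff.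
Qed.

Definition join_fun T k l (f : 'I_k -> T) (g : 'I_l -> T) (i : 'I_(k + l)) : T :=
  match fintype.split i with inl i => f i | inr i => g i end.

Lemma sum_join_fun (V : zmodType) k l (F : 'I_k -> V) (G : 'I_l -> V) :
  \sum_i join_fun F G i = \sum_i F i + \sum_i G i.
Proof.
rewrite big_split_ord /= /join_fun; congr (_ + _); apply: eq_bigr => i _.
  by have := unsplitK (inl i : 'I_k + 'I_l) => /= ->.
by have := unsplitK (inr i : 'I_k + 'I_l) => /= ->.
Qed.

Lemma sum_comb k l (p : 'I_k -> 'rV[R]_n) (q : 'I_l -> 'rV[R]_n) (w : 'I_k -> R)
    (z : 'I_l -> R) t (c := join_fun (fun i => (1 - t) * w i) (fun i => t * z i)) :
  \sum_i w i = 1 -> \sum_i z i = 1 ->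
  \sum_i c i = 1 /\
  (1 - t) *: (\sum_i w i *: p i) + t *: (\sum_i z i *: q i) =
    \sum_i c i *: join_fun p q i.
Proof.
move=> w1 z1; split.
  by rewrite /c sum_join_fun -!mulr_sumr w1 z1 !mulr1 subrK.
rewrite (eq_bigr (join_fun (fun i => ((1 - t) * w i) *: p i)
    (fun i => (t * z i) *: q i))); last first.
  by move=> i _; rewrite /c /join_fun; case: fintype.split.
rewrite sum_join_fun !scaler_sumr; congr (_ + _); apply: eq_bigr => i _;
  by rewrite scalerA.
Qed.

Lemma cvx_conv_hull S : cvx (conv_hull S).
Proof.
move=> _ _ t [k [p [w [Sp w0 w1 ->]]]] [l [q [z [Sq z0 z1 ->]]]] /andP[t0 t1].
have [c1 cE] := sum_comb p q t w1 z1.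
exists (k + l)%N, (join_fun p q),
  (join_fun (fun i => (1 - t) * w i) (fun i => t * z i)); split => //.
  by move=> i; rewrite /join_fun; case: fintype.split.
by move=> i; rewrite /join_fun; case: fintype.split => j; rewrite mulr_ge0// subr_ge0.
Qed.

Lemma sub_aff_hull S : S `<=` aff_hull S.
Proof.
move=> x Sx; exists 1%N, (fun=> x), (fun=> 1); split => //.
  by rewrite big_ord1.
by rewrite big_ord1 scale1r.
Qed.

Lemma aff_hull_line S x y t :
  aff_hull S x -> aff_hull S y -> aff_hull S ((1 - t) *: x + t *: y).
Proof.
move=> [k [p [w [Sp w1 ->]]]] [l [q [z [Sq z1 ->]]]].
have [c1 cE] := sum_comb p q t w1 z1.
exists (k + l)%N, (join_fun p q),
  (join_fun (fun i => (1 - t) * w i) (fun i => t * z i)); split => //.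
by move=> i; rewrite /join_fun; case: fintype.split.
Qed.

Lemma dotv_sumr u k (p : 'I_k -> 'rV[R]_n) (w : 'I_k -> R) :
  dotv u (\sum_i w i *: p i) = \sum_i w i * dotv u (p i).
Proof.
rewrite (big_morph (dotv u) (dotvDr u) (dotv0r u)).
by apply: eq_bigr => i _; rewrite dotvZr.
Qed.

Lemma aff_hull_hyperplane S u b : S `<=` [set x | dotv u x = b] ->
  aff_hull S `<=` [set x | dotv u x = b].
Proof.
move=> Sb _ [k [p [w [Sp w1 ->]]]] /=; rewrite dotv_sumr.
rewrite (eq_bigr (fun i => w i * b)); last by move=> i _; rewrite (Sb _ (Sp i)).
by rewrite -mulr_suml w1 mul1r.
Qed.

(** Take a subspace of largest dimension contained in [D]; an element of [D] outside it would
    enlarge it. *)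
Lemma vspace_of_closed (D : set 'rV[R]_n) : D 0 ->
  (forall c x y, D x -> D y -> D (c *: x + y)) ->
  exists L : {vspace 'rV[R]_n}, forall y, (y \in L) <-> D y.
Proof.
move=> D0 DD.
pose Q k := `[< exists L : {vspace 'rV[R]_n}, (forall y, y \in L -> D y) /\ \dim L = k >].
have exQ : exists k, Q k.
  exists 0%N; apply/asboolP; exists 0%VS; rewrite dimv0; split=> // y.
  by rewrite memv0 => /eqP ->.
have bQ k : Q k -> (k <= \dim {:'rV[R]_n})%N.
  by move=> /asboolP[L [_ <-]]; exact/dimvS/subvf.
case: (ex_maxnP exQ bQ) => k /asboolP[L [LD Lk]] kmax.
exists L => y; split; first exact: LD.
move=> Dy; apply/negPn/negP => yL.
have : Q (\dim (L + <[y]>)%VS).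
  apply/asboolP; exists (L + <[y]>)%VS; split=> // z /memv_addP[x xL [_ /vlineP[c ->] ->]].
  by rewrite addrC; apply: DD => //; exact: LD.
move=> /kmax; rewrite -Lk => le.
have /eqP E : (L == L + <[y]>)%VS by rewrite eqEdim addvSl le.
by move/negP: yL; apply; rewrite E; apply: (subvP (addvSr L <[y]>)); exact: memv_line.
Qed.

Lemma aff_hull_flat S x0 : S x0 ->
  exists L : {vspace 'rV[R]_n}, aff_hull S = [set x0 + y | y in [set y | y \in L]].
Proof.
move=> Sx0; have Ax0 := sub_aff_hull Sx0.
pose D : set 'rV[R]_n := [set y | aff_hull S (x0 + y)].
have DZ c y : D y -> D (c *: y).
  move=> Dy; have := aff_hull_line c Ax0 Dy; rewrite /D /=; congr (aff_hull S _).
  by rewrite scalerDr addrA -scalerDl subrK scale1r.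
(* x0 + y + z is reached along two lines: the midpoint of x0 + y and x0 + z, then its reflection of
   x0, with parameter 2. *)
have DD y z : D y -> D z -> D (y + z).
  move=> Dy Dz; have := aff_hull_line 2 Ax0 (aff_hull_line 2^-1 Dy Dz).
  rewrite /D /=; congr (aff_hull S _); apply/rowP => i; rewrite !mxE.
  lra.
have D0 : D 0 by rewrite /D /= addr0.
have [L LD] := vspace_of_closed D0 (fun c x y Dx Dy => DD _ _ (DZ c x Dx) Dy).
exists L; apply/seteqP; split=> [x Ax|x [y /= /LD Dy <-]//].
by exists (x - x0); rewrite ?subrKC//=; apply/LD; rewrite /D /= addrC subrK.
Qed.

(** [direction] makes a choice, so the point is uniqueness: two descriptions of the same flat have
    the same subspace of differences. *)
Lemma adim_flat S x0 (L : {vspace 'rV[R]_n}) :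
  aff_hull S = [set x0 + y | y in [set y | y \in L]] -> adim S = (\dim L)%:Z.
Proof.
move=> E; rewrite /adim ifF; last first.
  apply/asboolP => E0; have : aff_hull S x0 by rewrite E; exists 0; rewrite ?addr0//= mem0v.
  by rewrite E0.
congr (Posz (\dim _)).
pose Q : set {vspace 'rV[R]_n} := [set K | exists2 x, aff_hull S x &
  aff_hull S = [set x + y | y in [set y | y \in K]]].
have QL : Q L by exists x0 => //; rewrite E; exists 0; rewrite ?addr0//= mem0v.
have : Q (direction (aff_hull S)) by exact: (@xgetI _ _ Q L QL).
move: (direction _) => L' [x1 _ E'].
have key (A B : {vspace 'rV[R]_n}) (x y : 'rV[R]_n) :
    [set x + z | z in [set z | z \in A]] = [set y + z | z in [set z | z \in B]] ->
    (A <= B)%VS.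
  move=> EE; apply/subvP => z zA.
  have [z1 /= z1B e1] : [set y + z | z in [set z | z \in B]] (x + z) by rewrite -EE; exists z.
  have [z0 /= z0B e0] : [set y + z | z in [set z | z \in B]] x.
    by rewrite -EE; exists 0; rewrite ?addr0//= mem0v.
  have -> : z = z1 - z0.
    by rewrite -(addKr x z) -e1 -{1}e0 opprD addrACA addNr add0r addrC.
  exact: memvB.
apply/eqP; rewrite eqEsubv; apply/andP; split.
  by apply: (key _ _ x1 x0); rewrite -E -E'.
by apply: (key _ _ x0 x1); rewrite -E -E'.
Qed.

Lemma flat_of_adim S k : adim S = Posz k -> exists x0 (L : {vspace 'rV[R]_n}),
  [/\ S x0, aff_hull S = [set x0 + y | y in [set y | y \in L]] & \dim L = k].
Proof.
have [[x0 Sx0]|S0] := pselect (exists x, S x); last first.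
  rewrite /adim ifT//; apply/asboolP; apply/seteqP; split=> // x [[|l]].
    by move=> [p [w [_]]]; rewrite big_ord0 => /esym/eqP; rewrite oner_eq0.
  by move=> [p [w [Sp _ _]]]; apply: S0; exists (p ord0).
have [L E] := aff_hull_flat Sx0.
by rewrite (adim_flat E) => -[Lk]; exists x0, L.
Qed.

Lemma dimv_rV : \dim {:'rV[R]_n} = n.
Proof. by rewrite dimvf /dim /= mul1n. Qed.

Lemma dim_orthogonal (L W : {vspace 'rV[R]_n}) :
  (forall y z, y \in L -> z \in W -> dotv z y = 0) -> (\dim L + \dim W <= n)%N.
Proof.
move=> LW; rewrite -dimv_disjoint_sum.
  by rewrite -[leqRHS]dimv_rV; exact/dimvS/subvf.
apply/eqP; rewrite -subv0; apply/subvP => z /memv_capP[zL zW]; rewrite memv0.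
by apply/negPn/negP => /dotv_gt0; rewrite LW ?ltxx.
Qed.

Lemma exists_orthogonal (L : {vspace 'rV[R]_n}) : (\dim L < n)%N ->
  exists2 u, u != 0 & forall y, y \in L -> dotv u y = 0.
Proof.
move=> Ln; pose B : 'M[R]_(\dim L, n) := \matrix_(i, j) (vbasis L)`_i ord0 j.
have /rowV0Pn[u uB u0] : kermx B^T != 0.
  rewrite kermx_eq0 /row_free -mxrank_tr trmxK neq_ltn.
  by rewrite (leq_ltn_trans (rank_leq_row B) Ln).
exists u => // y yL; rewrite (coord_vbasis yL) dotv_sumr big1// => i _.
have /rowP/(_ i) := sub_kermxP uB; rewrite !mxE => e.
rewrite [X in _ * X](_ : _ = 0) ?mulr0// -{}e; apply: eq_bigr => j _.
by rewrite !mxE.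
Qed.

Lemma hyperplane_vspace u : u != 0 ->
  exists2 L : {vspace 'rV[R]_n}, forall y, (y \in L) <-> dotv u y = 0 & (\dim L).+1 = n.
Proof.
move=> u0; have D0 : [set y | dotv u y = 0] 0 by exact: dotv0r.
have [|L LE] := vspace_of_closed D0.
  by move=> c x y /= cx cy; rewrite dotvDr dotvZr cx cy mulr0 addr0.
have uu := dotv_gt0 u0.
exists L => //; apply/eqP; rewrite eqn_leq; apply/andP; split.
  have := @dim_orthogonal L <[u]>%VS; rewrite dim_vline u0 addn1; apply.
  by move=> y z /LE uy /vlineP[c ->]; rewrite dotvZl uy mulr0.
have full : (fullv <= L + <[u]>)%VS.
  apply/subvP => x _; pose c := dotv u x / dotv u u.
  rewrite -(subrK (c *: u) x) memv_add ?memvZ ?memv_line//.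
  by apply/LE; rewrite /= dotvBr dotvZr /c mulfVK ?subrr// gt_eqF.
have := dimvS full; rewrite dimv_rV => /leq_trans; apply.
by apply: (leq_trans (dimv_add_leqif _ _)); rewrite dim_vline u0 addn1.
Qed.

(** The union [J] of the segments from v to F is already convex. *)
Lemma conv_hull_apex F v x : cvx F -> F !=set0 -> conv_hull (F `|` [set v]) x ->
  exists t f, [/\ 0 <= t <= 1, F f & x = (1 - t) *: v + t *: f].
Proof.
move=> cF [f0 Ff0].
pose J : set 'rV[R]_n := [set x | exists t f, [/\ 0 <= t <= 1, F f & x = (1 - t) *: v + t *: f]].
suff : conv_hull (F `|` [set v]) `<=` J by move=> /[apply].
apply: conv_hull_min; last first.
  move=> y [Fy|->]; first by exists 1, y; rewrite ler01 lexx subrr scale0r add0r scale1r.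
  by exists 0, f0; rewrite ler01 lexx subr0 scale0r addr0 scale1r.
move=> _ _ r [t [f [/andP[t0 t1] Ff ->]]] [s [g [/andP[s0 s1] Fg ->]]] /andP[r0 r1].
(* The total weight carried by F; if it is zero the combination is v itself, otherwise f and g are
   averaged with their relative weights. *)
pose k := (1 - r) * t + r * s.
have a0 : 0 <= (1 - r) * t by rewrite mulr_ge0// subr_ge0.
have b0 : 0 <= r * s by rewrite mulr_ge0.
have k01 : 0 <= k <= 1 by rewrite /k; apply/andP; split; nra.
have [k0|k0] := eqVneq k 0.
  exists 0, f0; split; rewrite ?lexx ?ler01// subr0 scale1r scale0r addr0.
  have e1 : (1 - r) * t = 0 by rewrite /k in k0; lra.
  have e2 : r * s = 0 by rewrite /k in k0; lra.
  rewrite !scalerDr !scalerA e1 e2 !scale0r !addr0 -scalerDl.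
  have -> : (1 - r) * (1 - t) + r * (1 - s) = 1 by lra.
  by rewrite scale1r.
exists k, ((1 - r * s / k) *: f + (r * s / k) *: g); split => //.
  have kp : 0 < k by rewrite lt_neqAle eq_sym k0; case/andP: k01.
  apply: cF => //; rewrite divr_ge0 ?(ltW kp)//=.
  by rewrite ler_pdivrMr// mul1r /k; lra.
have e : k * (r * s / k) = r * s by rewrite mulrCA divff// mulr1.
have e' : k * (1 - r * s / k) = (1 - r) * t by rewrite mulrBr mulr1 e /k; lra.
rewrite !scalerDr !scalerA e e'.
rewrite addrACA -scalerDl; congr (_ *: _ + _); rewrite /k; lra.
Qed.

End hulls.

(** * Polytopes, facets and vertices *)

Section polytopes.
Variables (R : realType) (n : nat).
Local Notation mR := (measurableTypeR R).
Local Notation leb := (lebesgue_rV R n.+1).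
Implicit Types (P : set 'rV[R]_n.+1) (s : seq 'rV[R]_n.+1) (u v x : 'rV[R]_n.+1).

Lemma polytope_bounded P : is_polytope P -> exists M, bdd_by M P.
Proof.
move=> [s ->]; exists (\sum_(x <- s) \sum_j `|x ord0 j|).
apply: conv_hull_min => [x y t Bx By /andP[t0 t1] i|x /= xs i].
  rewrite !mxE; apply: (le_trans (ler_normD _ _)).
  have t1' : 0 <= 1 - t by rewrite subr_ge0.
  rewrite !normrM (ger0_norm t0) (ger0_norm t1').
  rewrite -[leRHS]mul1r -[in leRHS](subrK t 1) [leRHS]mulrDl.
  by apply: lerD; apply: ler_wpM2l => //; (exact: Bx || exact: By).
rewrite (big_rem x)//= (bigD1 i)//= -addrA lerDl addr_ge0//.
  exact: sumr_ge0.
by apply: sumr_ge0 => y _; exact: sumr_ge0.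
Qed.

Lemma polytope_argmax P u : is_polytope P -> P !=set0 ->
  exists2 v, P v & forall x, P x -> dotv u x <= dotv u v.
Proof.
move=> [s ->] [x0 Px0].
have s0 : exists y, y \in s.
  case: s Px0 => [|y s _]; last by exists y; rewrite mem_head.
  move=> [[|k]]; last by move=> [p [w [/(_ ord0)]]].
  by move=> [p [w [_ _]]]; rewrite big_ord0 => /esym/eqP; rewrite oner_eq0.
have [v vs vmax] : exists2 v, v \in s & forall x, x \in s -> dotv u x <= dotv u v.
  elim: s s0 {Px0} => [[y]//|y s IH _].
  have [->|[z zs]] : s = [::] \/ exists z, z \in s.
  - by case: (s) => [|z r]; [left|right; exists z; rewrite mem_head].
  - by exists y; rewrite ?mem_head// => x; rewrite inE => /eqP ->.
  have [v vs vmax] := IH (ex_intro _ z zs).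
  have [yv|vy] := lerP (dotv u y) (dotv u v).
    exists v; first by rewrite inE vs orbT.
    by move=> x; rewrite inE => /predU1P[->|/vmax].
  exists y; first by rewrite mem_head.
  move=> x; rewrite inE => /predU1P[->//|/vmax xv].
  exact: le_trans xv (ltW vy).
exists v; first exact: sub_conv_hull.
apply: (@conv_hull_min _ _ _ [set x | dotv u x <= dotv u v]) => // x y t /= xv yv /andP[t0 t1].
have t1' : 0 <= 1 - t by rewrite subr_ge0.
rewrite /= dotvDr !dotvZr.
have h1 : (1 - t) * dotv u x <= (1 - t) * dotv u v by exact: ler_wpM2l.
have h2 : t * dotv u y <= t * dotv u v by exact: ler_wpM2l.
by lra.
Qed.

(** A convex combination attains the bound only if every generator of nonzero weight does, so the
    face is generated by the generators on the supporting hyperplane. *)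
Lemma polytope_section P u (b : R) : is_polytope P ->
  (forall x, P x -> dotv u x <= b) -> is_polytope (P `&` [set x | dotv u x = b]).
Proof.
move=> [s ->] ub; exists [seq x <- s | dotv u x == b].
apply/seteqP; split; last first.
  move=> x xs; split.
    apply: conv_hull_min x xs; first exact: cvx_conv_hull.
    by move=> y /=; rewrite mem_filter => /andP[_ ys]; exact: sub_conv_hull.
  move: x xs; apply: conv_hull_min => [x y t /= xb yb _|y /=].
    by rewrite dotvDr !dotvZr xb yb -mulrDl subrK mul1r.
  by rewrite mem_filter => /andP[/eqP].
move=> x [[k [p [w [ps w0 w1 ->]]]]] /= xb.
have pb i : dotv u (p i) <= b by apply: ub; exact: sub_conv_hull.
have wb i : w i != 0 -> dotv u (p i) = b.
  move=> wi; have : \sum_i w i * (b - dotv u (p i)) = 0.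
    under eq_bigr do rewrite mulrBr.
    by rewrite sumrB -mulr_suml w1 mul1r -dotv_sumr xb subrr.
  move=> /eqP; rewrite psumr_eq0; last by move=> j _; rewrite mulr_ge0// subr_ge0.
  move=> /allP/(_ i); rewrite mem_index_enum mulf_eq0 (negbTE wi)/= subr_eq0 => /(_ isT).
  by move=> /eqP.
have [i0 wi0] : exists i, w i != 0.
  apply: contrapT => /forallNP h; move: w1; rewrite big1.
    by move=> /esym/eqP; rewrite oner_eq0.
  by move=> i _; have := h i => /negP; rewrite negbK => /eqP.
(* Generators of weight zero may lie off the hyperplane; they are replaced by [p i0], which lies on
   it. *)
exists k, (fun i => if w i == 0 then p i0 else p i), w; split => //.
  move=> i /=; rewrite mem_filter; case: ifPn => [_|wi].
    by rewrite wb// eqxx; exact: ps.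
  by rewrite wb// eqxx; exact: ps.
apply: eq_bigr => i _; case: ifPn => // /eqP ->.
by rewrite !scale0r.
Qed.

Section irredundant.
Variables (m : nat) (P : set 'rV[R]_n.+1) (a : 'I_m -> 'rV[R]_n.+1).
Hypotheses (polyP : is_polytope P) (dimP : adim P = n.+1%:Z) (centP : centered P)
  (irrP : irredundant_description a P).
Local Notation slack := (slack a).

Lemma irredundant_polyhedron : P = polyhedron a.
Proof. by have [-> _ _ _] := irrP. Qed.

Lemma irredundant_bounded : exists M, bdd_by M (polyhedron a).
Proof. by rewrite -irredundant_polyhedron; exact: polytope_bounded. Qed.

Lemma facet_ofE j f : facet_of P (a j) f <-> polyhedron a f /\ slack j f = 0.
Proof.
rewrite /facet_of irredundant_polyhedron; split=> -[Pf]; rewrite /slack /= => h; split=> //.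
  by rewrite h subrr.
by lra.
Qed.

Lemma facet_is_facet j : is_facet P (facet_of P (a j)).
Proof. by have [_ _ _ facets] := irrP; apply/facets; exists j. Qed.

Lemma facet_adim j : adim (facet_of P (a j)) = Posz n.
Proof. by have [_ ->] := facet_is_facet j; rewrite dimP -addn1 PoszD addrK. Qed.

(** Otherwise a_j and a_k would both be orthogonal to the n-dimensional direction of the j-th facet.
    In R^(n+1) they are then proportional, and equal because both take the value 1 on that facet. *)
Lemma facet_not_sub j k : k != j -> exists2 f, facet_of P (a j) f & 0 < slack k f.
Proof.
move=> kj; apply: contrapT => no.
have fk f : facet_of P (a j) f -> dotv (a k) f = 1.
  move=> Ff; apply/eqP/negPn/negP => ne; apply: no; exists f => //.
  have [/polyhedronP/(_ k) + _] := (facet_ofE j f).1 Ff.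
  by rewrite le_eqVlt => /predU1P[|//]; rewrite /slack => e; case/eqP: ne; lra.
have [x0 [L [Fx0 E dL]]] := flat_of_adim (facet_adim j).
have vanish l : (forall f, facet_of P (a j) f -> dotv (a l) f = 1) ->
    forall y, y \in L -> dotv (a l) y = 0.
  move=> fl y yL.
  have : aff_hull (facet_of P (a j)) (x0 + y) by rewrite E; exists y.
  move=> /(@aff_hull_hyperplane _ _ _ (a l) 1 fl) /=; rewrite dotvDr fl//; lra.
have jL := vanish j (fun f Ff => Ff.2); have kL := vanish k fk.
have [_ a0 inja _] := irrP.
have ajk : a k \notin <[a j]>%VS.
  apply/negP => /vlineP[c e]; move: (fk _ Fx0) (Fx0.2 : dotv (a j) x0 = 1).
  rewrite e dotvZl => + j1; rewrite j1 mulr1 => c1.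
  by move/eqP: kj; apply; apply: inja; rewrite e c1 scale1r.
have := @dim_orthogonal R n.+1 L (<[a j]> + <[a k]>)%VS.
rewrite dimv_disjoint_sum ?dim_vline ?a0//=; last first.
  apply/eqP; rewrite -subv0; apply/subvP => z /memv_capP[/vlineP[c ->] /vlineP[d e]].
  rewrite memv0 scaler_eq0 (negbTE (a0 j)) orbF; apply/negPn/negP => c0.
  have [d0|d0] := eqVneq d 0.
    by move: e => /eqP; rewrite d0 scale0r scaler_eq0 (negbTE (a0 j)) (negbTE c0).
  move/negP: ajk; apply; apply/vlineP; exists (d^-1 * c).
  by rewrite -scalerA e scalerA mulVf// scale1r.
rewrite dL addn1 addn2 => h.
have : (n.+2 <= n.+1)%N.
  apply: h => y z yL /memv_addP[_ /vlineP[c ->] [_ /vlineP[d ->] ->]].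
  by rewrite dotvDl !dotvZl jL// kL// !mulr0 addr0.
by rewrite ltnn.
Qed.

(** Average over k a point of the j-th facet lying off the k-th one. *)
Lemma facet_relative_interior j : exists f, slack j f = 0 /\ forall k, k != j -> 0 < slack k f.
Proof.
have [x0 [_ [Fx0 _ _]]] := flat_of_adim (facet_adim j).
have /choice[g gP] k : exists f, facet_of P (a j) f /\ (k != j -> 0 < slack k f).
  have [->|kj] := eqVneq k j; first by exists x0; split=> //; rewrite eqxx.
  by have [f Ff kf] := facet_not_sub kj; exists f.
have m0 : 0 < m%:R :> R by rewrite ltr0n (leq_ltn_trans (leq0n _) (ltn_ord j)).
have m1 : m%:R^-1 * m%:R = 1 :> R by rewrite mulVf// gt_eqF.
pose f := \sum_(k < m) m%:R^-1 *: g k.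
have slackE l : slack l f = m%:R^-1 * \sum_(k < m) slack l (g k).
  rewrite /slack /f dotv_sumr -mulr_sumr sumrB big_const_ord iter_addr_0 mulrBr m1.
  by [].
have Pg k l : 0 <= slack l (g k).
  by have [/facet_ofE[/polyhedronP]] := gP k.
exists f; split.
  rewrite slackE big1 ?mulr0// => k _.
  by have [/facet_ofE[]] := gP k.
move=> k kj; rewrite slackE mulr_gt0 ?invr_gt0// (bigD1 k)//= ltr_pwDl//.
  by have [_ ->] := gP k.
by apply: sumr_ge0 => l _; exact: Pg.
Qed.

End irredundant.
End polytopes.

(** * Pyramids and vertices of P expressed by slacks *)

Section bridge.
Variables (R : realType) (n m : nat) (P : set 'rV[R]_n.+1) (a : 'I_m -> 'rV[R]_n.+1).
Local Notation mR := (measurableTypeR R).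
Local Notation leb := (lebesgue_rV R n.+1).
Local Notation slack := (slack a).
Hypotheses (polyP : is_polytope P) (dimP : adim P = n.+1%:Z)
  (irrP : irredundant_description a P).

Let PE : P = polyhedron a := irredundant_polyhedron irrP.
Let fpt := facet_relative_interior dimP irrP.

Lemma facet_point j : exists2 f, facet_of P (a j) f & forall k, k != j -> 0 < slack k f.
Proof.
have [f [fj fk]] := fpt j; exists f => //; apply/(facet_ofE irrP); split=> //.
by apply/polyhedronP => k; have [->|/fk/ltW//] := eqVneq k j; rewrite fj.
Qed.

Lemma cone_ofE j : cone_of P (a j) = sector a 0 j.
Proof.
have [M bP] := irredundant_bounded polyP irrP.
apply/seteqP; split.
  apply: conv_hull_min => [x y t /sector0E[x1 xk] /sector0E[y1 yk] /andP[t0 t1]|x].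
    have t1' : 0 <= 1 - t by rewrite subr_ge0.
    apply/sector0E; split=> [|k]; rewrite !dotvDr !dotvZr.
      have := ler_wpM2l t1' x1; have := ler_wpM2l t0 y1; lra.
    by apply: lerD; apply: ler_wpM2l.
  move=> [->|[+ /= xj]].
    by apply/sector0E; rewrite !dotv0r; split=> // k; rewrite !dotv0r.
  by rewrite PE => Px; apply/sector0E; rewrite xj; split=> // k; rewrite Px.
move=> x Sx; have j0 : 0 < slack j 0 by rewrite slack0.
have [t [f [t01 Pf fj ->]]] := sectorP bP fpt j0 (polyhedron0 a) Sx.
apply: cvx_conv_hull => //; apply: sub_conv_hull; first by left.
by right; apply/(facet_ofE irrP).
Qed.

Lemma facet_of_inj i j : facet_of P (a i) = facet_of P (a j) -> i = j.
Proof.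
move=> E; have [f + fi] := facet_point i; rewrite E => /(facet_ofE irrP)[_ fj].
by apply/eqP/negPn/negP; rewrite eq_sym => /fi; rewrite fj ltxx.
Qed.

Lemma sees_only_pyramid i v : P v -> sees_only a i v -> is_pyramid P (facet_of P (a i)) v.
Proof.
move=> Pv iv; have [M bP] := irredundant_bounded polyP irrP; split.
- apply: polytope_section => // x; rewrite PE; exact.
- by have [] := facet_is_facet irrP i.
- have Fi : facet_of P (a i) `<=` [set x | dotv (a i) x = 1] by move=> x [].
  move=> /(aff_hull_hyperplane Fi) /= vi.
  by have := iv.1; rewrite /slack vi subrr ltxx.
apply/seteqP; split=> x.
  rewrite {1}PE => Px; have Pv' : polyhedron a v by rewrite -PE.
  have [t [f [t01 Pf fi ->]]] := sees_only_cover bP fpt Pv' iv Px.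
  apply: cvx_conv_hull => //; apply: sub_conv_hull; first by right.
  by left; apply/(facet_ofE irrP).
apply: conv_hull_min; first by rewrite PE; exact: cvx_polyhedron.
by move=> y [[]|->].
Qed.

(** The base spans a hyperplane missing the apex, with P on one side, so it is a facet, say the
    i-th. A relative interior point of another facet missing v would be pushed along its segment
    into the base, hence onto the i-th facet. *)
Lemma pyramid_sees_only F v : is_pyramid P F v ->
  P v /\ exists2 i, F = facet_of P (a i) & sees_only a i v.
Proof.
move=> [[s FE] dimF vF PF].
have cF : cvx F by rewrite FE; exact: cvx_conv_hull.
have FP : F `<=` P by rewrite PF => x Fx; apply: sub_conv_hull; left.
have Pv : P v by rewrite PF; apply: sub_conv_hull; right.
have dF : adim F = Posz n by rewrite dimF dimP -addn1 PoszD addrK.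
have [x0 [L [Fx0 E dL]]] := flat_of_adim dF.
have F0 : F !=set0 by exists x0.
have decomp x : P x -> exists t f, [/\ 0 <= t <= 1, F f & x = (1 - t) *: v + t *: f].
  by rewrite {1}PF; exact: conv_hull_apex.
have [u u0 uL] : exists2 u, u != 0 & forall y, y \in L -> dotv u y = 0.
  by apply: exists_orthogonal; rewrite dL.
have uF x : F x -> dotv u x = dotv u x0.
  move=> /sub_aff_hull; rewrite E => -[y /= yL <-].
  by rewrite dotvDr (uL y yL) addr0.
(* By dimension, L is the whole hyperplane orthogonal to u, so equality would put v in the affine
   hull of F. *)
have uv : dotv u v != dotv u x0.
  apply/eqP => uv; apply: vF; rewrite E; exists (v - x0); last by rewrite subrKC.
  have [K KE dK] := hyperplane_vspace u0.
  have /eqP -> : (L == K)%VS.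
    rewrite eqEdim; apply/andP; split; first by apply/subvP => y /uL/KE.
    by rewrite dL -ltnS dK.
  by apply/KE; rewrite dotvBr uv subrr.
have [w [wv wF]] : exists w, dotv w v < dotv w x0 /\ forall x, F x -> dotv w x = dotv w x0.
  have [lt|gt|eq] := ltgtP (dotv u v) (dotv u x0); first by exists u.
    by exists (- u); rewrite !dotvNl ltrN2; split=> // x Fx; rewrite !dotvNl uF.
  by rewrite eq eqxx in uv.
have facetF : is_facet P F.
  split; last exact: dimF.
  exists w, (dotv w x0); split.
    move=> x /decomp[t [f [/andP[t0 t1] Ff ->]]].
    rewrite dotvDr !dotvZr (wF _ Ff).
    have : (1 - t) * dotv w v <= (1 - t) * dotv w x0.
      by apply: ler_wpM2l; [rewrite subr_ge0|exact: ltW].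
    lra.
  apply/seteqP; split=> [x Fx|x [/decomp[t [f [/andP[t0 t1] Ff ->]]]]].
    by split; [exact: FP|exact: wF].
  rewrite /= dotvDr !dotvZr (wF _ Ff) => e.
  have : (1 - t) * (dotv w x0 - dotv w v) = 0 by lra.
  move=> /eqP; rewrite mulf_eq0 subr_eq0 [_ - _ == 0]gt_eqF ?subr_gt0// orbF => /eqP <-.
  by rewrite subrr scale0r add0r scale1r.
have [_ _ _ /(_ F)[+ _]] := irrP => /(_ facetF)[i FEi].
split=> //; exists i => //.
have Fslack f : F f -> slack i f = 0 by rewrite FEi => /(facet_ofE irrP)[].
have vP j : 0 <= slack j v by move: Pv; rewrite PE => /polyhedronP.
split.
  rewrite lt_neqAle vP andbT eq_sym; apply/eqP => iv; apply: vF.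
  by apply: sub_aff_hull; rewrite FEi; apply/(facet_ofE irrP); rewrite -PE.
move=> k kv; apply/eqP/negPn/negP => ki.
have [f Fkf fk] := facet_point k.
have [Pf kf] := (facet_ofE irrP k f).1 Fkf.
move: Pf; rewrite -PE => /decomp[t [g [/andP[t0 t1] Fg fE]]].
have gk : 0 <= slack k g by move: (FP _ Fg); rewrite PE => /polyhedronP.
move: kf; rewrite fE slack_comb => e.
have p1 : 0 <= (1 - t) * slack k v by rewrite mulr_ge0// subr_ge0.
have p2 : 0 <= t * slack k g by rewrite mulr_ge0.
have /eqP : (1 - t) * slack k v = 0 by lra.
rewrite mulf_eq0 (gt_eqF kv) orbF subr_eq0 => /eqP t1E.
have := fk i; rewrite eq_sym => /(_ ki).
by rewrite fE -t1E subrr scale0r add0r scale1r Fslack// ltxx.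
Qed.

Lemma pyramid_with_baseE i : pyramid_with_base P (facet_of P (a i)) <->
  exists2 v, P v & sees_only a i v.
Proof.
split=> [[v /pyramid_sees_only[Pv [j /facet_of_inj -> jv]]]|[v Pv iv]].
  by exists v.
by exists v; exact: sees_only_pyramid.
Qed.

Lemma pyramid_with_apexE v : P v ->
  pyramid_with_apex P v <-> exists i, sees_only a i v.
Proof.
move=> Pv; split=> [[F /pyramid_sees_only[_ [i _ iv]]]|[i iv]]; first by exists i.
by exists (facet_of P (a i)); exact: sees_only_pyramid.
Qed.

Definition normals v := [seq a i | i <- enum 'I_m & slack i v == 0].

(** If some w != 0 were orthogonal to all active normals, P would contain a small segment around v
    in the direction w; the functional exposing v would be constant on it, so v would not be the
    only point of its face. *)
Lemma vertex_normals_span v : is_vertex P v -> <<normals v>>%VS = fullv.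
Proof.
move=> [u0 [b [ub face]]].
have [Pv u0v] : P v /\ dotv u0 v = b.
  by have : [set v] v by []; rewrite face.
apply/eqP; rewrite eqEdim subvf/= leqNgt; apply/negP; rewrite dimv_rV => /exists_orthogonal[w w0 wX].
have vP j : 0 <= slack j v by move: Pv; rewrite PE => /polyhedronP.
(* [d] is at most every inactive slack (default 1 if there is none) and [C] bounds all |<a_i, w>|,
   so a move of v by at most e = d/C along w violates no constraint. *)
pose d := \big[Num.min/1]_(i | slack i v != 0) slack i v.
have d0 : 0 < d.
  by apply: lt_bigmin => // i iv; rewrite lt_neqAle eq_sym iv vP.
have dle i : slack i v != 0 -> d <= slack i v by move=> iv; exact: bigmin_le_cond.
pose C := 1 + \sum_i `|dotv (a i) w|.
have Ci i : `|dotv (a i) w| <= C.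
  by rewrite /C (bigD1 i)//= addrCA lerDl addr_ge0// sumr_ge0.
have C0 : 0 < C by rewrite /C ltr_pwDl// sumr_ge0.
pose e := d / C; have e0 : 0 < e by rewrite divr_gt0.
have Pe (r : R) : `|r| = e -> P (v + r *: w).
  move=> re; rewrite PE => i; rewrite /= dotvDr dotvZr.
  have [iv|iv] := eqVneq (slack i v) 0.
    have -> : dotv (a i) w = 0.
      rewrite dotvC; apply: wX; apply: memv_span.
      by apply/mapP; exists i => //; rewrite mem_filter iv eqxx mem_enum.
    by have := vP i; rewrite /slack mulr0; lra.
  have h1 : r * dotv (a i) w <= d.
    apply: le_trans (ler_norm _) _; rewrite normrM re.
    have -> : d = e * C by rewrite /e mulfVK// gt_eqF.
    by rewrite ler_pM2l.
  by have := dle i iv; rewrite /slack; lra.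
have u0w : dotv u0 w = 0.
  have h1 := ub _ (Pe e (gtr0_norm e0)).
  have h2 : dotv u0 (v + - e *: w) <= b by apply/ub/Pe; rewrite normrN gtr0_norm.
  move: h1 h2; rewrite !dotvDr !dotvZr u0v => h1 h2.
  have /eqP : e * dotv u0 w = 0 by lra.
  by rewrite mulf_eq0 gt_eqF//= => /eqP.
have : [set v] (v + e *: w).
  by rewrite face; split; [exact/Pe/gtr0_norm|rewrite /= dotvDr dotvZr u0w mulr0 addr0].
move=> /= /eqP; rewrite -subr_eq0 addrAC subrr add0r scaler_eq0 (negbTE w0) orbF.
by rewrite gt_eqF.
Qed.

(** For y with <v, y> = 1, write y as a linear combination of the active normals. As <v, a_i> = 1
    for each of them, the coefficients add up to <v, y> = 1: the combination is affine. *)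
Lemma vertex_hyperplane v : is_vertex P v ->
  aff_hull [set a i | i in [set i | facet_of P (a i) v]] = [set y | dotv v y = 1].
Proof.
move=> vv; have span := vertex_normals_span vv.
have Pv : P v by have [u0 [b [ub face]]] := vv; have : [set v] v by []; rewrite face => -[].
have inI i : facet_of P (a i) v <-> slack i v = 0.
  by split=> [/(facet_ofE irrP)[]//|iv]; apply/(facet_ofE irrP); rewrite -PE.
apply/seteqP; split.
  apply: aff_hull_hyperplane => _ [i /inI iv <-] /=.
  by rewrite dotvC; move: iv; rewrite /slack; lra.
move=> y /= yv; set X := normals v in span.
have yX : y \in <<in_tuple X>>%VS by rewrite span memvf.
exists (size X), (fun i => X`_i), (fun i => coord (in_tuple X) i y).
have Xi (i : 'I_(size X)) : [set a i | i in [set i | facet_of P (a i) v]] X`_i.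
  have /mapP[j] : X`_i \in X by exact: mem_nth.
  by rewrite mem_filter => /andP[/eqP jv _] ->; exists j => //; apply/inI.
have yE := coord_span yX; split => //.
move: yv; rewrite {1}yE dotv_sumr => <-; apply: eq_bigr => i _.
have [j /inI jv <-] := Xi i.
by rewrite dotvC; move: jv; rewrite /slack => jv; have -> : dotv (a j) v = 1 by [lra]; rewrite mulr1.
Qed.

Lemma vertex_is_hyperplane v : is_vertex P v ->
  is_hyperplane [set y | dotv v y = 1] /\ adim [set y | dotv v y = 1] = Posz n.
Proof.
move=> vv; have span := vertex_normals_span vv.
(* The origin lies on no facet, and an empty family of normals does not span. *)
have v0 : v != 0.
  apply/eqP => v0; move: span; rewrite v0.
  rewrite (_ : normals 0 = [::]).
    by rewrite span_nil => /(congr1 (fun V => \dim V)); rewrite dimv0 dimv_rV.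
  rewrite /normals (eq_filter (a2 := pred0)) ?filter_pred0// => i.
  by rewrite slack0 oner_eq0.
have vv0 := dotv_gt0 v0.
pose y0 := (dotv v v)^-1 *: v.
have y01 : dotv v y0 = 1 by rewrite dotvZr mulVf// gt_eqF.
set H := [set y | dotv v y = 1].
have HH : aff_hull H = H.
  by apply/seteqP; split; [exact: aff_hull_hyperplane|exact: sub_aff_hull].
have [L LE dL] := hyperplane_vspace v0.
have dH : adim H = Posz n.
  transitivity (\dim L)%:Z; last by case: dL => ->.
  apply: (@adim_flat _ _ _ y0); rewrite HH; apply/seteqP; split=> [y yv|_ [z /= /LE zv <-]].
    by exists (y - y0); rewrite ?subrKC//=; apply/LE; rewrite dotvBr y01 yv subrr.
  by rewrite /H /= dotvDr y01 zv addr0.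
by split=> //; split=> //; rewrite dH -addn1 PoszD addrK.
Qed.

Lemma adim_set1 (x : 'rV[R]_n.+1) : adim [set x] = 0.
Proof.
rewrite (@adim_flat _ _ _ x 0%VS) ?dimv0//.
apply/seteqP; split=> y.
  move=> [k [p [w [px w1 ->]]]]; exists 0; rewrite ?addr0 /= ?mem0v//.
  rewrite (eq_bigr (fun i => w i *: x)) => [|i _]; last by rewrite px.
  by rewrite -scaler_suml w1 scale1r.
by move=> [z /=]; rewrite memv0 => /eqP -> <-; rewrite addr0; exact: sub_aff_hull.
Qed.

End bridge.

Section centered_slack.
Variables (R : realType) (n : nat).
Local Notation mR := (measurableTypeR R).
Local Notation leb := (lebesgue_rV R n.+1).

Lemma integrable_dotv (P : set 'rV[mR]_n.+1) M (u : 'rV[R]_n.+1) :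
  measurable P -> bdd_by M P -> (leb P < +oo)%E ->
  leb.-integrable P (EFin \o (dotv u : 'rV[mR]_n.+1 -> R)).
Proof.
move=> mP bP VP; apply: measurable_bounded_integrable => //.
  by apply: measurable_funTS; exact: measurable_dotv.
exists (\sum_j `|u ord0 j| * M); split; first exact: num_real.
move=> z Mz x Px; apply: le_trans (ltW Mz); rewrite /dotv /=.
apply: le_trans (ler_norm_sum _ _ _) _; apply: ler_sum => j _.
by rewrite normrM ler_wpM2l//; exact: bP.
Qed.

Lemma centered_dotv (P : set 'rV[R]_n.+1) M (u : 'rV[R]_n.+1) :
  measurable (P : set 'rV[mR]_n.+1) -> bdd_by M P -> (leb P < +oo)%E -> (0 < leb P)%E ->
  centered P -> (\int[leb]_(x in P) (dotv u x)%:E = 0)%E.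
Proof.
move=> mP bP VP V0 cP.
have V0' : (fine (vol P))^-1 != 0 :> R.
  by rewrite invr_neq0// gt_eqF// fine_gt0// V0 VP.
have int (v : 'rV[R]_n.+1) : leb.-integrable P (EFin \o (dotv v : 'rV[mR]_n.+1 -> R)).
  exact: integrable_dotv bP VP.
(* [centroid] is built from real-valued integrals, which are 0 by default for infinite ones;
   integrability turns the vanishing into one of extended reals. *)
have coord i : (\int[leb]_(x in P) (dotv (delta_mx 0 i) x)%:E = 0)%E.
  have fin := integrable_fin_num mP (int (delta_mx 0 i)).
  rewrite -(fineK fin); congr EFin.
  have /rowP/(_ i) := cP; rewrite /centroid !mxE => /eqP.
  rewrite mulf_eq0 (negbTE V0')/= => /eqP e; rewrite -[RHS]e /Rintegral; congr fine.
  by apply: eq_integral => x _; rewrite /= dotv_delta.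
have -> : u = \sum_i u 0 i *: delta_mx 0 i by exact: row_sum_delta.
elim/big_rec : _ => [|i v _ IH].
  under eq_integral do rewrite dotv0l.
  by rewrite integral0.
under eq_integral do rewrite dotvDl EFinD.
rewrite integralD_EFin//=.
rewrite IH adde0; under eq_integral do rewrite dotvZl EFinM.
by rewrite (integralZl mP (int _)) coord mule0.
Qed.

Lemma centered_slack m (a : 'I_m -> 'rV[R]_n.+1) M j :
  bdd_by M (polyhedron a) -> centered (polyhedron a) ->
  (\int[leb]_(x in polyhedron a) (slack a j x)%:E = leb (polyhedron a))%E.
Proof.
move=> bP cP; have mP := measurable_polyhedron a.
have V := pvolE bP.
have VP : (leb (polyhedron a) < +oo)%E by rewrite V ltry.
have V0 : (0 < leb (polyhedron a))%E by rewrite V lte_fin (pvol_gt0 bP).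
have int := integrable_dotv (a j) mP bP VP.
under eq_integral do rewrite /slack EFinB.
rewrite integralB_EFin//.
  rewrite integral_cst// mul1e (centered_dotv (a j) mP bP VP V0 cP).
  by rewrite sube0.
apply: measurable_bounded_integrable => //.
by exists 1; split=> // z z1 x _; rewrite /= normr1 ltW.
Qed.

End centered_slack.

Theorem theorem1p2 (R : realType) (n m : nat) (P : set 'rV[R]_n)
    (a : 'I_m -> 'rV[R]_n)
    (polyP : is_polytope P) (dimP : adim P = n%:Z) (centP : centered P)
    (irrP : irredundant_description a P) :
  (forall i : 'I_m,
     cone_volume_equality a P [set a i] <->
     pyramid_with_base P (facet_of P (a i))) /\
  (forall (v : 'rV[R]_n) (A : set 'rV[R]_n),
     is_vertex P v ->
     A = aff_hull [set a i | i in [set i | facet_of P (a i) v]] ->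
     is_hyperplane A /\
     (cone_volume_equality a P A <-> pyramid_with_apex P v)).
Proof.
case: n P a polyP dimP centP irrP => [|n] P a polyP dimP centP irrP.
  (* Dimension 0 is vacuous: the empty set, of dimension -1, is then a facet of P, and its index
     would give a nonzero vector of R^0. *)
  have [_ a0 _ facets] := irrP.
  suff /facets[i] : is_facet P set0 by have := a0 i; rewrite (thinmx0 (a i)) eqxx.
  split.
    exists 0, 1; split=> [x _|]; first by rewrite dotv0l ler01.
    by apply/seteqP; split=> // x [_ /=]; rewrite dotv0l => /eqP; rewrite eq_sym oner_eq0.
  rewrite dimP /adim ifT//; apply/asboolP/seteqP; split=> // x.
  by move=> [[|k] [p [w [p0 w1 _]]]]; [move: w1; rewrite big_ord0 => /esym/eqP; rewrite oner_eq0|have := p0 ord0].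
have PE := irredundant_polyhedron irrP.
have [M bP] := irredundant_bounded polyP irrP.
have fpt := facet_relative_interior dimP irrP.
have cP j : (\int[lebesgue_rV R n.+1]_(x in polyhedron a) (slack a j x)%:E =
    lebesgue_rV R n.+1 (polyhedron a))%E.
  by apply: centered_slack bP _; rewrite -PE.
have inja : injective a by have [] := irrP.
have VE : vol P = (pvol a)%:E by rewrite PE; exact: pvolE bP.
have coneE j : vol (cone_of P (a j)) = (svolume a j)%:E.
  by rewrite (cone_ofE polyP dimP irrP); exact: svolumeE bP j.
have n2 : n.+2%:R != 0 :> R by rewrite pnatr_eq0.
(* The equality with denominators cleared, k being dim A and [n.+2] the dimension of the space plus
   one. *)
have cveE A (Q : {pred 'I_m}) (k : nat) : (forall j, (a j \in A) = Q j) -> adim A = Posz k ->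
    cone_volume_equality a P A <->
    n.+2%:R * \sum_(j | Q j) svolume a j = k.+1%:R * pvol a.
  move=> AQ dA; rewrite /cone_volume_equality (eq_bigl _ _ AQ) dA VE.
  rewrite (eq_bigr _ (fun j _ => coneE j)) sumEFin -EFinM.
  have -> : ((Posz k + 1)%:~R : R) = k.+1%:R by rewrite -natr1 intrD.
  split=> [[->]|e]; first by rewrite mulrA mulrCA divff// mulr1.
  by congr EFin; apply: (mulfI n2); rewrite e mulrA mulrCA divff// mulr1.
split=> [i|v A vv AE].
  rewrite (cveE _ (pred1 i) 0%N); last 2 first.
  - move=> j /=; apply/idP/eqP => [/set_mem/inja//|->].
    by rewrite inE.
  - exact: adim_set1.
  rewrite big_pred1_eq mul1r (pyramid_with_baseE polyP dimP irrP); split=> [e|[v Pv iv]].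
    have P0 : P !=set0 by exists 0; rewrite PE; exact: polyhedron0.
    (* A point farthest from the i-th facet: maximizing -<a_i, x> maximizes [slack i]. *)
    have [v Pv vmax] := polytope_argmax (- a i) polyP P0.
    exists v => //; rewrite PE in Pv.
    apply: (ratio_sees_only bP fpt cP Pv _ e) => x; rewrite -PE => /vmax.
    by rewrite !dotvNl /slack; lra.
  by rewrite PE in Pv; exact: sees_only_ratio bP fpt cP i v Pv iv.
have Pv : P v by have [u0 [b [ub face]]] := vv; have : [set v] v by []; rewrite face => -[].
have AH : A = [set y | dotv v y = 1] by rewrite AE (vertex_hyperplane irrP vv).
have [hypA dA] := vertex_is_hyperplane irrP vv; rewrite -AH in hypA dA.
split=> //; rewrite (pyramid_with_apexE polyP dimP irrP Pv).
have Pv' : polyhedron a v by rewrite -PE.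
rewrite -(exists_sees_only bP fpt cP Pv').
rewrite (cveE _ (fun j => ~~ (0 < slack a j v)) n)//; last first.
  move=> j; have := (polyhedronP a v).1 Pv' j; rewrite AH.
  rewrite -leNgt => j0; apply/idP/idP => [/set_mem/=|j1].
    by rewrite dotvC /slack => ->; rewrite subrr.
  apply/mem_set => /=; rewrite dotvC; move: j0 j1; rewrite /slack => j0 j1.
  by apply/eqP; rewrite eq_le; apply/andP; split; lra.
(* S1 collects the facets missing v, S2 those through v. As S1 + S2 = pvol, both equalities say that
   S2 = (n+1) S1. *)
have := svolume_total bP fpt; rewrite (bigID (fun j => 0 < slack a j v))/=.
set S1 := \sum_(j | 0 < _) _; set S2 := \sum_(j | _) _ => tot.
rewrite -mulr_sumr -/S1 -tot -[n.+2%:R]natr1.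
by split=> h; lra.
Qed.
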